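(* If $W(x,0)$, $x\in\mathbb{R}$, is a stationary Gaussian process having a.s. continuously differentiable sample paths, then $$F^{\mathrm{space}}_{W_x}(w)=\frac{\mathsf{E}[W_x(0,0)^-\,\mathbf{1}_{\{W_x(0,0)\le w\}}\mid W(0,0)=0]\,f_{W(0,0)}(0)}{\mathsf{E}[W_x(0,0)^-\mid W(0,0)=0]\,f_{W(0,0)}(0)},\qquad w\in\mathbb{R},$$ where $x^-=\max(-x,0)$. Moreover, $$F^{\mathrm{space}}_{W_x}(w)=P(\sqrt{\lambda_{20}}\,R^-\le w),$$ where $R^-$ is a random variable having density $f_{R^-}(r)=-re^{-r^2/2}$, $r<0$.
   Context: Sea model (standing assumption): $W(x,t)$, $(x,t)\in\mathbb{R}^2$, is a real zero-mean stationary Gaussian field whose covariance function $R(\xi,\tau)=\mathsf{E}[W(x,t)W(x+\xi,t+\tau)]$ is $$R(\xi,\tau)=\int_0^\infty\int_0^{2\pi}\cos\Big(\omega\tau+\frac{\omega^2}{g}\xi\cos\theta\Big)S(\omega,\theta)\,d\theta\,d\omega,$$ where $S(\omega,\theta)$, $\omega>0$, $\theta\in[0,2\pi]$, is the directional spectral density and $g>0$ is the gravitational constant (the wave number is $\kappa(\omega)=\omega^2/g$). $W_x$ denotes the partial derivative in $x$. The spectral moments are $\lambda_{ij}=\int_0^\infty\int_0^{2\pi}(\kappa(\omega)\cos\theta)^i\omega^jS(\omega,\theta)\,d\theta\,d\omega$; in particular $\lambda_{00}=\mathrm{Var}(W(0,0))$ and $\lambda_{20}=\mathrm{Var}(W_x(0,0))$.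 The Gaussian vector $(W(0,0),W_x(0,0))$ is nondegenerate (has a density). Spatial Palm distribution of slope at wave centers (a wave center being a zero-downcrossing of $x\mapsto W(x,0)$): $$F^{\mathrm{space}}_{W_x}(w)=\frac{\mathsf{E}[\#\{x\in[0,1];\,W(x,0)=0,\ W_x(x,0)<0,\ W_x(x,0)\le w\}]}{\mathsf{E}[\#\{x\in[0,1];\,W(x,0)=0,\ W_x(x,0)<0\}]}.$$ Notation: $f_X$ is the density of $X$, and $\mathsf{E}[h\mid W(0,0)=0]f_{W(0,0)}(0)$ for $h=h(W_x(0,0))$ means the integral $\int h(z)f_{W_x(0,0),W(0,0)}(z,0)\,dz$. *)

(* Defs.v *)
From HB Require Import structures.
From mathcomp Require Import all_boot all_order all_algebra.
From mathcomp Require Import all_classical all_reals all_analysis.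

Set Implicit Arguments.
Unset Strict Implicit.
Unset Printing Implicit Defensive.

Import Order.TTheory GRing.Theory Num.Theory.
Import numFieldNormedType.Exports.

Local Open Scope classical_set_scope.
Local Open Scope ring_scope.

(* Normal law, possibly degenerate. The degenerate case is listed separately
   because the library's [normal_prob m 0] is not the Dirac mass at [m]. *)
Definition gaussian_law (R : realType) (law : set R -> \bar R) : Prop :=
  (exists m s : R, s != 0 /\
     forall A : set R, measurable A -> law A = normal_prob m s A) \/
  (exists m : R, forall A : set R, measurable A -> law A = \d_m A).

(* Every finite linear combination of values of the field is normal. *)
Definition gaussian_field (d : measure_display) (T : measurableType d)
    (R : realType) (P : probability T R) (W : R -> R -> {RV P >-> R}) : Prop :=
  forall (n : nat) (c : 'I_n -> R) (p : 'I_n -> R * R),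
    gaussian_law (fun A : set R =>
      P [set o | A (\sum_(i < n) c i * W (p i).1 (p i).2 o)]).

Definition zero_mean (d : measure_display) (T : measurableType d)
    (R : realType) (P : probability T R) (W : R -> R -> {RV P >-> R}) : Prop :=
  forall x t : R, ('E_P[W x t] = 0)%E.

(* Translation invariance of the finite-dimensional laws, tested on
   rectangles, which form a pi-system generating the product sigma-algebra. *)
Definition stationary_field (d : measure_display) (T : measurableType d)
    (R : realType) (P : probability T R) (W : R -> R -> {RV P >-> R}) : Prop :=
  forall (n : nat) (p : 'I_n -> R * R) (h k : R) (B : 'I_n -> set R),
    (forall i, measurable (B i)) ->
    P [set o | forall i, B i (W ((p i).1 + h) ((p i).2 + k) o)] =
    P [set o | forall i, B i (W (p i).1 (p i).2 o)].

Definition spectral_density (R : realType) (S : R -> R -> R) : Prop :=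
  measurable_fun (`]0, +oo[ `*` `[0, 2 * pi] : set (R * R))
    (fun p : R * R => S p.1 p.2) /\
  (forall om th : R, 0 < om -> 0 <= th <= 2 * pi -> 0 <= S om th).

Definition wave_number (R : realType) (g om : R) : R := om ^+ 2 / g.

Definition sea_covariance (R : realType) (g : R) (S : R -> R -> R)
    (xi tau : R) : \bar R :=
  (\int[lebesgue_measure]_(om in `]0%R, +oo[)
     \int[lebesgue_measure]_(th in `[0%R, (2 * pi)%R])
       (cos (om * tau + wave_number g om * xi * cos th) * S om th)%:E)%E.

Definition spectral_moment (R : realType) (g : R) (S : R -> R -> R)
    (i j : nat) : \bar R :=
  (\int[lebesgue_measure]_(om in `]0%R, +oo[)
     \int[lebesgue_measure]_(th in `[0%R, (2 * pi)%R])
       ((wave_number g om * cos th) ^+ i * om ^+ j * S om th)%:E)%E.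

(* W is a zero-mean stationary Gaussian field with covariance R(xi, tau). *)
Definition sea_model (d : measure_display) (T : measurableType d)
    (R : realType) (P : probability T R) (g : R) (S : R -> R -> R)
    (W : R -> R -> {RV P >-> R}) : Prop :=
  [/\ spectral_density S, gaussian_field W, zero_mean W, stationary_field W &
      forall x t xi tau : R,
        ('E_P[(W x t \* W (x + xi)%R (t + tau)%R)%R] =
         sea_covariance g S xi tau)%E].

(* W_x; where the sample path is not differentiable the value is arbitrary. *)
Definition x_derivative (d : measure_display) (T : measurableType d)
    (R : realType) (P : probability T R) (W : R -> R -> {RV P >-> R})
    (x t : R) (o : T) : R :=
  derive1 (fun y : R => W y t o) x.

Definition as_C1_in_x (d : measure_display) (T : measurableType d)
    (R : realType) (P : probability T R) (W : R -> R -> {RV P >-> R}) : Prop :=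
  {ae P, forall o : T,
    (forall x : R, derivable (fun y : R => W y 0 o) x 1) /\
    continuous (fun x : R => x_derivative W x 0 o)}.

(* The law of (X, Y) is written E[1_A(X, Y)]: W_x(0,0) is only almost surely
   equal to a measurable function, and the integral, unlike [P] applied to the
   event, does not depend on the values taken on a null set. *)
Definition joint_density (d : measure_display) (T : measurableType d)
    (R : realType) (P : probability T R) (X Y : T -> R) (f : R * R -> R)
    : Prop :=
  [/\ measurable_fun [set: R * R] f, (forall p : R * R, 0 <= f p) &
      forall A : set (R * R), measurable A ->
        (\int[P]_o (\1_A (X o, Y o))%:E =
         \int[lebesgue_measure \x lebesgue_measure]_(p in A) (f p)%:E)%E].

(* E[h(X) | Y = 0] f_Y(0), where f is the density of (X, Y). *)
Definition cond_mean_density0 (R : realType) (f : R * R -> R) (h : R -> R)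
    : \bar R :=
  (\int[lebesgue_measure]_z (h z * f (z, 0%R))%:E)%E.

Definition neg_part (R : realType) (x : R) : R := Num.max (- x) 0.

Definition wave_centers (d : measure_display) (T : measurableType d)
    (R : realType) (P : probability T R) (W : R -> R -> {RV P >-> R}) (o : T)
    : set R :=
  [set x | 0 <= x <= 1 /\ W x 0 o = 0 /\ x_derivative W x 0 o < 0].

(* F^space_{W_x}(w), a ratio of expected numbers of points. *)
Definition palm_slope_cdf (d : measure_display) (T : measurableType d)
    (R : realType) (P : probability T R) (W : R -> R -> {RV P >-> R}) (w : R)
    : \bar R :=
  ((\int[P]_o counting
      (wave_centers W o `&` [set x : R | (x_derivative W x 0 o <= w)%R])) /
   (\int[P]_o counting (wave_centers W o)))%E.

(* Density of R^- (the negative of a standard Rayleigh variable). *)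
Definition neg_rayleigh_pdf (R : realType) (r : R) : R :=
  if r < 0 then - r * expR (- (r ^+ 2) / 2) else 0.

(* Main.v *)
(* Rice's formula by discretization. On the dyadic grid of mesh h = 2^-n of
   [0, 1], count the cells over which W goes from a positive to a nonpositive
   value with difference quotient at most w. For fixed n the mean of this count
   is explicit: the half-sum and the difference quotient of two neighbouring
   values are uncorrelated, hence independent normal variables, and a crossing
   says that the half-sum lies in an interval of length h times the negative
   part of the quotient. This confines the mean between two Gaussian integrals
   with the same limit as n grows. For a continuously differentiable path with
   W(0, 0) <> 0 the counts, for slope thresholds slightly below and slightly
   above w, eventually enclose the number of downcrossings with slope at most
   w. The counts without slope restriction increase with n, which gives the
   domination needed to pass to the limit from above; Fatou's lemma does it from
   below.

   The variance of the difference quotients converges to lambda_20: almost sure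
   convergence of normal variables bounds their variances, so lambda_20 is
   finite by Fatou's lemma in the spectral integral, and then dominated
   convergence applies. Hence (W_x, W)(0, 0) has independent normal components,
   and a continuous density of it is the product of two normal densities. *)
Require Import Defs.
From HB Require Import structures.
From mathcomp Require Import all_boot all_order all_algebra.
From mathcomp Require Import all_classical all_reals all_analysis.
From mathcomp Require Import measurable_realfun ring lra.

Set Implicit Arguments.
Unset Strict Implicit.
Unset Printing Implicit Defensive.

Import Order.TTheory GRing.Theory Num.Theory.
Import numFieldNormedType.Exports HBNNSimple.

Local Open Scope classical_set_scope.
Local Open Scope ring_scope.

(** * Gaussian integrals *)

(** Gaussianity is given for linear combinations only, so joint laws are reached through the real
    numbers [E[cos (a X + b Y - c)]]. The phase [c] carries both parts of the characteristic
    function, and these numbers determine a planar law because the Gaussian kernel is itself such a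
    transform. Measurability of the number of wave centers is never established. Comparisons of
    counts are therefore pointwise off a null set, under an integral read as a supremum over simple
    functions, and limit theorems are applied only to crossing counts, which are measurable.
    Comparing zeros with crossings costs a little slope threshold. The two bounds meet because the
    limiting intensity is continuous in the threshold. Thresholds above 0 are cut down to 0, where
    the slope condition only says that the crossing is downward. A joint density makes both
    variances positive and [W 0 0] almost surely nonzero. Its continuity matters when it is
    evaluated on the line of height 0, which is Lebesgue null. *)

(** The fundamental theorem on each compact interval, then dominated convergence with [|f|] as
    bound. Two free sequences of endpoints cover both the whole line and a half-line closed on the
    right. *)
Lemma integral_FTC_exhaust (R : realType) (f F : R -> R) (D : set R)
    (a b : nat -> R) (l : R) :
  measurable D ->
  (forall x : R, is_derive x (1 : R) F (f x)) -> continuous f ->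
  lebesgue_measure.-integrable D (EFin \o f) ->
  (forall n, a n < b n) -> (forall n, `[a n, b n] `<=` D) ->
  (forall x, D x -> \forall n \near \oo, a n <= x <= b n) ->
  F (b n) - F (a n) @[n --> \oo] --> l ->
  (\int[lebesgue_measure]_(x in D) (f x)%:E = l%:E)%E.
Proof.
move=> mD dF cf intf ab abD Dab Fl.
pose g n := (EFin \o f) \_ `[a n, b n].
have mf : measurable_fun setT f by exact: continuous_measurable_fun.
have gE n : (\int[lebesgue_measure]_(x in D) g n x = (F (b n) - F (a n))%:E)%E.
  rewrite /g -integral_mkcondr setIidr //=.
  rewrite (@continuous_FTC2 _ f F) //.
  - exact/continuous_subspaceT.
  - have cF : continuous F.
      move=> x; apply: differentiable_continuous; apply/derivable1_diffP.
      exact: (@ex_derive _ _ _ _ _ _ _ (dF x)).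
    split=> [x _||].
    + exact: (@ex_derive _ _ _ _ _ _ _ (dF x)).
    + exact/cvg_at_right_filter/cF.
    + exact/cvg_at_left_filter/cF.
  - by move=> x _; rewrite derive1E; exact: (@derive_val _ _ _ _ _ _ _ (dF x)).
have gf x : D x -> g n x @[n --> \oo] --> (f x)%:E.
  move=> Dx; apply: cvg_near_cst; near=> n.
  rewrite /g patchE mem_set//= in_itv/=.
  by near: n; exact: Dab.
have [] := @dominated_convergence _ _ _ lebesgue_measure D mD g (EFin \o f)
  (abse \o (EFin \o f)).
- move=> n; apply/measurable_restrict => //.
  apply: measurableT_comp => //.
  exact: measurable_funS mf.
- apply: measurableT_comp => //.
  exact: measurable_funS mf.
- by apply: aeW => x Dx; exact: gf.
- exact: integrable_abse.
- apply: aeW => x n Dx /=; rewrite /g patchE; case: ifPn => //= _.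
  by rewrite lee_fin normr0.
move=> _ _; rewrite [X in X @ _ --> _](_ : _ = (fun n => (F (b n) - F (a n))%:E)).
  move=> H; apply/esym/(cvg_unique _ _ H) => //.
  apply: cvg_EFin => //; exact: nearW.
by apply/funext => n; exact: gE.
Unshelve. all: by end_near. Qed.

Lemma is_derive_normal_pdf (R : realType) (m s x : R) : s != 0 ->
  is_derive x (1 : R) (normal_pdf m s) (- ((x - m) / s ^+ 2) * normal_pdf m s x).
Proof.
move=> s0; rewrite normal_pdfE // /normal_fun.
have s20 : s ^+ 2 != 0 by rewrite expf_neq0.
have d1 : is_derive x (1 : R) (fun y : R => - (y - m) ^+ 2 / (s ^+ 2 *+ 2))
    (- ((x - m) / s ^+ 2)).
  have -> : (fun y : R => - (y - m) ^+ 2 / (s ^+ 2 *+ 2)) =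
      ((- (s ^+ 2 *+ 2)^-1) \*: ((id - cst m) ^+ 2) : R -> R).
    by apply/funext => y /=; rewrite mulNr mulrC -mulNr.
  apply: is_derive_eq.
  rewrite /= /GRing.scale/= subr0 mulr1 expr1 !fctE -mulr_natr.
  by field.
have d2 := is_derive1_comp (is_derive_expR _) d1.
apply: (@is_derive_eq _ _ _ _ _ _ _ _ (is_deriveZ (normal_peak s) d2)).
by rewrite /GRing.scale/= mulrCA mulrC -mulrA mulrCA.
Qed.

(** Half of the exponent absorbs the quadratic factor: with [y = (x - m)^2 / (4 s^2)] this is
    [y exp(-2y) <= exp(-y)], and the surviving half is a normal density of standard deviation
    [sqrt 2 * s]. *)
Lemma normal_pdf_sqr_le (R : realType) (m s x : R) : s != 0 ->
  (x - m) ^+ 2 * normal_pdf m s x <=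
  4 * s ^+ 2 * (normal_peak s / normal_peak (Num.sqrt 2 * s)) *
    normal_pdf m (Num.sqrt 2 * s) x.
Proof.
move=> s0.
have s2gt0 : 0 < s ^+ 2 by rewrite exprn_even_gt0.
have q0 : (Num.sqrt 2 * s : R) != 0.
  by rewrite mulf_neq0 // gt_eqF // sqrtr_gt0.
have P0 := normal_peak_gt0 s0; have P1 := normal_peak_gt0 q0.
rewrite !normal_pdfE // /normal_fun exprMn sqr_sqrtr //.
set y := (x - m) ^+ 2 / (4 * s ^+ 2).
have -> : - (x - m) ^+ 2 / (s ^+ 2 *+ 2) = - (y + y).
  by rewrite /y; field.
have -> : - (x - m) ^+ 2 / (2 * s ^+ 2 *+ 2) = - y.
  by rewrite /y -mulr_natr; field.
have -> : (x - m) ^+ 2 = 4 * s ^+ 2 * y.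
  by rewrite /y; field.
have y0 : 0 <= y by apply: divr_ge0; [exact: sqr_ge0 | rewrite mulr_ge0 ?sqr_ge0].
have -> : 4 * s ^+ 2 * (normal_peak s / normal_peak (Num.sqrt 2 * s)) *
    (normal_peak (Num.sqrt 2 * s) * expR (- y)) =
    4 * s ^+ 2 * normal_peak s * expR (- y).
  by field; rewrite gt_eqF.
rewrite opprD expRD.
have -> : 4 * s ^+ 2 * y * (normal_peak s * (expR (- y) * expR (- y))) =
    4 * s ^+ 2 * normal_peak s * expR (- y) * (y * expR (- y)) by ring.
rewrite ler_piMr //.
  by rewrite mulr_ge0 ?expR_ge0 // mulr_ge0 ?normal_peak_ge0 // mulr_ge0 ?sqr_ge0.
rewrite expRN ler_pdivrMr ?expR_gt0 // mul1r.
apply: le_trans (expR_ge1Dx _); lra.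
Qed.

Lemma integrable_normal_pdf_growth (R : realType) (m s K : R) (h : R -> R) :
  s != 0 -> measurable_fun setT h ->
  (forall x, `|h x| <= K * (1 + (x - m) ^+ 2)) ->
  lebesgue_measure.-integrable setT
    (fun x => (h x * normal_pdf m s x)%:E).
Proof.
move=> s0 mh hK.
set q := Num.sqrt 2 * s; set C := 4 * s ^+ 2 * (normal_peak s / normal_peak q).
have K0 : 0 <= K.
  have := le_trans (normr_ge0 _) (hK m).
  by rewrite subrr expr0n /= addr0 mulr1.
have iN z := @integrable_normal_pdf R m z.
have H1 := integrableD measurableT (iN s) (integrableZl measurableT C (iN q)).
have H2 := integrableZl measurableT K H1.
apply: (le_integrable measurableT _ _ H2) => //.
- apply/measurable_EFinP; apply: measurable_funM => //.
  exact: measurable_normal_pdf.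
- move=> x _; rewrite /= lee_fin.
  rewrite normrM (ger0_norm (normal_pdf_ge0 _ _ _)).
  apply: le_trans (ler_norm _).
  apply: (le_trans (ler_wpM2r (normal_pdf_ge0 _ _ _) (hK x))).
  rewrite -mulrA ler_wpM2l // mulrDl mul1r lerD2l.
  exact: normal_pdf_sqr_le.
Qed.

(** Meant for the boundary terms of an integration by parts; [e] is 1 or -1, so that both ends are
    treated at once. *)
Lemma cvg_normal_pdf_growth (R : realType) (m s : R) (e : R) : s != 0 ->
  e ^+ 2 = 1 ->
  ((1 + `|(e * n.+1%:R)|) * normal_pdf m s (m + e * n.+1%:R)) @[n --> \oo] --> (0 : R).
Proof.
move=> s0 e1.
have s2gt0 : 0 < s ^+ 2 by rewrite exprn_even_gt0.
have P0 := normal_peak_gt0 s0.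
have ne : `|e| = 1 by apply/eqP; rewrite -sqrp_eq1 // real_normK ?num_real ?e1.
(* With [k = n + 1], the bounds [1 + k <= 2 k] and [exp(k^2 / (2 s^2)) >= k^2 / (2 s^2)] produce the
   constant [4 s^2]. *)
apply: (@squeeze_cvgr _ _ _ _ (cst 0) (fun n => (4 * s ^+ 2 * normal_peak s) * n.+1%:R^-1)).
- near=> n; apply/andP; split.
    by rewrite mulr_ge0 ?normal_pdf_ge0 // addr_ge0.
  rewrite normal_pdfE // /normal_fun (addrC m) addrK exprMn e1 mul1r normrM ne mul1r ger0_norm //.
  set k : R := n.+1%:R.
  have k1 : 1 <= k by rewrite ler1n.
  rewrite mulNr expRN mulrCA.
  rewrite -[leRHS]mulrA [in leRHS]mulrCA.
  rewrite ler_pM2l //.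
  rewrite ler_pdivrMr ?expR_gt0 //.
  have := expR_ge1Dx (k ^+ 2 / (s ^+ 2 *+ 2)) => H.
  have H2 : k ^+ 2 / (s ^+ 2 *+ 2) <= expR (k ^+ 2 / (s ^+ 2 *+ 2)) by lra.
  have H3 : 4 * s ^+ 2 / k * (k ^+ 2 / (s ^+ 2 *+ 2)) = k + k.
    have k0 : k != 0 by rewrite gt_eqF //; lra.
    by move: (k) k0 => z z0; rewrite -mulr_natr; field; rewrite z0 s0.
  apply: (@le_trans _ _ (4 * s ^+ 2 / k * (k ^+ 2 / (s ^+ 2 *+ 2)))).
    by rewrite H3; lra.
  apply: ler_wpM2l H2; rewrite mulr_ge0 //.
    by rewrite mulr_ge0 // ltW.
  by rewrite invr_ge0; lra.
- exact: cvg_cst.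
- rewrite -[X in _ --> X](mulr0 (4 * s ^+ 2 * normal_peak s)).
  apply: cvgMr; exact: cvg_harmonic.
Unshelve. all: by end_near. Qed.

(** Stein's identity. The derivative of the density [p] is [- ((x - m) / s^2) p], so the difference
    of the two integrands is the derivative of [G p], which vanishes at both ends. The choice of [G]
    yields the mean, the variance and the differential equation of the cosine transform. *)
Lemma integral_normal_pdf_by_parts (R : realType) (m s K : R) (G G' : R -> R) :
  s != 0 -> (forall x : R, is_derive x (1 : R) G (G' x)) -> continuous G' ->
  (forall x, `|G x| <= K * (1 + `|x - m|)) -> (forall x, `|G' x| <= K) ->
  (\int[lebesgue_measure]_x (((x - m) / s ^+ 2 * G x) * normal_pdf m s x)%:E =
   \int[lebesgue_measure]_x (G' x * normal_pdf m s x)%:E)%E.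
Proof.
move=> s0 dG cG' GK G'K.
have K0 : 0 <= K by exact: le_trans (normr_ge0 _) (G'K m).
have cG : continuous G.
  move=> x; apply: differentiable_continuous; apply/derivable1_diffP.
  exact: (@ex_derive _ _ _ _ _ _ _ (dG x)).
have cp := @continuous_normal_pdf R m s s0.
have cxm : continuous (fun x : R => (x - m) / s ^+ 2).
  move=> x; apply: cvgM; last exact: cvg_cst.
  by apply: cvgB; [exact: cvg_id | exact: cvg_cst].
have i1 : lebesgue_measure.-integrable setT
    (fun x => (G' x * normal_pdf m s x)%:E).
  apply: (@integrable_normal_pdf_growth R m s K) => //.
    exact: continuous_measurable_fun.
  move=> x; apply: le_trans (G'K x) _.
  by rewrite ler_peMr // lerDl sqr_ge0.
have i2 : lebesgue_measure.-integrable setT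
    (fun x => (((x - m) / s ^+ 2 * G x) * normal_pdf m s x)%:E).
  apply: (@integrable_normal_pdf_growth R m s (2 * K / s ^+ 2)) => //.
    apply: continuous_measurable_fun => x.
    by apply: cvgM; [exact: cxm | exact: cG].
  move=> x; rewrite normrM normrM (ger0_norm (_ : 0 <= (s ^+ 2)^-1)); last first.
    by rewrite invr_ge0 sqr_ge0.
  rewrite [leLHS]mulrAC [leRHS]mulrAC ler_wpM2r ?invr_ge0 ?sqr_ge0 //.
  apply: le_trans (ler_wpM2l (normr_ge0 _) (GK x)) _.
  rewrite -(real_normK (num_real (x - m))).
  have := normr_ge0 (x - m); set y := `|x - m| => y0.
  have H : 0 <= K * (1 + (y - 1) ^+ 2 + 1 + y ^+ 2).
    rewrite mulr_ge0 // !addr_ge0 // sqr_ge0 //.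
  have : 0 <= K * (2 * (1 + y ^+ 2) - y * (1 + y)).
    apply: mulr_ge0 => //; nra.
  nra.
have H : (\int[lebesgue_measure]_x
    (G' x * normal_pdf m s x - ((x - m) / s ^+ 2 * G x) * normal_pdf m s x)%:E
    = 0%:E)%E.
  apply: (@integral_FTC_exhaust R _ (fun x => G x * normal_pdf m s x) setT
    (fun n => m + -1 * n.+1%:R) (fun n => m + 1 * n.+1%:R)) => //.
  - move=> x.
    apply: (@is_derive_eq _ _ _ _ _ _ _ _
      (is_deriveM (dG x) (@is_derive_normal_pdf R m s x s0))).
    by rewrite /GRing.scale/=; ring.
  - move=> x; apply: cvgB; apply: cvgM; [exact: cG'|exact: cp| |exact: cp].
    by apply: cvgM; [exact: cxm|exact: cG].
  - have := integrableB measurableT i1 i2.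
    by apply: eq_integrable => // x _; rewrite /= EFinB.
  - by move=> n; rewrite ltrD2l mulN1r mul1r gtrN.
  - move=> x _; near=> n.
    have : `|x - m| <= n.+1%:R.
      apply: (@le_trans _ _ n%:R); last by rewrite ler_nat.
      by near: n; exact: nbhs_infty_ger.
    rewrite ler_norml => /andP[h1 h2]; apply/andP; split; lra.
  - have cv e : e ^+ 2 = 1 -> G (m + e * n.+1%:R) * normal_pdf m s (m + e * n.+1%:R)
        @[n --> \oo] --> (0 : R).
      move=> e1.
      apply: norm_cvg0.
      apply: (@squeeze_cvgr _ _ _ _ (cst 0) (fun n => K *
        ((1 + `|(e * n.+1%:R)|) * normal_pdf m s (m + e * n.+1%:R)))).
      + near=> n; rewrite normr_ge0 /= normrM mulrA.
        rewrite (ger0_norm (normal_pdf_ge0 _ _ _)) ler_wpM2r ?normal_pdf_ge0 //.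
        apply: le_trans (GK _) _.
        by rewrite (addrC m) addrK.
      + exact: cvg_cst.
      + rewrite -[X in _ --> X](mulr0 K).
        by apply: cvgMr; exact: cvg_normal_pdf_growth.
    rewrite -[X in _ --> X](subr0 0).
    by apply: cvgB; apply: cv; rewrite ?sqrrN expr1n.
move: H; under eq_integral do rewrite EFinB.
rewrite integralB //.
have := integrable_fin_num measurableT i1; have := integrable_fin_num measurableT i2.
case: (integral _ _ _) => [a||] // _; case: (integral _ _ _) => [b||] // _ [].
by move/eqP; rewrite subr_eq0 => /eqP ->.
Unshelve. all: by end_near. Qed.

Lemma measurable_cos (R : realType) : measurable_fun [set: R] (@cos R).
Proof. by apply: continuous_measurable_fun; exact: continuous_cos. Qed.

(** Stein's identity with [G x = x - m]. *)
Lemma integral_normal_pdf_sqr (R : realType) (m s : R) : s != 0 ->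
  (\int[lebesgue_measure]_x ((x - m) ^+ 2 * normal_pdf m s x)%:E =
   (s ^+ 2)%:E)%E.
Proof.
move=> s0.
have := @integral_normal_pdf_by_parts R m s 1 (fun x => x - m) (cst 1) s0.
have -> : (\int[lebesgue_measure]_x ((cst 1 x : R) * normal_pdf m s x)%:E = 1)%E.
  by under eq_integral do rewrite /= mul1r; exact: integral_normal_pdf.
move=> H.
transitivity ((s ^+ 2)%:E * \int[lebesgue_measure]_x
    ((x - m) / s ^+ 2 * (x - m) * normal_pdf m s x)%:E)%E.
  rewrite -integralZl //.
    by apply: eq_integral => x _ /=; rewrite -EFinM; congr EFin; field.
  apply: (@integrable_normal_pdf_growth R m s (s ^+ 2)^-1) => //.
    apply: measurable_funM => //; last exact: measurable_funB.
    apply: measurable_funM => //; exact: measurable_funB.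
  move=> x; rewrite mulrAC -expr2 normrM.
  rewrite (ger0_norm (sqr_ge0 _)) mulrC ger0_norm ?invr_ge0 ?sqr_ge0 //.
  by rewrite ler_wpM2l ?invr_ge0 ?sqr_ge0 // lerDr.
rewrite (H _) ?mule1 //.
- by move=> x; apply: is_derive_eq; rewrite subr0.
- by move=> x; exact: cvg_cst.
- by move=> x; rewrite mul1r lerDr.
- by move=> x; rewrite normr1.
Qed.

(** Stein's identity with [G = 1]: the centered first moment vanishes. *)
Lemma integral_normal_pdf_mean (R : realType) (m s : R) : s != 0 ->
  (\int[lebesgue_measure]_x (x * normal_pdf m s x)%:E = m%:E)%E.
Proof.
move=> s0.
have := @integral_normal_pdf_by_parts R m s 1 (cst 1) (cst 0) s0.
have -> : (\int[lebesgue_measure]_x ((cst 0 x : R) * normal_pdf m s x)%:E = 0)%E.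
  by under eq_integral do rewrite /= mul0r; exact: integral0.
move=> H.
have i1 : lebesgue_measure.-integrable setT
    (fun x => ((x - m) / s ^+ 2 * 1 * normal_pdf m s x)%:E).
  apply: (@integrable_normal_pdf_growth R m s (s ^+ 2)^-1) => //.
    apply: measurable_funM => //; apply: measurable_funM => //.
    exact: measurable_funB.
  move=> x; rewrite mulr1 normrM mulrC ger0_norm ?invr_ge0 ?sqr_ge0 //.
  rewrite ler_wpM2l ?invr_ge0 ?sqr_ge0 //.
  rewrite -(real_normK (num_real (x - m))).
  move: `|x - m| (normr_ge0 (x - m)) => y y0; nra.
transitivity (m%:E * \int[lebesgue_measure]_x (normal_pdf m s x)%:E +
  (s ^+ 2)%:E * \int[lebesgue_measure]_x
    ((x - m) / s ^+ 2 * 1 * normal_pdf m s x)%:E)%E; last first.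
  rewrite integral_normal_pdf mule1 (H _) ?mule0 ?adde0 //.
  - by move=> x; exact: cvg_cst.
  - by move=> x; rewrite normr1 mul1r lerDl.
  - by move=> x; rewrite normr0.
have i2 := @integrable_normal_pdf R m s.
rewrite -integralZl // -integralZl // -integralD //; [|exact: integrableZl..].
by apply: eq_integral => x _ /=; rewrite -!EFinM -EFinD; congr EFin; field.
Qed.

(** As a function [K] of the frequency [v], the integral satisfies [K' = - s^2 v K]: differentiate
    under the integral sign and remove the factor [x - m] by Stein's identity with a sine. Hence
    [K v * exp((s v)^2 / 2)] is constant, equal to its value [cos c] at 0. *)
Lemma integral_cos_normal_pdf (R : realType) (m s u c : R) : s != 0 ->
  (\int[lebesgue_measure]_x (cos (u * (x - m) - c) * normal_pdf m s x)%:E =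
   (cos c * expR (- (s * u) ^+ 2 / 2))%:E)%E.
Proof.
move=> s0.
pose f (v x : R) : R := cos (v * (x - m) - c) * normal_pdf m s x.
pose df (v x : R) : R := - (x - m) * sin (v * (x - m) - c) * normal_pdf m s x.
pose K v := (\int[lebesgue_measure]_x f v x)%R.
have mlin v : measurable_fun [set: R] (fun x : R => v * (x - m) - c).
  apply: measurable_funB => //; apply: measurable_funM => //.
  exact: measurable_funB.
have intf v : lebesgue_measure.-integrable setT (EFin \o f v).
  apply: (@integrable_normal_pdf_growth R m s 1) => //.
    apply: measurableT_comp => //; exact: measurable_cos.
  move=> x; rewrite mul1r ler_norml; have := cos_max (v * (x - m) - c).
  rewrite ler_norml => /andP[h1 h2].
  have := sqr_ge0 (x - m) => h3; apply/andP; split; lra.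
have dfP v x : is_derive v (1 : R) (f ^~ x) (df v x).
  have d1 : is_derive v (1 : R) (fun v => v * (x - m) - c) (x - m).
    have -> : (fun v => v * (x - m) - c) = ((x - m) \*: id - cst c : R -> R).
      by apply/funext => y /=; rewrite ?fctE /= /GRing.scale/= mulrC.
    by apply: is_derive_eq; rewrite subr0 /GRing.scale/= mulr1.
  have d2 := is_derive1_comp (is_derive_cos _) d1.
  have -> : f ^~ x = (normal_pdf m s x \*: (cos \o (fun v => v * (x - m) - c))).
    by apply/funext => y; rewrite /f mulrC.
  by apply: is_derive_eq; rewrite /GRing.scale/= /df; ring.
have dfE v x : partial1of2 f v x = df v x.
  by rewrite partial1of2E; exact: (@derive_val _ _ _ _ _ _ _ (dfP v x)).
(* A bound for the derivative in [v] that is free of [v], as differentiation under the integral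
   demands. *)
pose G x := (1 + (x - m) ^+ 2) * normal_pdf m s x.
have G0 x : 0 <= G x by rewrite mulr_ge0 ?normal_pdf_ge0 // addr_ge0 ?sqr_ge0.
have mG : measurable_fun setT (fun x : R => 1 + (x - m) ^+ 2).
  apply: measurable_funD => //; apply: measurable_funX.
  exact: measurable_funB.
have intG : lebesgue_measure.-integrable setT (EFin \o G).
  apply: (@integrable_normal_pdf_growth R m s 1) => // x.
  by rewrite mul1r ger0_norm // addr_ge0 ?sqr_ge0.
have dG v x : `|df v x| <= G x.
  rewrite /df /G normrM (ger0_norm (normal_pdf_ge0 _ _ _)) ler_wpM2r ?normal_pdf_ge0 //.
  rewrite normrM normrN; have := sin_max (v * (x - m) - c).
  rewrite -(real_normK (num_real (x - m))).
  move: `|x - m| (normr_ge0 (x - m)) => y y0.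
  move: `|sin _| (normr_ge0 (sin (v * (x - m) - c))) => z z0 z1.
  nra.
have intdf v : lebesgue_measure.-integrable setT (EFin \o df v).
  apply: (le_integrable measurableT _ _ intG) => //.
    apply/measurable_EFinP; apply: measurable_funM; last exact: measurable_normal_pdf.
    apply: measurable_funM.
      by apply: measurableT_comp => //; exact: measurable_funB.
    apply: measurableT_comp; last exact: mlin.
    by apply: continuous_measurable_fun; exact: continuous_sin.
  by move=> x _; rewrite /= lee_fin (ger0_norm (G0 x)).
have dK v : is_derive v (1 : R) K (- (s ^+ 2 * v) * K v).
  have vI : `]v - 1, v + 1[%classic v.
    by rewrite /= in_itv /= ltrBlDr ltrDl ltr01.
  have H1 := @differentiation_under_integral R _ _ lebesgue_measure f setT
    measurableT v (v - 1) (v + 1) vI (fun x _ => intf x)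
    (fun x y _ _ => @ex_derive _ _ _ _ _ _ _ (dfP x y)) G G0 intG.
  have H2 := @derivable_under_integral R _ _ lebesgue_measure f setT
    measurableT v (v - 1) (v + 1) vI (fun x _ => intf x)
    (fun x y _ _ => @ex_derive _ _ _ _ _ _ _ (dfP x y)) G G0 intG.
  have B : forall x y : R, `]v - 1, v + 1[%classic x -> setT y ->
      `|partial1of2 f x y| <= G y by move=> x y _ _; rewrite dfE.
  apply: DeriveDef; first exact: H2.
  rewrite -derive1E H1 // {H1 H2 B}.
  have H : (\int[lebesgue_measure]_x
      (((x - m) / s ^+ 2 * sin (v * (x - m) - c)) * normal_pdf m s x)%:E =
      \int[lebesgue_measure]_x
      ((v * cos (v * (x - m) - c)) * normal_pdf m s x)%:E)%E.
    apply: (@integral_normal_pdf_by_parts R m s (1 + `|v|)) => //.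
    - move=> x.
      have d1 : is_derive x (1 : R) (fun x => v * (x - m) - c) v.
        have -> : (fun x => v * (x - m) - c) = (v \*: (id - cst m) - cst c : R -> R).
          by apply/funext => y /=; rewrite ?fctE.
        by apply: is_derive_eq; rewrite !subr0 /GRing.scale/= mulr1.
      have d2 := is_derive1_comp (is_derive_sin _) d1.
      by apply: is_derive_eq; rewrite /GRing.scale/= mulrC.
    - move=> x; apply: cvgM; first exact: cvg_cst.
      apply: continuous_comp; last exact: continuous_cos.
      apply: cvgB; last exact: cvg_cst.
      apply: cvgM; first exact: cvg_cst.
      by apply: cvgB; [exact: cvg_id|exact: cvg_cst].
    - move=> x; apply: le_trans (sin_max _) _.
      have := normr_ge0 v; have := normr_ge0 (x - m); nra.
    - move=> x; rewrite normrM.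
      have := cos_max (v * (x - m) - c); have := normr_ge0 v.
      have := normr_ge0 (cos (v * (x - m) - c)); nra.
  have i1 : lebesgue_measure.-integrable setT (fun x =>
      (((x - m) / s ^+ 2 * sin (v * (x - m) - c)) * normal_pdf m s x)%:E).
    have := integrableZl measurableT (- (s ^+ 2)^-1) (intdf v).
    by apply: eq_integrable => // x _; rewrite /= -EFinM /df; congr EFin; ring.
  rewrite /Rintegral.
  transitivity (fine ((- s ^+ 2)%:E * \int[lebesgue_measure]_x
     (((x - m) / s ^+ 2 * sin (v * (x - m) - c)) * normal_pdf m s x)%:E)%E).
    rewrite -integralZl //; congr fine; apply: eq_integral => x _.
    by rewrite dfE /df -EFinM; congr EFin; field.
  rewrite H /K /Rintegral.
  have -> : (\int[lebesgue_measure]_x (v * cos (v * (x - m) - c) * normal_pdf m s x)%:E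
      = v%:E * \int[lebesgue_measure]_x (f v x)%:E)%E.
    rewrite -integralZl //; last exact: intf.
    by apply: eq_integral => x _; rewrite -EFinM /f mulrA.
  have := integrable_fin_num measurableT (intf v).
  by case: (integral _ _ _) => [a||] // _ /=; rewrite mulrA mulNr.
have dL v : is_derive v (1 : R) (fun v => K v * expR ((s * v) ^+ 2 / 2)) 0.
  have d1 : is_derive v (1 : R) (fun v : R => (s * v) ^+ 2 / 2) (s ^+ 2 * v).
    have -> : (fun v : R => (s * v) ^+ 2 / 2) = ((s ^+ 2 / 2) \*: (id ^+ 2) : R -> R).
      by apply/funext => y /=; rewrite ?fctE /= /GRing.scale/= exprMn; ring.
    by apply: is_derive_eq; rewrite /GRing.scale/=; field.
  have d2 := is_derive1_comp (is_derive_expR _) d1.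
  apply: (@is_derive_eq _ _ _ _ _ _ _ _ (is_deriveM (dK v) d2)).
  by rewrite /GRing.scale/=; ring.
have := is_derive_0_is_cst u 0 dL.
rewrite mulr0 expr0n /= mul0r expR0 mulr1.
have -> : K 0 = cos c.
  rewrite /K /Rintegral /f.
  under eq_integral do rewrite mul0r sub0r cosN EFinM.
  rewrite integralZl //; last exact: integrable_normal_pdf.
  by rewrite integral_normal_pdf mule1.
move=> <-; rewrite -mulrA -expRD -mulrDl subrr mul0r expR0 mulr1.
rewrite /K /Rintegral fineK //.
exact: (integrable_fin_num measurableT (intf u)).
Qed.

(** * Integration against a density and against an image law *)

Lemma ge0_integral_density (d : measure_display) (T : measurableType d)
    (R : realType) (mu nu : {measure set T -> \bar R}) (p : T -> R)
    (f : T -> \bar R) :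
  measurable_fun setT p -> (forall x, 0 <= p x) ->
  (forall A, measurable A -> nu A = (\int[mu]_(x in A) (p x)%:E)%E) ->
  measurable_fun setT f -> (forall x, (0 <= f x)%E) ->
  (\int[nu]_x f x = \int[mu]_x (f x * (p x)%:E))%E.
Proof.
move=> mp p0 nuE mf f0.
(* By monotone convergence both sides are limits of their values at the simple functions [h n];
   linearity then leaves indicators, for which the claim is [nuE]. *)
pose h := nnsfun_approx measurableT mf.
have hf x : (EFin \o h n) x @[n --> \oo] --> f x.
  exact: cvg_nnsfun_approx.
have hnd x : {homo (fun n => (h n x)%:E) : a b / (a <= b)%N >-> (a <= b)%E}.
  by move=> a b ab; rewrite lee_fin; exact/lefP/nd_nnsfun_approx.
have mh n : measurable_fun setT (h n) by exact: measurable_funP.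
have -> : (\int[nu]_x f x = limn (fun n => \int[nu]_x (h n x)%:E))%E.
  under eq_integral => x _ do rewrite -(cvg_lim _ (hf x)) //.
  apply: monotone_convergence => //.
  - by move=> n; exact/measurable_EFinP.
  - by move=> n x _ /=; rewrite lee_fin.
  - by move=> x _; exact: hnd.
have -> : (\int[mu]_x (f x * (p x)%:E) =
    limn (fun n => \int[mu]_x ((h n x)%:E * (p x)%:E)))%E.
  have hfp x : ((h n x)%:E * (p x)%:E)%E @[n --> \oo] --> (f x * (p x)%:E)%E.
    by apply: cvgeZr => //; exact: hf.
  under eq_integral => x _ do rewrite -(cvg_lim _ (hfp x)) //.
  apply: monotone_convergence => //.
  - by move=> n; apply/emeasurable_funM; exact/measurable_EFinP.
  - by move=> n x _ /=; rewrite mule_ge0 ?lee_fin.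
  - by move=> x _ a b ab /=; rewrite lee_wpmul2r ?lee_fin ?p0 //; exact: hnd.
congr (limn _); apply/funext => n.
have indich r : measurable_fun setT (fun x => (r * \1_(h n @^-1` [set r]) x)%:E).
  by apply: measurableT_comp => //; exact: measurable_funM.
transitivity (\int[nu]_x
   (\sum_(y \in range (h n)) (y * \1_(h n @^-1` [set y]) x)%:E))%E.
  by apply: eq_integral => t _; rewrite /= fimfunE -fsumEFin.
rewrite ge0_integral_fsum //; last by move=> y x _; exact: nnfun_muleindic_ge0.
transitivity (\int[mu]_x (\sum_(y \in range (h n))
    (y * \1_(h n @^-1` [set y]) x)%:E * (p x)%:E))%E; last first.
  under eq_integral => x _.
    rewrite -ge0_mule_fsuml => [|y]; last exact: nnfun_muleindic_ge0.
    rewrite fsumEFin // -(fimfunE _ x); over.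
  by [].
rewrite ge0_integral_fsum //; last 2 first.
  - by move=> y; apply: emeasurable_funM => //; exact/measurable_EFinP.
  - by move=> y x _; apply: mule_ge0; [exact: nnfun_muleindic_ge0 | rewrite lee_fin].
apply: eq_fsbigr => r rhn.
have r0 : 0 <= r by move: rhn; rewrite inE => -[t _ <-].
have mA : measurable (h n @^-1` [set r]) by [].
under eq_integral do rewrite EFinM.
under [RHS]eq_integral do rewrite EFinM -muleA.
have mI : measurable_fun setT (fun x => (\1_(h n @^-1` [set r]) x)%:E : \bar R).
  by apply/measurable_EFinP; exact: measurable_indic.
rewrite ge0_integralZl //.
rewrite [RHS]ge0_integralZl //; last 2 first.
  - by apply: emeasurable_funM => //; exact/measurable_EFinP.
  - by move=> x _; rewrite mule_ge0 ?lee_fin.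
congr (_ * _)%E; rewrite integral_indic // setIT nuE //.
rewrite [LHS]integral_mkcond; apply: eq_integral => x _.
by rewrite epatch_indic /= muleC.
Qed.

Lemma integral_density (d : measure_display) (T : measurableType d)
    (R : realType) (mu nu : {measure set T -> \bar R}) (p : T -> R)
    (f : T -> \bar R) :
  measurable_fun setT p -> (forall x, 0 <= p x) ->
  (forall A, measurable A -> nu A = (\int[mu]_(x in A) (p x)%:E)%E) ->
  measurable_fun setT f ->
  (\int[nu]_x f x = \int[mu]_x (f x * (p x)%:E))%E.
Proof.
move=> mp p0 nuE mf; rewrite integralE [RHS]integralE; congr (_ - _)%E.
- rewrite (ge0_integral_density _ p0 nuE) //; last exact: measurable_funepos.
  apply: eq_integral => x _; rewrite !funeposE.
  rewrite maxe_pMl ?mul0e ?lee_fin //.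
- rewrite (ge0_integral_density _ p0 nuE) //; last exact: measurable_funeneg.
  apply: eq_integral => x _; rewrite !funenegE.
  by rewrite maxe_pMl ?mul0e ?lee_fin // mulNe.
Qed.

Lemma integral_normal_prob (R : realType) (m s : R) (f : R -> \bar R) :
  measurable_fun setT f ->
  (\int[normal_prob m s]_x f x =
   \int[lebesgue_measure]_x (f x * (normal_pdf m s x)%:E))%E.
Proof.
move=> mf; apply: integral_density => //.
  exact: measurable_normal_pdf.
exact: normal_pdf_ge0.
Qed.

Lemma integral_image_law (d d' : measure_display) (T : measurableType d)
    (T' : measurableType d') (R : realType) (mu : {measure set T -> \bar R})
    (nu : {measure set T' -> \bar R}) (phi : T -> T') (f : T' -> \bar R) :
  measurable_fun setT phi ->
  (forall A, measurable A -> mu (phi @^-1` A) = nu A) ->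
  measurable_fun setT f ->
  (\int[mu]_x f (phi x) = \int[nu]_y f y)%E.
Proof.
move=> mphi lawE mf.
have ge0 (h : T' -> \bar R) : measurable_fun setT h -> (forall y, (0 <= h y)%E) ->
    (\int[mu]_x h (phi x) = \int[nu]_y h y)%E.
  move=> mh h0.
  rewrite -(@eq_measure_integral _ _ _ setT nu (pushforward mu phi)).
    by rewrite (ge0_integral_pushforward mphi).
  by move=> A mA _; exact: lawE.
rewrite integralE [RHS]integralE; congr (_ - _)%E.
- rewrite -ge0 //; last exact: measurable_funepos.
  by apply: eq_integral => x _; rewrite !funeposE.
- rewrite -ge0 //; last exact: measurable_funeneg.
  by apply: eq_integral => x _; rewrite !funenegE.
Qed.

(** The Dirac case fits the same two formulas with [s = 0], so the alternative in [gaussian_law]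
    disappears from here on. In either case the vanishing mean forces the parameter [m] to be 0. *)
Lemma gaussian_law_centered (d : measure_display) (T : measurableType d)
    (R : realType) (P : probability T R) (V : T -> R) :
  measurable_fun setT V ->
  gaussian_law (fun A : set R => P [set o | A (V o)]) ->
  (\int[P]_o (V o)%:E = 0)%E ->
  exists s : R, (\int[P]_o (V o ^+ 2)%:E = (s ^+ 2)%:E)%E /\
    forall c, (\int[P]_o (cos (V o - c))%:E = (cos c * expR (- s ^+ 2 / 2))%:E)%E.
Proof.
move=> mV gV V0.
have msq : measurable_fun setT (fun x : measurableTypeR R => (x ^+ 2)%:E : \bar R).
  by apply/measurable_EFinP; exact: measurable_funX.
have mcos c : measurable_fun setT (fun x : measurableTypeR R => (cos (x - c))%:E : \bar R).
  apply/measurable_EFinP; apply: measurableT_comp; first exact: measurable_cos.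
  exact: measurable_funB.
have mid : measurable_fun setT (fun x : measurableTypeR R => x%:E : \bar R).
  exact/measurable_EFinP.
case: gV => [[m [s [s0 E]]] | [m E]].
- have lawE (f : measurableTypeR R -> \bar R) : measurable_fun setT f ->
      (\int[P]_o f (V o) = \int[normal_prob m s]_x f x)%E.
    by move=> mf; apply: integral_image_law.
  have m0 : m = 0.
    move: V0; rewrite (lawE EFin) // integral_normal_prob //.
    by rewrite (integral_normal_pdf_mean m s0) => -[].
  subst m; exists s; split.
    rewrite (lawE (fun x => (x ^+ 2)%:E)) // integral_normal_prob //.
    rewrite -(integral_normal_pdf_sqr 0 s0).
    by apply: eq_integral => x _; rewrite subr0 EFinM.
  move=> c; rewrite (lawE _ (mcos c)) (integral_normal_prob _ _ (mcos c)).
  rewrite -[in RHS](mulr1 s) -(integral_cos_normal_pdf 0 1 c s0).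
  by apply: eq_integral => x _; rewrite subr0 mul1r EFinM.
- have lawE (f : measurableTypeR R -> \bar R) : measurable_fun setT f ->
      (\int[P]_o f (V o) = f m)%E.
    move=> mf; transitivity (\int[\d_(m : measurableTypeR R)]_x f x)%E.
      by apply: integral_image_law.
    by rewrite integral_dirac // diracT mul1e.
  have m0 : m = 0 by move: V0; rewrite (lawE EFin) // => -[].
  subst m; exists 0; split.
    by rewrite (lawE (fun x => (x ^+ 2)%:E)) // expr0n.
  move=> c; rewrite (lawE _ (mcos c)) sub0r cosN.
  by rewrite expr0n /= oppr0 mul0r expR0 mulr1.
Qed.

(** * Planar laws are determined by their cosine transforms *)

(** Chebyshev's inequality. *)
Lemma normal_prob_far_le (R : realType) (m s e : R) (A : set R) :
  s != 0 -> 0 < e -> measurable A -> (forall x, A x -> e <= `|x - m|) ->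
  (normal_prob m s A <= (s ^+ 2 / e ^+ 2)%:E)%E.
Proof.
move=> s0 e0 mA Ae.
have e20 : 0 < e ^+ 2 by rewrite exprn_gt0.
have mp := @measurable_normal_pdf R m s.
have mq : measurable_fun setT (fun x : R => (x - m) ^+ 2).
  by apply: measurable_funX; exact: measurable_funB.
apply: (@le_trans _ _ (\int[lebesgue_measure]_x
    ((e ^+ 2)^-1%:E * ((x - m) ^+ 2 * normal_pdf m s x)%:E))%E).
  rewrite /normal_prob integral_mkcond; apply: ge0_le_integral => //.
  - move=> x _; rewrite patchE; case: ifPn => // _.
    by rewrite lee_fin normal_pdf_ge0.
  - apply/(measurable_restrictT _ _).1 => //.
    by apply: measurable_funTS; exact/measurable_EFinP.
  - apply: measurable_funeM; apply/measurable_EFinP; exact: measurable_funM.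
  - move=> x _; rewrite -EFinM patchE; case: ifPn => [|_]; last first.
      by rewrite lee_fin mulr_ge0 ?invr_ge0 ?sqr_ge0 // mulr_ge0 ?sqr_ge0 ?normal_pdf_ge0.
    rewrite inE => /Ae ex; rewrite lee_fin mulrA.
    rewrite ler_peMl ?normal_pdf_ge0 // mulrC ler_pdivlMr // mul1r.
    rewrite -(real_normK (num_real (x - m))) ler_sqr // nnegrE; exact: ltW.
rewrite ge0_integralZl //.
- by rewrite integral_normal_pdf_sqr // -EFinM lee_fin mulrC.
- by apply/measurable_EFinP; exact: measurable_funM.
- by move=> x _; rewrite lee_fin mulr_ge0 ?sqr_ge0 ?normal_pdf_ge0.
- by rewrite lee_fin invr_ge0 ltW.
Qed.

(* The bound is moved by more than the width of the kernel, so that the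
   smoothed indicator also tends to [0] at the endpoint [a]. *)
Lemma cvg_normal_prob_ray (R : realType) (a x : R) :
  normal_prob x (n.+1%:R ^- 2) `]-oo, a - n.+1%:R^-1[ @[n --> \oo] -->
  ((\1_(`]-oo, a[) x)%:E : \bar R).
Proof.
have e0 n : (n.+1%:R ^- 2 : R) != 0 by rewrite invr_eq0 expf_neq0.
have inv0 : (n.+1%:R^-1 : R) @[n --> \oo] --> (0 : R) by exact: cvg_harmonic.
have inv2 : (n.+1%:R^-1 : R) ^+ 2 @[n --> \oo] --> (0 : R).
  by rewrite -(mulr0 (0 : R)); under eq_fun do rewrite expr2; exact: cvgM.
have inv4 : (n.+1%:R^-1 : R) ^+ 4 @[n --> \oo] --> (0 : R).
  rewrite -(mulr0 (0 : R)); under eq_fun do rewrite (exprD _ 2 2).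
  exact: cvgM.
rewrite indicE; have [xa|ax] := ltP x a; last first.
  rewrite memNset ?in_itv /= ?ltNge ?ax //=; last first.
    by rewrite in_itv /= ltNge ax.
  (* The shifted ray is at distance at least [1/(n+1)] from [x], and the standard deviation is the
     square of that distance; Chebyshev leaves [(n+1)^-2]. *)
  apply: (@squeeze_cvge _ _ _ _ (cst 0%E) _ (fun n => ((n.+1%:R^-1 : R) ^+ 2)%:E)).
  - near=> n; rewrite measure_ge0 /=.
    apply: le_trans (normal_prob_far_le (e := n.+1%:R^-1) _ _ _ _) _ => //.
    + move=> y; rewrite /= in_itv /= => yn.
      have : 0 < (n.+1%:R^-1 : R) by rewrite invr_gt0.
      move: yn; move: (n.+1%:R^-1 : R) => z yn i0.
      have yx : y - x <= 0 by lra.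
      by rewrite (ler0_norm yx); lra.
    + rewrite lee_fin le_eqVlt; apply/orP; left; apply/eqP.
      by field.
  - exact: cvg_cst.
  - by apply: cvg_EFin; [exact: nearW|exact: inv2].
rewrite mem_set ?in_itv //=.
(* Half of the gap pays for the shift of the ray, the other half is the distance in Chebyshev's
   inequality for the complement. *)
pose d := (a - x) / 2; have d0 : 0 < d by rewrite divr_gt0 // subr_gt0.
apply: (@squeeze_cvge _ _ _ _ (fun n => (1 - (n.+1%:R^-1) ^+ 4 / d ^+ 2)%:E) _ (cst 1%E)).
- near=> n; rewrite probability_le1 // andbT.
  have nd : n.+1%:R^-1 <= d.
    by near: n; exact: (cvgr_le _ inv0).
  have mA : measurable (`]-oo, a - n.+1%:R^-1[%classic : set (measurableTypeR R)).
    by [].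
  have := probability_setC (normal_prob x (n.+1%:R ^- 2)) mA.
  move=> E.
  have : (normal_prob x (n.+1%:R ^- 2) (~` `]-oo, (a - n.+1%:R^-1)%R[%classic) <=
      ((n.+1%:R ^- 2) ^+ 2 / d ^+ 2)%:E)%E.
    apply: (normal_prob_far_le (e0 n) d0 (measurableC mA)) => y /=; rewrite in_itv /= => /negP; rewrite -leNgt => ay.
    move: nd ay; rewrite /d; move: (n.+1%:R^-1 : R) => z nd ay.
    have yx : 0 <= y - x by lra.
    by rewrite (ger0_norm yx); lra.
  have -> : (n.+1%:R ^- 2) ^+ 2 / d ^+ 2 = n.+1%:R^-1 ^+ 4 / d ^+ 2 :> R.
    by congr (_ / _); rewrite -exprVn -exprM.
  rewrite E EFinB leeBlDr; last exact: (fin_num_measure (normal_prob _ _) _ mA).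
  by rewrite leeBlDr // addeC.
- rewrite -[X in _ --> X]/(1%:E) -[in X in _ --> X](subr0 1).
  apply: cvg_EFin; first exact: nearW.
  apply: cvgB; first exact: cvg_cst.
  rewrite -[X in _ --> X](mul0r (d ^+ 2)^-1); apply: cvgMl.
  exact: inv4.
- exact: cvg_cst.
Unshelve. all: by end_near. Qed.

Lemma measurable_fst_snd (d1 d2 d3 d4 : measure_display) (T1 : measurableType d1)
    (T2 : measurableType d2) (T3 : measurableType d3) (T4 : measurableType d4) :
  [/\ measurable_fun setT (fun z : (T1 * T2) * (T3 * T4) => z.1.1),
      measurable_fun setT (fun z : (T1 * T2) * (T3 * T4) => z.1.2),
      measurable_fun setT (fun z : (T1 * T2) * (T3 * T4) => z.2.1) &
      measurable_fun setT (fun z : (T1 * T2) * (T3 * T4) => z.2.2)].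
Proof.
by split; [exact: (measurableT_comp measurable_fst measurable_fst)
  |exact: (measurableT_comp measurable_snd measurable_fst)
  |exact: (measurableT_comp measurable_fst measurable_snd)
  |exact: (measurableT_comp measurable_snd measurable_snd)].
Qed.

Lemma bounded_probability_integrable (d : measure_display) (T : measurableType d)
    (R : realType) (P : probability T R) (f : T -> R) (K : R) :
  measurable_fun setT f -> (forall x, `|f x| <= K) ->
  P.-integrable setT (EFin \o f).
Proof.
move=> mf fK; apply: measurable_bounded_integrable => //.
- by rewrite (le_lt_trans (probability_le1 _ _)) // ltry.
- by exists K; split; [exact: num_real|] => x Kx t _; apply: le_trans (fK t) (ltW Kx).
Qed.

Definition normal_pair (R : realType) (s t : R) :
    probability (measurableTypeR R * measurableTypeR R)%type R :=
  (normal_prob 0 s \x normal_prob 0 t)%E.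

(** For fixed first coordinate [x] the integrand is a cosine in the second one with phase [c - u x].
    The free phase thus lets the one-dimensional formula be applied twice, with no appeal to
    sines. *)
Lemma integral_cos_normal_pair (R : realType) (s t u v c : R) :
  s != 0 -> t != 0 ->
  (\int[normal_pair s t]_q (cos (u * q.1 + v * q.2 - c))%:E =
   (cos c * (expR (- (s * u) ^+ 2 / 2) * expR (- (t * v) ^+ 2 / 2)))%:E)%E.
Proof.
move=> s0 t0.
have mcos : measurable_fun setT
    (fun q : measurableTypeR R * measurableTypeR R => cos (u * q.1 + v * q.2 - c)).
  apply: measurableT_comp; first exact: measurable_cos.
  apply: measurable_funB => //.
  by apply: measurable_funD; apply: measurable_funM.
rewrite -(integral12_prod_meas1 (f := fun q : measurableTypeR R * measurableTypeR R =>
  (cos (u * q.1 + v * q.2 - c))%:E)); last first.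
  apply: (@bounded_probability_integrable _ _ R _ _ 1) => // q; exact: cos_max.
rewrite /fubini_F /=.
have inner (r w b : R) : r != 0 -> (\int[normal_prob 0 r]_y (cos (w * y - b))%:E =
    (cos b * expR (- (r * w) ^+ 2 / 2))%:E)%E.
  move=> r0; rewrite integral_normal_prob; last first.
    apply/measurable_EFinP; apply: measurableT_comp; first exact: measurable_cos.
    by apply: measurable_funB => //; apply: measurable_funM.
  rewrite -(integral_cos_normal_pdf 0 w b r0).
  by apply: eq_integral => y _; rewrite subr0 EFinM.
under eq_integral => x _.
  rewrite (_ : (fun y : R => _) = (fun y => (cos (v * y - (c - u * x)))%:E)); last first.
    by apply/funext => y; congr (cos _)%:E; ring.
  rewrite inner // -cosN opprB EFinM muleC; over.
rewrite integralZl //; first by rewrite inner // -EFinM; congr EFin; ring.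
apply: (@bounded_probability_integrable _ _ R _ _ 1) => [|x]; last exact: cos_max.
apply: measurableT_comp; first exact: measurable_cos.
by apply: measurable_funB => //; apply: measurable_funM.
Qed.

Lemma measurable_cos_affine (d : measure_display) (T : measurableType d)
    (R : realType) (e x y : R) (a b s t : T -> R) :
  measurable_fun setT a -> measurable_fun setT b ->
  measurable_fun setT s -> measurable_fun setT t ->
  measurable_fun setT (fun z => cos ((a z - x) / e * s z + (b z - y) / e * t z - 0)).
Proof.
move=> ma mb ms mt.
apply: measurableT_comp; first exact: measurable_cos.
apply: measurable_funB => //.
by apply: measurable_funD; apply: measurable_funM => //; apply: measurable_funM => //;
  exact: measurable_funB.
Qed.

(** The Gaussian kernel is its own cosine transform: its value at [p] is the mean of a cosine under
    [normal_pair 1 1]. Exchanging the integrals expresses the mass of [m] smoothed at [(x, y)]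
    through cosine transforms of [m] alone. *)
Lemma gaussian_smoothing_fubini (R : realType)
    (m : probability (measurableTypeR R * measurableTypeR R)%type R) (e x y : R) :
  (\int[m]_p (expR (- ((p.1 - x) / e) ^+ 2 / 2) *
              expR (- ((p.2 - y) / e) ^+ 2 / 2))%:E =
   \int[normal_pair 1 1]_q
     \int[m]_p (cos (q.1 / e * p.1 + q.2 / e * p.2 -
                     (q.1 / e * x + q.2 / e * y)))%:E)%E.
Proof.
have one_neq0 : (1 : R) != 0 by [].
have E (u v : R) : (expR (- u ^+ 2 / 2) * expR (- v ^+ 2 / 2))%:E =
    (\int[normal_pair 1 1]_q (cos (u * q.1 + v * q.2 - 0))%:E)%E.
  by rewrite integral_cos_normal_pair // cos0 !mul1r.
under eq_integral do rewrite E.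
pose f (z : (measurableTypeR R * measurableTypeR R) *
            (measurableTypeR R * measurableTypeR R)) : R :=
  cos ((z.1.1 - x) / e * z.2.1 + (z.1.2 - y) / e * z.2.2 - 0).
have mf : measurable_fun setT f.
  have [m1 m2 m3 m4] := measurable_fst_snd (measurableTypeR R) (measurableTypeR R)
    (measurableTypeR R) (measurableTypeR R).
  exact: (measurable_cos_affine e x y m1 m2 m3 m4).
rewrite (Fubini (m1 := m) (m2 := normal_pair 1 1)
  (f := EFin \o f)); last first.
  apply: (@bounded_probability_integrable _ _ R _ _ 1) => // z; exact: cos_max.
apply: eq_integral => q _; apply: eq_integral => p _; congr (cos _)%:E.
by rewrite /=; ring.
Qed.

Lemma normal_pdfC (R : realType) (s x y : R) :
  s != 0 -> normal_pdf x s y = normal_pdf y s x.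
Proof.
by move=> s0; rewrite !normal_pdfE // /normal_fun -sqrrN opprB.
Qed.

Lemma measurable_normal_pdf2 (d : measure_display) (T : measurableType d)
    (R : realType) (s : R) (a b : T -> R) : s != 0 ->
  measurable_fun setT a -> measurable_fun setT b ->
  measurable_fun setT (fun z => normal_pdf (a z) s (b z)).
Proof.
move=> s0 ma mb; have -> : (fun z => normal_pdf (a z) s (b z)) =
    (fun z => normal_peak s * expR (- (b z - a z) ^+ 2 / (s ^+ 2 *+ 2))).
  by apply/funext => z; rewrite normal_pdfE.
apply: measurable_funM => //; apply: measurableT_comp => //.
apply: measurable_funM => //; apply: measurableT_comp => //.
by apply: measurable_funX; exact: measurable_funB.
Qed.

(** The kernel is symmetric in center and argument, so smoothing the indicator of [A] amounts to
    integrating over [A] the mass smoothed at each point. The weight [c] allows a second use for the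
    other coordinate of a rectangle. *)
Lemma normal_prob_tonelli (d : measure_display) (T : measurableType d)
    (R : realType) (m : probability T R) (s : R) (c : T -> \bar R) (a : T -> R)
    (A : set R) :
  s != 0 -> measurable A ->
  measurable_fun setT c -> (forall p, (0 <= c p)%E) -> measurable_fun setT a ->
  measurable_fun setT (fun p => normal_prob (a p) s A) /\
  (\int[m]_p (c p * normal_prob (a p) s A) =
   \int[lebesgue_measure]_(x in A) \int[m]_p (c p * (normal_pdf x s (a p))%:E))%E.
Proof.
move=> s0 mA mc c0 ma.
pose k (z : T * measurableTypeR R) : \bar R :=
  ((normal_pdf (a z.1) s z.2)%:E * (\1_A z.2)%:E)%E.
have mk : measurable_fun setT k.
  apply: emeasurable_funM; apply/measurable_EFinP.
    by apply: measurable_normal_pdf2 => //; exact: measurableT_comp.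
  apply: measurableT_comp => //; exact: measurable_indic.
have k0 z : (0 <= k z)%E by rewrite mule_ge0 ?lee_fin ?normal_pdf_ge0.
have kE p : (normal_prob (a p) s A = \int[lebesgue_measure]_x k (p, x))%E.
  rewrite /normal_prob integral_mkcond; apply: eq_integral => x _.
  by rewrite epatch_indic.
have mN : measurable_fun setT (fun p => normal_prob (a p) s A).
  rewrite (_ : (fun p => _) = fubini_F lebesgue_measure k); last first.
    by apply/funext => p; rewrite kE.
  exact: measurable_fun_fubini_tonelli_F.
split=> //.
pose f (z : T * measurableTypeR R) : \bar R := (c z.1 * k z)%E.
have mf : measurable_fun setT f.
  by apply: emeasurable_funM => //; exact: measurableT_comp.
have f0 z : (0 <= f z)%E by exact: mule_ge0.
transitivity (\int[m]_p \int[lebesgue_measure]_x f (p, x))%E.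
  apply: eq_integral => p _; rewrite kE -ge0_integralZl //.
  - exact: measurableT_comp mk _.
rewrite (fubini_tonelli f mf f0) [RHS]integral_mkcond; apply: eq_integral => x _.
rewrite patchE; case: ifPn => [/set_mem xA|/negP xA].
  apply: eq_integral => p _; rewrite /f /k /= indicE mem_set // mule1.
  by rewrite (normal_pdfC x _ s0).
rewrite integral0_eq // => p _; rewrite /f /k /= indicE memNset ?mule0 //.
by move=> Ax; apply: xA; rewrite inE.
Qed.

Lemma smoothed_rectangle_eq (R : realType)
    (m1 m2 : probability (measurableTypeR R * measurableTypeR R)%type R)
    (s : R) (A B : set R) :
  (forall a b c : R, (\int[m1]_p (cos (a * p.1 + b * p.2 - c))%:E =
                      \int[m2]_p (cos (a * p.1 + b * p.2 - c))%:E)%E) ->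
  s != 0 -> measurable A -> measurable B ->
  (\int[m1]_p (normal_prob p.2 s B * normal_prob p.1 s A) =
   \int[m2]_p (normal_prob p.2 s B * normal_prob p.1 s A))%E.
Proof.
move=> cosE s0 mA mB.
have m1fst : measurable_fun setT (fst : measurableTypeR R * measurableTypeR R -> R).
  exact: measurable_fst.
have m2snd : measurable_fun setT (snd : measurableTypeR R * measurableTypeR R -> R).
  exact: measurable_snd.
have mN : measurable_fun setT (fun p : measurableTypeR R * measurableTypeR R =>
    normal_prob p.2 s B).
  by have [] := @normal_prob_tonelli _ _ R m1 s (cst 0%E) snd B s0 mB
    (measurable_cst _) (fun=> lexx _) m2snd.
have key (m : probability (measurableTypeR R * measurableTypeR R)%type R) :
  (\int[m]_p (normal_prob p.2 s B * normal_prob p.1 s A) =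
   \int[lebesgue_measure]_(x in A) \int[lebesgue_measure]_(y in B)
   ((normal_peak s * normal_peak s)%:E *
    \int[m]_p (expR (- ((p.1 - x) / s) ^+ 2 / 2) *
              expR (- ((p.2 - y) / s) ^+ 2 / 2))%:E))%E.
  have [_ ->] := @normal_prob_tonelli _ _ R m s _ fst A s0 mA mN
    (fun p => measure_ge0 _ _) m1fst.
  apply: eq_integral => x _.
  have mc : measurable_fun setT (fun p : measurableTypeR R * measurableTypeR R =>
      (normal_pdf x s p.1)%:E : \bar R).
    by apply/measurable_EFinP; exact: measurable_normal_pdf2.
  have c0 (p : measurableTypeR R * measurableTypeR R) :
      (0 <= (normal_pdf x s p.1)%:E :> \bar R)%E.
    by rewrite lee_fin normal_pdf_ge0.
  under eq_integral do rewrite muleC.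
  have [_ ->] := @normal_prob_tonelli _ _ R m s _ snd B s0 mB mc c0 m2snd.
  apply: eq_integral => y _.
  rewrite -ge0_integralZl //.
  - apply: eq_integral => p _; rewrite -!EFinM; congr EFin.
    rewrite !normal_pdfE // /normal_fun mulrACA.
    by congr (_ * (expR _ * expR _)); rewrite -mulr_natr; field.
  - apply/measurable_EFinP; apply: measurable_funM; apply: measurableT_comp => //;
      apply: measurable_funM => //; apply: measurableT_comp => //;
      apply: measurable_funX; apply: measurable_funM => //; exact: measurable_funB.
  - by rewrite lee_fin mulr_ge0 ?normal_peak_ge0.
rewrite !key; apply: eq_integral => x _; apply: eq_integral => y _; congr (_ * _)%E.
by rewrite !gaussian_smoothing_fubini; apply: eq_integral => q _; rewrite cosE.
Qed.

(** Smoothed indicators of the quadrant converge pointwise everywhere, its boundary included, so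
    bounded convergence holds for every law, even one that charges the boundary. *)
Lemma rays_eq (R : realType)
    (m1 m2 : probability (measurableTypeR R * measurableTypeR R)%type R) (a b : R) :
  (forall a b c : R, (\int[m1]_p (cos (a * p.1 + b * p.2 - c))%:E =
                      \int[m2]_p (cos (a * p.1 + b * p.2 - c))%:E)%E) ->
  m1 (`]-oo, a[ `*` `]-oo, b[) = m2 (`]-oo, a[ `*` `]-oo, b[).
Proof.
move=> cosE.
pose A n : set R := `]-oo, a - n.+1%:R^-1[%classic.
pose B n : set R := `]-oo, b - n.+1%:R^-1[%classic.
pose e n : R := n.+1%:R ^- 2.
have e0 n : e n != 0 by rewrite invr_eq0 expf_neq0.
have mD : measurable (`]-oo, a[ `*` `]-oo, b[ :
    set (measurableTypeR R * measurableTypeR R)) by exact: measurableX.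
have key (m : probability (measurableTypeR R * measurableTypeR R)%type R) :
   (\int[m]_p (normal_prob p.2 (e n) (B n) * normal_prob p.1 (e n) (A n)))%E
     @[n --> \oo] --> m (`]-oo, a[ `*` `]-oo, b[).
  have -> : m (`]-oo, a[ `*` `]-oo, b[) =
      (\int[m]_p (\1_(`]-oo, a[ `*` `]-oo, b[) p)%:E)%E.
    by rewrite integral_indic // setIT.
  have m1fst : measurable_fun setT (fst : measurableTypeR R * measurableTypeR R -> R).
    exact: measurable_fst.
  have m2snd : measurable_fun setT (snd : measurableTypeR R * measurableTypeR R -> R).
    exact: measurable_snd.
  have [] := @dominated_convergence _ _ _ m setT measurableT
    (fun n p => normal_prob p.2 (e n) (B n) * normal_prob p.1 (e n) (A n))%E
    (fun p => (\1_(`]-oo, a[ `*` `]-oo, b[) p)%:E) (cst 1%E).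
  - move=> n; apply: emeasurable_funM.
      by have [] := @normal_prob_tonelli _ _ R m (e n) (cst 0%E) snd (B n) (e0 n)
        (measurable_itv _) (measurable_cst _) (fun=> lexx _) m2snd.
    by have [] := @normal_prob_tonelli _ _ R m (e n) (cst 0%E) fst (A n) (e0 n)
        (measurable_itv _) (measurable_cst _) (fun=> lexx _) m1fst.
  - by apply/measurable_EFinP; exact: measurable_indic.
  - apply: aeW => p _.
    have -> : (\1_(`]-oo, a[ `*` `]-oo, b[) p)%:E =
       ((\1_(`]-oo, b[) p.2)%:E * (\1_(`]-oo, a[) p.1)%:E : \bar R)%E.
      by rewrite -EFinM; congr EFin; rewrite !indicE in_setX andbC -mulnb natrM.
    apply: cvgeM; [|exact: cvg_normal_prob_ray..].
    by rewrite mule_def_fin.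
  - exact: finite_measure_integrable_cst.
  - apply: aeW => p n _; rewrite gee0_abs ?mule_ge0 //=.
    rewrite -[leRHS]mule1; by apply: lee_pmul => //; apply: probability_le1; exact: measurable_itv.
  by [].
have E : (fun n => \int[m1]_p (normal_prob p.2 (e n) (B n) * normal_prob p.1 (e n) (A n)))%E
      = (fun n => \int[m2]_p (normal_prob p.2 (e n) (B n) * normal_prob p.1 (e n) (A n)))%E.
  by apply/funext => n; apply: smoothed_rectangle_eq => //; exact: measurable_itv.
by have := key m1; rewrite E => /cvg_unique; apply => //; exact: key.
Qed.

Lemma measure_rays_inj (R : realType)
    (m1 m2 : {measure set (measurableTypeR R) -> \bar R}) :
  (forall a : R, m1 `]-oo, a[%classic = m2 `]-oo, a[%classic) ->
  (forall a : R, (m1 `]-oo, a[%classic < +oo)%E) ->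
  forall A, measurable A -> m1 A = m2 A.
Proof.
move=> E fin; apply: (@measure_unique _ R (measurableTypeR R) (@RGenInftyO.G R)
  (fun n => `]-oo, n%:R[%classic)).
- exact: RGenInftyO.measurableE.
- move=> _ _ [x ->] [y ->]; exists (Num.min x y).
  apply/seteqP; split => z /=; rewrite !in_itv /= lt_min.
    by case=> -> ->.
  by move/andP.
- by move=> n; exists n%:R.
- apply/seteqP; split => // x _; exists (Num.bound `|x : R|) => //=.
  rewrite in_itv /=.
  exact: (le_lt_trans (ler_norm (x : R)) (archi_boundP (normr_ge0 (x : R)))).
- by move=> _ [a ->].
- by move=> n.
Qed.

Lemma measure_rectangles_inj (R : realType) (d1 d2 : measure_display)
    (T1 : measurableType d1) (T2 : measurableType d2)
    (m1 m2 : probability (T1 * T2)%type R) :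
  (forall A B, measurable A -> measurable B -> m1 (A `*` B) = m2 (A `*` B)) ->
  forall X, measurable X -> m1 X = m2 X.
Proof.
move=> E; apply: (@measure_unique _ R (T1 * T2)%type
   [set A `*` B | A in measurable & B in measurable] (fun=> setT)).
- exact: measurable_prod_measurableType.
- move=> _ _ [A mA [B mB <-]] [A' mA' [B' mB' <-]].
  exists (A `&` A'); first exact: measurableI.
  by exists (B `&` B'); [exact: measurableI|rewrite setXI].
- move=> _; exists setT; [exact: measurableT|exists setT; [exact: measurableT|]].
  exact: setXTT.
- by rewrite bigcup_const.
- by move=> _ [A mA [B mB <-]]; exact: E.
- by move=> _; rewrite (le_lt_trans (probability_le1 _ _)) // ltry.
Qed.

(** Quadrants are upgraded to rectangles one coordinate at a time: with the second factor frozen as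
    a ray, the mass is a measure in the first factor known on rays; then the first factor is frozen
    as any measurable set. *)
Lemma cos_transform_inj (R : realType)
    (m1 m2 : probability (measurableTypeR R * measurableTypeR R)%type R) :
  (forall a b c : R, (\int[m1]_p (cos (a * p.1 + b * p.2 - c))%:E =
                      \int[m2]_p (cos (a * p.1 + b * p.2 - c))%:E)%E) ->
  forall A, measurable A -> m1 A = m2 A.
Proof.
move=> cosE; apply: measure_rectangles_inj.
have fin (m : probability (measurableTypeR R * measurableTypeR R)%type R) X :
    measurable X -> (m X < +oo)%E.
  by move=> mX; rewrite (le_lt_trans (probability_le1 _ _)) // ltry.
have step1 b A : measurable A ->
    m1 (A `*` `]-oo, b[%classic) = m2 (A `*` `]-oo, b[%classic).
  move=> mA.
  have mD : measurable (setT `*` `]-oo, b[%classic :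
    set (measurableTypeR R * measurableTypeR R)) by exact: measurableX.
  (* Restriction to the strip followed by projection turns the mass of [C] times the ray into a
     measure in [C]. *)
  have XE (m : probability (measurableTypeR R * measurableTypeR R)%type R)
      (C : set (measurableTypeR R)) :
      pushforward (mrestr m mD) fst C = m (C `*` `]-oo, b[%classic).
    by congr (m _); apply/seteqP; split => [z [? []]|z []].
  rewrite -(XE m1) -(XE m2).
  apply: (@measure_rays_inj R (pushforward (mrestr m1 mD) fst)
     (pushforward (mrestr m2 mD) fst)) => // a.
    exact: (etrans (XE m1 _) (etrans (rays_eq _ _ cosE) (esym (XE m2 _)))).
  by apply: le_lt_trans (fin m1 _ (measurableX (measurable_itv `]-oo, a[)
    (measurable_itv `]-oo, b[))); rewrite le_eqVlt; apply/orP; left; apply/eqP/XE.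
move=> A B mA mB.
have mD : measurable (A `*` setT :
    set (measurableTypeR R * measurableTypeR R)) by exact: measurableX.
have XE (m : probability (measurableTypeR R * measurableTypeR R)%type R)
    (C : set (measurableTypeR R)) :
    pushforward (mrestr m mD) snd C = m (A `*` C).
  by congr (m _); apply/seteqP; split => [z [? []]|z []].
rewrite -(XE m1) -(XE m2).
apply: (@measure_rays_inj R (pushforward (mrestr m1 mD) snd)
   (pushforward (mrestr m2 mD) snd)) => // a.
  exact: (etrans (XE m1 _) (etrans (step1 _ _ mA) (esym (XE m2 _)))).
by apply: le_lt_trans (fin m1 _ (measurableX mA (measurable_itv `]-oo, a[)));
  rewrite le_eqVlt; apply/orP; left; apply/eqP/XE.
Qed.

(** * Spectral form of the slope variance *)

Lemma gaussian_field_pair (d : measure_display) (T : measurableType d)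
    (R : realType) (P : probability T R) (W : R -> R -> {RV P >-> R})
    (x y a b : R) :
  gaussian_field W ->
  gaussian_law (fun A : set R => P [set o | A (a * W x 0 o + b * W y 0 o)]).
Proof.
move=> gW.
have := gW 2 (fun i => if i == 0 :> nat then a else b)
  (fun i => (if i == 0 :> nat then x else y, 0)).
congr gaussian_law; apply/funext => A; congr (P _); apply/seteqP.
by split => o /=; rewrite !big_ord_recl big_ord0 /= addr0.
Qed.

(** [fine] loses nothing for a sea model: the covariance is finite by [sea_model_covariance]. *)
Definition covariance_x (R : realType) (g : R) (S : R -> R -> R) (xi : R) : R :=
  fine (sea_covariance g S xi 0).

(** The definition of [spectral_density] does not include integrability of [S]; finite variance
    comes from the Gaussian law of a single value. *)
Lemma sea_model_sqr_integrable (d : measure_display) (T : measurableType d)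
    (R : realType) (P : probability T R) (g : R) (S : R -> R -> R)
    (W : R -> R -> {RV P >-> R}) (x : R) : sea_model g S W ->
  P.-integrable setT (fun o => (W x 0 o ^+ 2)%:E).
Proof.
case=> _ gW mW _ _.
have W0 : (\int[P]_o (W x 0 o)%:E = 0)%E by rewrite -expectation_def; exact: mW.
have gWx := gaussian_field_pair x x 1 0 gW.
have gV : gaussian_law (fun A : set R => P [set o | A (W x 0 o)]).
  move: gWx; congr gaussian_law; apply/funext => A; congr (P _); apply/seteqP.
  by split => o /=; rewrite mul1r mul0r addr0.
have [s [E _]] := gaussian_law_centered (measurable_funPT (W x 0)) gV W0.
apply/integrableP; split.
  by apply/measurable_EFinP; exact: measurable_funX.
under eq_integral do rewrite gee0_abs ?lee_fin ?sqr_ge0 //.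
by rewrite E ltry.
Qed.

Lemma sea_model_mul_integrable (d : measure_display) (T : measurableType d)
    (R : realType) (P : probability T R) (g : R) (S : R -> R -> R)
    (W : R -> R -> {RV P >-> R}) (x y : R) : sea_model g S W ->
  P.-integrable setT (fun o => (W x 0 o * W y 0 o)%:E).
Proof.
move=> seaW.
have := integrableD measurableT (sea_model_sqr_integrable x seaW)
  (sea_model_sqr_integrable y seaW).
apply: le_integrable => //.
  by apply/measurable_EFinP; exact: measurable_funM.
move=> o _; rewrite /= lee_fin normrM -[X in _ <= `|X + _|]real_normK ?num_real //.
rewrite -[X in _ <= `|_ + X|]real_normK ?num_real //.
move: `|W x 0 o| `|W y 0 o| (normr_ge0 (W x 0 o)) (normr_ge0 (W y 0 o)) => u v u0 v0.
rewrite ger0_norm ?addr_ge0 ?sqr_ge0 //.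
have := sqr_ge0 (u - v); nra.
Qed.

Lemma sea_model_integrable (d : measure_display) (T : measurableType d)
    (R : realType) (P : probability T R) (g : R) (S : R -> R -> R)
    (W : R -> R -> {RV P >-> R}) (x : R) : sea_model g S W ->
  P.-integrable setT (fun o => (W x 0 o)%:E).
Proof.
move=> seaW.
have := integrableD measurableT (sea_model_sqr_integrable x seaW)
  (finite_measure_integrable_cst P 1 measurableT).
apply: le_integrable => //.
  by apply/measurable_EFinP; exact: measurable_funP.
move=> o _; rewrite /= lee_fin -[X in _ <= `|X + _|]real_normK ?num_real //.
move: `|W x 0 o| (normr_ge0 (W x 0 o)) => u u0.
rewrite ger0_norm ?addr_ge0 ?sqr_ge0 //; nra.
Qed.

Lemma sea_model_covariance (d : measure_display) (T : measurableType d)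
    (R : realType) (P : probability T R) (g : R) (S : R -> R -> R)
    (W : R -> R -> {RV P >-> R}) (x y : R) : sea_model g S W ->
  (\int[P]_o (W x 0 o * W y 0 o)%:E = (covariance_x g S (y - x))%:E)%E /\
  sea_covariance g S (y - x) 0 = (covariance_x g S (y - x))%:E.
Proof.
move=> seaW; have [_ _ _ _ covW] := seaW.
have E : (\int[P]_o (W x 0 o * W y 0 o)%:E = sea_covariance g S (y - x) 0)%E.
  rewrite -(covW x 0) expectation_def.
  by apply: eq_integral => o _ /=; rewrite addr0 addrC subrK.
have := integrable_fin_num measurableT (sea_model_mul_integrable x y seaW).
by rewrite E /covariance_x => f; rewrite fineK.
Qed.

(** A combination of two values is centered and Gaussian, so its transform depends only on its
    second moment, which is found by expanding the square. *)
Lemma sea_model_cos (d : measure_display) (T : measurableType d)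
    (R : realType) (P : probability T R) (g : R) (S : R -> R -> R)
    (W : R -> R -> {RV P >-> R}) (x y a b c : R) : sea_model g S W ->
  (\int[P]_o (cos (a * W x 0 o + b * W y 0 o - c))%:E =
   (cos c * expR (- (a ^+ 2 * covariance_x g S 0 + b ^+ 2 * covariance_x g S 0 +
     2 * a * b * covariance_x g S (y - x)) / 2))%:E)%E.
Proof.
move=> seaW; have [_ gW mW _ _] := seaW.
pose V o := a * W x 0 o + b * W y 0 o.
have mV : measurable_fun setT V by apply: measurable_funD; exact: measurable_funM.
have iW z := sea_model_integrable z seaW.
have V0 : (\int[P]_o (V o)%:E = 0)%E.
  under eq_integral do rewrite EFinD !EFinM.
  rewrite integralD //; [|exact: integrableZl..].
  rewrite !integralZl //.
  have EW z : (\int[P]_o (W z 0 o)%:E = 0)%E by rewrite -expectation_def; exact: mW.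
  by rewrite !EW !mule0 adde0.
have [s [E cosE]] := gaussian_law_centered mV (gaussian_field_pair x y a b gW) V0.
rewrite cosE; congr (_ * expR (- _ / 2))%:E; apply: EFin_inj; rewrite -E.
have iS z := sea_model_sqr_integrable z seaW.
have iM := sea_model_mul_integrable x y seaW.
have EV o : (V o ^+ 2)%:E = ((a ^+ 2)%:E * (W x 0 o ^+ 2)%:E +
  ((b ^+ 2)%:E * (W y 0 o ^+ 2)%:E + (2 * a * b)%:E * (W x 0 o * W y 0 o)%:E))%E.
  by rewrite -!EFinM -!EFinD /V; congr EFin; ring.
under eq_integral do rewrite EV.
have i1 := integrableZl measurableT (b ^+ 2) (iS y).
have i2 := integrableZl measurableT (2 * a * b) iM.
rewrite integralD //; [|exact: integrableZl|exact: integrableD].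
rewrite integralD // !integralZl //.
have E2 z : (\int[P]_o (W z 0 o ^+ 2)%:E = (covariance_x g S 0)%:E)%E.
  by under eq_integral do rewrite expr2; have [] := sea_model_covariance z z seaW;
    rewrite subrr.
rewrite !E2; have [-> _] := sea_model_covariance x y seaW.
move: (covariance_x g S 0) (covariance_x g S (y - x)) => r0 r1.
by rewrite -!EFinM -!EFinD; congr EFin; ring.
Qed.

(** * Difference quotients of a single oscillation *)

Lemma normr_sin_le (R : realType) (z : R) : `|sin z| <= `|z|.
Proof.
wlog z0 : z / 0 < z => [H|].
  have [z0|z0|->] := ltgtP z 0; [|exact: H|by rewrite sin0].
  by have := H (- z); rewrite sinN !normrN; apply; rewrite oppr_gt0.
have [c _] := MVT z0 (fun x _ => is_derive_sin x)
  (continuous_subspaceT (@continuous_sin R)).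
rewrite sin0 !subr0 => ->; rewrite normrM ler_piMl //; exact: cos_max.
Qed.

(* [q y h] is [2 (1 - cos (h y)) / h ^ 2], the squared modulus of the
   difference quotient of [exp (i h y)]. *)
Definition quotient_symbol (R : realType) (y h : R) : R :=
  (2 * sin (h * y / 2) / h) ^+ 2.

Lemma quotient_symbolE (R : realType) (y h : R) :
  h != 0 -> quotient_symbol y h = 2 / h ^+ 2 * (1 - cos (h * y)).
Proof.
move=> h0; rewrite /quotient_symbol.
have -> : cos (h * y) = 1 - 2 * sin (h * y / 2) ^+ 2.
  have -> : h * y = (h * y / 2) *+ 2 by rewrite -mulr_natr divfK.
  rewrite cos_mulr2n; have := cos2Dsin2 ((h * y / 2) *+ 2 / 2).
  have -> : (h * y / 2) *+ 2 / 2 = h * y / 2 by rewrite -mulr_natr mulfK.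
  by rewrite -mulr_natr; lra.
by field.
Qed.

Lemma quotient_symbol_ge0 (R : realType) (y h : R) : 0 <= quotient_symbol y h.
Proof. exact: sqr_ge0. Qed.

(** Follows from [|sin z| <= |z|]. The bound is also the limit as [h] tends to 0, so the limiting
    spectral integrand dominates its own approximations. *)
Lemma quotient_symbol_le (R : realType) (y h : R) :
  quotient_symbol y h <= y ^+ 2.
Proof.
rewrite /quotient_symbol; have [->|h0] := eqVneq h 0.
  by rewrite invr0 mulr0 expr0n sqr_ge0.
rewrite -(real_normK (num_real (2 * _ / _))) -(real_normK (num_real y)).
rewrite ler_sqr ?nnegrE //.
rewrite normrM normfV ler_pdivrMr ?normr_gt0 // normrM ger0_norm //.
have := normr_sin_le (h * y / 2); rewrite !normrM (ger0_norm (_ : 0 <= 2^-1)) //.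
lra.
Qed.

(** Before squaring, the symbol is the difference quotient at 0 of [2 * sin (t * y / 2)], whose
    derivative there is [y]. *)
Lemma cvg_quotient_symbol (R : realType) (y : R) (h : nat -> R) :
  (forall n, h n != 0) -> h n @[n --> \oo] --> (0 : R) ->
  quotient_symbol y (h n) @[n --> \oo] --> y ^+ 2.
Proof.
move=> h0 hcvg.
have D : is_derive (0 : R) (1 : R) (fun t : R => 2 * sin (t * y / 2)) y.
  have d1 : is_derive (0 : R) (1 : R) (fun t : R => t * y / 2) (y / 2).
    have -> : (fun t : R => t * y / 2) = ((y / 2) \*: id : R -> R).
      by apply/funext => t /=; rewrite /GRing.scale/=; ring.
    by apply: is_derive_eq; rewrite /GRing.scale/= mulr1.
  have d2 := is_derive1_comp (is_derive_sin _) d1.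
  have d3 := is_deriveZ 2 d2.
  apply: (@is_derive_eq _ _ _ _ _ _ _ _ d3).
  by rewrite /GRing.scale/= mul0r mul0r cos0 mul1r mulrC divfK.
have := @ex_derive _ _ _ _ _ _ _ D.
have := @derive_val _ _ _ _ _ _ _ D.
rewrite /derive => E /cvg_ex[l Hl].
have ly : l = y by rewrite -E; apply/esym/cvg_lim.
rewrite {}ly in Hl.
have /cvgr_dnbhsP := Hl.
move=> /(_ h (conj h0 hcvg)) {}Hl.
rewrite expr2; under eq_fun do rewrite /quotient_symbol expr2.
suff H : 2 * sin (h n * y / 2) / h n @[n --> \oo] --> y by exact: cvgM.
apply: cvg_trans Hl; apply: near_eq_cvg; near=> n.
by rewrite /= /GRing.scale/= addr0 mulr1 !mul0r sin0 mulr0 subr0 mulrC.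
Unshelve. all: by end_near. Qed.

(** * Spectral integrals as integrals over the plane *)

Definition spectral_domain (R : realType) : set (measurableTypeR R * measurableTypeR R) :=
  `]0, +oo[ `*` `[0, 2 * pi].

(** Extension by zero: sign and measurability of [S] are known on the spectral domain only, while
    product-measure integrals are taken over the whole plane. *)
Definition spectral_ext (R : realType) (S : R -> R -> R)
    (p : measurableTypeR R * measurableTypeR R) : R :=
  S p.1 p.2 * \1_(@spectral_domain R) p.

Definition projected_wave_number (R : realType) (g : R)
    (p : measurableTypeR R * measurableTypeR R) : R :=
  wave_number g p.1 * cos p.2.

Lemma measurable_spectral_domain (R : realType) : measurable (@spectral_domain R).
Proof. by apply: measurableX; exact: measurable_itv. Qed.

Lemma spectral_ext_ge0 (R : realType) (S : R -> R -> R) p :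
  spectral_density S -> 0 <= spectral_ext S p.
Proof.
case=> _ S0; rewrite /spectral_ext indicE; have [/set_mem|_] := boolP (p \in _).
  rewrite /spectral_domain /= !in_itv /= andbT => -[p0 p1].
  by rewrite mulr1 S0.
by rewrite mulr0.
Qed.

Lemma measurable_spectral_ext (R : realType) (S : R -> R -> R) :
  spectral_density S -> measurable_fun setT (spectral_ext S).
Proof.
case=> mS _.
have -> : spectral_ext S = (fun p => S p.1 p.2) \_ (@spectral_domain R).
  apply/funext => p; rewrite /spectral_ext patchE indicE.
  by case: ifPn => _; rewrite ?mulr1 ?mulr0.
exact: ((measurable_restrictT (fun p : measurableTypeR R * measurableTypeR R => S p.1 p.2)
  (@measurable_spectral_domain R)).1 mS).
Qed.

Lemma measurable_projected_wave_number (R : realType) (g : R) :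
  measurable_fun setT (projected_wave_number g).
Proof.
apply: measurable_funM.
  apply: measurable_funM => //; apply: measurable_funX; exact: measurable_fst.
apply: measurableT_comp; first exact: measurable_cos.
exact: measurable_snd.
Qed.

Lemma spectral_iterated_integral (R : realType) (S : R -> R -> R)
    (q : measurableTypeR R * measurableTypeR R -> R) :
  (\int[lebesgue_measure]_(om in `]0%R, +oo[)
     \int[lebesgue_measure]_(th in `[0%R, (2 * pi)%R])
       (q (om, th) * S om th)%:E =
   \int[lebesgue_measure]_om \int[lebesgue_measure]_th
       (q (om, th) * spectral_ext S (om, th))%:E)%E.
Proof.
rewrite integral_mkcond; apply: eq_integral => om _; rewrite patchE.
case: ifPn => [om0|om0].
  rewrite integral_mkcond; apply: eq_integral => th _; rewrite patchE.
  rewrite /spectral_ext indicE /spectral_domain in_setX om0 /=.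
  by case: ifPn => _; rewrite ?mulr1 // !mulr0.
rewrite integral0_eq // => th _.
by rewrite /spectral_ext indicE /spectral_domain in_setX (negbTE om0) /= !mulr0.
Qed.

Lemma ge0_spectral_integral (R : realType) (S : R -> R -> R)
    (q : measurableTypeR R * measurableTypeR R -> R) :
  spectral_density S -> measurable_fun setT q -> (forall p, 0 <= q p) ->
  (\int[lebesgue_measure]_(om in `]0%R, +oo[)
     \int[lebesgue_measure]_(th in `[0%R, (2 * pi)%R])
       (q (om, th) * S om th)%:E =
   \int[lebesgue_measure \x lebesgue_measure]_p (q p * spectral_ext S p)%:E)%E.
Proof.
move=> dS mq q0; rewrite spectral_iterated_integral.
rewrite (fubini_tonelli1 (fun p => (q p * spectral_ext S p)%:E)) //.
- by apply/measurable_EFinP; apply: measurable_funM => //; exact: measurable_spectral_ext.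
- by move=> p; rewrite lee_fin mulr_ge0 // spectral_ext_ge0.
Qed.

Lemma spectral_moment_20 (R : realType) (g : R) (S : R -> R -> R) :
  spectral_density S ->
  (spectral_moment g S 2 0 =
   \int[lebesgue_measure \x lebesgue_measure]_p
     (projected_wave_number g p ^+ 2 * spectral_ext S p)%:E)%E.
Proof.
move=> dS.
have mq : measurable_fun setT (fun p => projected_wave_number g p ^+ 2).
  by apply: measurable_funX; exact: measurable_projected_wave_number.
apply: (eq_trans _ (ge0_spectral_integral dS mq (fun p => sqr_ge0 _))).
by apply: eq_integral => om _; apply: eq_integral => th _; rewrite expr0 mulr1.
Qed.

(** For a sea model the left side is the variance of the difference quotient with step [h]. The
    cosine changes sign, so Fubini rather than Tonelli applies; the integrability of [S] that it
    requires is the finiteness of the covariance at 0. *)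
Lemma spectral_increment (R : realType) (g : R) (S : R -> R -> R) (h : R) :
  spectral_density S -> (sea_covariance g S 0 0 < +oo)%E -> h != 0 ->
  ((2 * (covariance_x g S 0 - covariance_x g S h) / h ^+ 2)%:E =
   \int[lebesgue_measure \x lebesgue_measure]_p
     (quotient_symbol (projected_wave_number g p) h * spectral_ext S p)%:E)%E.
Proof.
move=> dS fin h0.
have mS := measurable_spectral_ext dS; have mk := measurable_projected_wave_number g.
have mc : measurable_fun setT (fun p => cos (h * projected_wave_number g p)).
  apply: measurableT_comp; first exact: measurable_cos.
  exact: measurable_funM.
have E0 : (sea_covariance g S 0 0 =
    \int[lebesgue_measure \x lebesgue_measure]_p (spectral_ext S p)%:E)%E.
  transitivity (\int[lebesgue_measure \x lebesgue_measure]_p (1 * spectral_ext S p)%:E)%E.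
    have := ge0_spectral_integral (q := fun=> 1) dS (measurable_cst _) (fun=> ler01).
    apply: eq_trans; apply: eq_integral => om _; apply: eq_integral => th _.
    by rewrite !mulr0 mul0r addr0 cos0.
  by apply: eq_integral => p _; rewrite mul1r.
have iS : (lebesgue_measure \x lebesgue_measure)%E.-integrable setT
    (fun p => (spectral_ext S p)%:E).
  apply/integrableP; split; first exact/measurable_EFinP.
  under eq_integral do rewrite gee0_abs ?lee_fin ?spectral_ext_ge0 //.
  by rewrite -E0.
have ic : (lebesgue_measure \x lebesgue_measure)%E.-integrable setT
    (fun p => (cos (h * projected_wave_number g p) * spectral_ext S p)%:E).
  apply: le_integrable iS => //.
    by apply/measurable_EFinP; exact: measurable_funM.
  move=> p _; rewrite /= lee_fin normrM ler_piMl //; exact: cos_max.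
have Eh : (sea_covariance g S h 0 = \int[lebesgue_measure \x lebesgue_measure]_p
    (cos (h * projected_wave_number g p) * spectral_ext S p)%:E)%E.
  apply: (eq_trans _ (integral12_prod_meas1 ic)).
  apply: (eq_trans _ (spectral_iterated_integral S
    (fun p => cos (h * projected_wave_number g p)))).
  apply: eq_integral => om _; apply: eq_integral => th _.
  rewrite mulr0 add0r /projected_wave_number /=; congr (cos _ * _)%:E; ring.
have F0 := integrable_fin_num measurableT iS.
have Fc := integrable_fin_num measurableT ic.
have iB := integrableB measurableT iS ic.
transitivity ((2 / h ^+ 2)%:E * \int[lebesgue_measure \x lebesgue_measure]_p
   ((spectral_ext S p)%:E - (cos (h * projected_wave_number g p) * spectral_ext S p)%:E))%E.
  rewrite integralB // -E0 -Eh /covariance_x -[in RHS](fineK (_ : sea_covariance g S 0 0 \is a fin_num)).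
    rewrite -[in RHS](fineK (_ : sea_covariance g S h 0 \is a fin_num)) ?Eh //.
    by rewrite -EFinB -EFinM; congr EFin; ring.
  by rewrite E0.
rewrite -integralZl //; apply: eq_integral => p _.
by rewrite -EFinB -EFinM quotient_symbolE //; congr EFin; ring.
Qed.

Lemma limn_einf_le (R : realType) (u : nat -> \bar R) (l : \bar R) :
  (\forall n \near \oo, (u n <= l)%E) -> (limn_einf u <= l)%E.
Proof.
case=> N _ ul; rewrite limn_einf_lim; apply: lime_le; first exact: is_cvg_einfs.
apply: nearW => n; apply: (@le_trans _ _ (u (maxn n N))).
  by apply: ereal_inf_lbound; exists (maxn n N) => //=; rewrite leq_maxl.
by apply: ul; rewrite /= leq_maxr.
Qed.

Lemma limn_einf_ge (R : realType) (u : nat -> \bar R) (l : \bar R) :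
  (\forall n \near \oo, (l <= u n)%E) -> (l <= limn_einf u)%E.
Proof.
case=> N _ ul; rewrite limn_einf_lim; apply: lime_ge; first exact: is_cvg_einfs.
exists N => // n /= Nn; apply: le_ereal_inf_tmp => _ [k /= nk <-].
by apply: ul => /=; exact: leq_trans Nn nk.
Qed.

Lemma limn_esup_le (R : realType) (u : nat -> \bar R) (l : \bar R) :
  (\forall n \near \oo, (u n <= l)%E) -> (limn_esup u <= l)%E.
Proof.
case=> N _ ul; rewrite limn_esup_lim; apply: lime_le; first exact: is_cvg_esups.
exists N => // n /= Nn; apply: ge_ereal_sup => _ [k /= nk <-].
by apply: ul => /=; exact: leq_trans Nn nk.
Qed.

Lemma measurable_increment_integrand (R : realType) (g : R) (S : R -> R -> R) (h : R) :
  spectral_density S ->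
  measurable_fun setT (fun p =>
    (quotient_symbol (projected_wave_number g p) h * spectral_ext S p)%:E).
Proof.
move=> dS; apply/measurable_EFinP.
apply: measurable_funM; last exact: measurable_spectral_ext.
apply: measurable_funX; apply: measurable_funM => //; apply: measurable_funM => //.
apply: measurableT_comp; first exact: continuous_measurable_fun (@continuous_sin R).
apply: measurable_funM => //; apply: measurable_funM => //.
exact: measurable_projected_wave_number.
Qed.

Lemma cvg_increment_integrand (R : realType) (g : R) (S : R -> R -> R)
    (h : nat -> R) (p : measurableTypeR R * measurableTypeR R) :
  (forall n, h n != 0) -> h n @[n --> \oo] --> (0 : R) ->
  (quotient_symbol (projected_wave_number g p) (h n) * spectral_ext S p)%:E
    @[n --> \oo] --> (projected_wave_number g p ^+ 2 * spectral_ext S p)%:E.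
Proof.
move=> h0 hcvg; apply: cvg_EFin; first exact: nearW.
by apply: cvgMl; exact: cvg_quotient_symbol.
Qed.

Lemma spectral_moment_20_le (R : realType) (g M : R) (S : R -> R -> R) (h : nat -> R) :
  spectral_density S -> (sea_covariance g S 0 0 < +oo)%E ->
  (forall n, h n != 0) -> h n @[n --> \oo] --> (0 : R) ->
  (\forall n \near \oo,
     2 * (covariance_x g S 0 - covariance_x g S (h n)) / h n ^+ 2 <= M) ->
  (spectral_moment g S 2 0 <= M%:E)%E.
Proof.
move=> dS fin h0 hcvg leM; rewrite (spectral_moment_20 g dS).
have := @fatou _ _ R (lebesgue_measure \x lebesgue_measure)%E setT measurableT
  (fun n p => (quotient_symbol (projected_wave_number g p) (h n) * spectral_ext S p)%:E)
  (fun n => measurable_increment_integrand g (h n) dS)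
  (fun n p _ => mulr_ge0 (quotient_symbol_ge0 _ _) (spectral_ext_ge0 p dS)).
set L := (X in (_ <= X)%E -> _) => H.
have {H} : (\int[lebesgue_measure \x lebesgue_measure]_p
    (projected_wave_number g p ^+ 2 * spectral_ext S p)%:E <= L)%E.
  apply: le_trans H; rewrite le_eqVlt; apply/orP; left; apply/eqP.
  apply: eq_integral => p _; apply/esym.
  have H := cvg_increment_integrand (g := g) (S := S) (p := p) h0 hcvg.
  by rewrite is_cvg_limn_einfE ?(cvg_lim _ H) //; apply/cvg_ex; eexists; exact: H.
move=> /le_trans; apply; rewrite /L.
rewrite [X in limn_einf X](_ : _ = (fun n =>
   (2 * (covariance_x g S 0 - covariance_x g S (h n)) / h n ^+ 2)%:E)); last first.
  by apply/funext => n; rewrite spectral_increment.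
apply: limn_einf_le; apply: filterS leM => n; by rewrite lee_fin.
Qed.

Lemma cvg_spectral_increment (R : realType) (g : R) (S : R -> R -> R) (h : nat -> R) :
  spectral_density S -> (sea_covariance g S 0 0 < +oo)%E ->
  (spectral_moment g S 2 0 < +oo)%E ->
  (forall n, h n != 0) -> h n @[n --> \oo] --> (0 : R) ->
  2 * (covariance_x g S 0 - covariance_x g S (h n)) / h n ^+ 2 @[n --> \oo] -->
    fine (spectral_moment g S 2 0).
Proof.
move=> dS fin fin2 h0 hcvg.
have mq : measurable_fun setT (fun p => (projected_wave_number g p ^+ 2 * spectral_ext S p)%:E).
  apply/measurable_EFinP; apply: measurable_funM; last exact: measurable_spectral_ext.
  by apply: measurable_funX; exact: measurable_projected_wave_number.
have q0 (p : measurableTypeR R * measurableTypeR R) :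
    0 <= projected_wave_number g p ^+ 2 * spectral_ext S p.
  by rewrite mulr_ge0 ?sqr_ge0 ?spectral_ext_ge0.
have [] := @dominated_convergence _ _ R (lebesgue_measure \x lebesgue_measure)%E setT
  measurableT
  (fun n p => (quotient_symbol (projected_wave_number g p) (h n) * spectral_ext S p)%:E)
  _ (fun p => (projected_wave_number g p ^+ 2 * spectral_ext S p)%:E)
  (fun n => measurable_increment_integrand g (h n) dS) mq
  (aeW _ (fun p _ => @cvg_increment_integrand R g S h p h0 hcvg)).
- apply/integrableP; split; first exact: mq.
  under eq_integral do rewrite gee0_abs ?lee_fin ?q0 //.
  by rewrite -(spectral_moment_20 g dS).
- apply: aeW => p n _; rewrite gee0_abs ?lee_fin.
    by rewrite ler_wpM2r ?spectral_ext_ge0 // quotient_symbol_le.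
  by rewrite mulr_ge0 ?quotient_symbol_ge0 ?spectral_ext_ge0.
move=> _ _; rewrite -(spectral_moment_20 g dS).
rewrite [X in X @ _ --> _ -> _](_ : _ = (fun n =>
   (2 * (covariance_x g S 0 - covariance_x g S (h n)) / h n ^+ 2)%:E)); last first.
  by apply/funext => n; rewrite spectral_increment.
have fin2' : spectral_moment g S 2 0 \is a fin_num.
  rewrite ge0_fin_numE // (spectral_moment_20 g dS).
  by apply: integral_ge0 => p _; rewrite lee_fin.
rewrite -[X in _ --> X -> _](fineK fin2').
by move=> /fine_cvg.
Qed.

(** The mean of [cos (s X)] tends to 1 as [s] tends to 0, so some [s > 0] keeps it above 1/2. For
    that [s] the transforms of [D n] converge to it, and an exponential above 1/2 bounds its
    exponent. *)
Lemma gaussian_variance_bounded (d : measure_display) (T : measurableType d)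
    (R : realType) (P : probability T R) (D : nat -> T -> R) (X : T -> R)
    (v : nat -> R) :
  (forall n, measurable_fun setT (D n)) -> measurable_fun setT X ->
  {ae P, forall o, D n o @[n --> \oo] --> X o} ->
  (forall n s, (\int[P]_o (cos (s * D n o))%:E = (expR (- (s ^+ 2 * v n) / 2))%:E)%E) ->
  exists M, \forall n \near \oo, v n <= M.
Proof.
move=> mD mX DX cosD.
have mcos s (Y : T -> R) : measurable_fun setT Y ->
    measurable_fun setT (fun o => (cos (s * Y o))%:E : \bar R).
  move=> mY; apply/measurable_EFinP; apply: measurableT_comp; first exact: measurable_cos.
  exact: measurable_funM.
have ccos (u : nat -> R) l : u n @[n --> \oo] --> l ->
    (cos (u n))%:E @[n --> \oo] --> ((cos l)%:E : \bar R).
  move=> ul; apply: cvg_EFin; first exact: nearW.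
  exact: (cvg_comp _ _ ul (@continuous_cos R l)).
have i1 : P.-integrable setT (cst 1%E) by exact: finite_measure_integrable_cst.
have b1 s (Y : nat -> T -> R) : {ae P, forall o (n : nat), setT o ->
     (`|(cos (s n * Y n o))%:E| <= (1%E : \bar R))%E}.
  by apply: aeW => o n _; rewrite abse_EFin lee_fin; exact: cos_max.
pose L s := (\int[P]_o (cos (s * X o))%:E)%E.
have L1 : L (n.+1%:R^-1) @[n --> \oo] --> (1%E : \bar R).
  have [] := @dominated_convergence _ _ R P setT measurableT
    (fun n o => (cos (n.+1%:R^-1 * X o))%:E) (cst 1%E) (cst 1%E).
  - by move=> n; exact: mcos.
  - exact: measurable_cst.
  - apply: aeW => o _; rewrite -[X in _ --> X%:E](@cos0 R); apply: ccos.
    by rewrite -[X in _ --> X](mul0r (X o)); apply: cvgMl; exact: cvg_harmonic.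
  - exact: i1.
  - exact: b1 (fun n => n.+1%:R^-1) (fun=> X).
  have -> : (\int[P]_o cst 1 o = 1)%E.
    by rewrite integral_cst // mul1e; exact: probability_setT.
  by [].
have Lfin s : L s \is a fin_num.
  apply: integrable_fin_num => //; apply: (le_integrable measurableT _ _ i1).
    exact: mcos.
  by move=> o _; rewrite abse_EFin abse1 lee_fin; exact: cos_max.
have {}L1 := fine_cvg L1 _.
have [k Lk] : exists k : nat, 2^-1 < fine (L k.+1%:R^-1).
  have h : 2^-1 < (1 : R) by rewrite invf_lt1 // ltr1n.
  by have [k _ /(_ k (leqnn k))] := cvgr_gt _ (L1 _) _ h; exists k.
set s : R := k.+1%:R^-1 in Lk.
have s0 : 0 < s by rewrite invr_gt0.
have cvgs : expR (- (s ^+ 2 * v n) / 2) @[n --> \oo] --> fine (L s).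
  have [] := @dominated_convergence _ _ R P setT measurableT
    (fun n o => (cos (s * D n o))%:E) (fun o => (cos (s * X o))%:E) (cst 1%E).
  - by move=> n; exact: mcos.
  - exact: mcos.
  - case: DX => N [mN N0 sub]; exists N; split => // o /= h; apply: sub => /= h'.
    by apply: h => _; apply: ccos; exact: cvgMr.
  - exact: i1.
  - exact: b1 (fun=> s) D.
  move=> _ _; rewrite -/(L s) -[X in _ --> X -> _](fineK (Lfin s)).
  rewrite (_ : [sequence _]_n = fun n => (expR (- (s ^+ 2 * v n) / 2))%:E).
    by move/fine_cvg.
  by apply/funext => n; rewrite /= cosD.
(* The value of [v] at which [exp(- s^2 v / 2)] equals 1/2. *)
exists (2 * ln 2 / s ^+ 2).
near=> n.
have H : 2^-1 < expR (- (s ^+ 2 * v n) / 2) by near: n; exact: cvgr_gt cvgs _ Lk.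
rewrite ler_pdivlMr ?exprn_gt0 // mulrC.
have : ln (2^-1) <= ln (expR (- (s ^+ 2 * v n) / 2)).
  by rewrite ler_ln ?posrE ?expR_gt0 ?invr_gt0 // ltW.
rewrite expRK lnV ?posrE //; lra.
Unshelve. all: by end_near. Qed.

(** * Dyadic crossings of a smooth path *)

Lemma counting_ge (T : choiceType) (R : realType) (A : set T) (s : seq T) :
  uniq s -> (forall x, x \in s -> A x) ->
  ((size s)%:R%:E <= counting A :> \bar R)%E.
Proof.
move=> us sA; rewrite /counting; case: asboolP => [fA|_]; last exact: leey.
rewrite lee_fin ler_nat; apply: uniq_leq_size => // x xs.
by rewrite in_fset_set // mem_set //; exact: sA.
Qed.

(** An infinite set has finite subsets of every size, which forces [l] to be infinite. Bounds on a
    count thus reduce to duplicate-free finite lists, and no finiteness of the zero set is needed in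
    advance. *)
Lemma counting_le (T : choiceType) (R : realType) (A : set T) (l : \bar R) :
  (forall s : seq T, uniq s -> (forall x, x \in s -> A x) -> ((size s)%:R%:E <= l)%E) ->
  (counting A <= l)%E.
Proof.
move=> sl; rewrite /counting; case: asboolP => [fA|iA].
  apply: sl => [|x]; first exact: finmap.fset_uniq.
  by rewrite in_fset_set // inE.
rewrite leye_eq; apply/eqP/eqyP => r r0.
have [B BA Br] := infinite_set_fset (Num.bound r) iA.
apply: (@le_trans _ _ (size (finmap.enum_fset B))%:R%:E); last first.
  by apply: sl => [|x xB]; [exact: finmap.fset_uniq|exact: BA].
rewrite lee_fin; apply: (le_trans (ltW (archi_boundP (ltW r0)))).
by rewrite ler_nat.
Qed.

Definition dyadic (R : realType) (n k : nat) : R := k%:R / 2 ^+ n.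

Definition dyadic_slope (R : realType) (F : R -> R) (n k : nat) : R :=
  (F (dyadic R n k.+1) - F (dyadic R n k)) * 2 ^+ n.

Definition dyadic_crossing (R : realType) (F : R -> R) (w : R) (n k : nat) : bool :=
  [&& 0 < F (dyadic R n k), F (dyadic R n k.+1) <= 0 & dyadic_slope F n k <= w].

Definition crossings (R : realType) (F : R -> R) (w : R) (n : nat) : nat :=
  (\sum_(0 <= k < 2 ^ n) dyadic_crossing F w n k)%N.

(** The threshold is strict, unlike in [wave_centers]: for a continuous derivative the condition
    then persists near the zero. For [w <= 0] it already makes the zero a downcrossing. *)
Definition downcrossing_zeros (R : realType) (F : R -> R) (w : R) : set R :=
  [set x | 0 <= x <= 1 /\ F x = 0 /\ derive1 F x < w].

Lemma crossingsE (R : realType) (F : R -> R) (w : R) (n : nat) :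
  crossings F w n = size [seq k <- index_iota 0 (2 ^ n) | dyadic_crossing F w n k].
Proof.
rewrite /crossings size_filter -sum1_count [RHS]big_mkcond.
by apply: eq_bigr => k _; case: dyadic_crossing.
Qed.

Lemma dyadic_lt (R : realType) (n k : nat) : dyadic R n k < dyadic R n k.+1.
Proof. by rewrite /dyadic ltr_pM2r ?invr_gt0 ?exprn_gt0 // ltr_nat. Qed.

Lemma dyadic_ge0 (R : realType) (n k : nat) : 0 <= dyadic R n k.
Proof. by rewrite /dyadic divr_ge0 // exprn_ge0. Qed.

Lemma dyadic_le1 (R : realType) (n k : nat) : (k <= 2 ^ n)%N -> dyadic R n k <= 1.
Proof.
by move=> kn; rewrite /dyadic ler_pdivrMr ?exprn_gt0 // mul1r -natrX ler_nat.
Qed.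

Lemma dyadicB (R : realType) (n k : nat) :
  dyadic R n k.+1 - dyadic R n k = (2 ^+ n)^-1.
Proof. by rewrite /dyadic -mulrBl -natrB // subSn // subnn mul1r. Qed.

Lemma cvg_two_expV (R : realType) : ((2 ^+ n)^-1 : R) @[n --> \oo] --> (0 : R).
Proof.
have -> : (fun n => (2 ^+ n)^-1) = (fun n => (2^-1) ^+ n) :> (nat -> R).
  by apply/funext => n; rewrite exprVn.
by apply: cvg_expr; rewrite ger0_norm // invf_lt1 // ltr1n.
Qed.

Lemma near_two_expV_lt (R : realType) (d : R) :
  0 < d -> \forall n \near \oo, (2 ^+ n)^-1 < d.
Proof. by move=> d0; near=> n; near: n; exact: cvgr_lt (@cvg_two_expV R) _ d0.
Unshelve. all: by end_near. Qed.

Lemma derivable_continuous (R : realType) (F : R -> R) :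
  (forall x : R, derivable F x 1) -> continuous F.
Proof.
by move=> dF x; apply: differentiable_continuous; apply/derivable1_diffP; exact: dF.
Qed.

Lemma mean_value (R : realType) (F : R -> R) (a b : R) :
  (forall x : R, derivable F x 1) -> a < b ->
  exists2 c, a < c < b & F b - F a = derive1 F c * (b - a).
Proof.
move=> dF ab.
have [|c cab E] := @MVT R F (derive1 F) a b ab _ (continuous_subspaceT (derivable_continuous dF)).
  by move=> x _; apply: DeriveDef; [exact: dF|rewrite derive1E].
by exists c => //; move: cab; rewrite in_itv.
Qed.

(** Heine's theorem at dyadic scale. Compactness is used as near-covering, which makes the rank [n]
    uniform in [x]; the second point may leave [[0, 1]]. *)
Lemma uniform_continuity01 (R : realType) (f : R -> R) (e : R) :
  continuous f -> 0 < e ->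
  \forall n \near \oo, forall x y : R, 0 <= x <= 1 -> `|y - x| <= (2 ^+ n)^-1 ->
    `|f y - f x| < e.
Proof.
move=> cf e0.
have : \forall n \near \oo, `[0, 1]%classic `<=`
    (fun x : R => forall y : R, `|y - x| <= (2 ^+ n)^-1 -> `|f y - f x| < e).
  apply: (compact_near_coveringP _).1; first exact: segment_compact.
  move=> x _.
  have /cvgrPdist_lt /(_ (e / 2)) := cf x.
  rewrite divr_gt0 // => /(_ isT) [d /= d0 xd].
  near=> x' n => y /=; rewrite -/(`|y - x'| <= (2 ^+ n)^-1) => yx'.
  have x'd : `|x - x'| < d / 2.
    by near: x'; exists (d / 2) => //=; rewrite divr_gt0.
  have nd : (2 ^+ n)^-1 < d / 2.
    by near: n; apply: near_two_expV_lt; rewrite divr_gt0.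
  have H1 : `|f x - f x'| < e / 2 by apply: xd => /=; lra.
  have H2 : `|f x - f y| < e / 2.
    apply: xd => /=; have := ler_distD x' x y; rewrite (distrC x' y); lra.
  have := ler_distD (f x) (f y) (f x'); rewrite (distrC (f y) (f x)); lra.
apply: filterS => n H x y x01 yx; apply: H => //=; by rewrite in_itv.
Unshelve. all: by end_near. Qed.

(** A crossing cell contains a zero by the intermediate value theorem and, by the mean value
    theorem, a point whose derivative is the dyadic slope. Uniform continuity carries the slope
    bound from that point to the zero at a cost below [w' - w]. *)
Lemma crossings_le_zeros (R : realType) (F : R -> R) (w w' : R) :
  (forall x : R, derivable F x 1) -> continuous (derive1 F) -> w < w' ->
  \forall n \near \oo,
    ((crossings F w n)%:R%:E <= counting (downcrossing_zeros F w') :> \bar R)%E.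
Proof.
move=> dF cF' ww'.
have e0 : 0 < w' - w by rewrite subr_gt0.
near=> n.
have unif : forall x y : R, 0 <= x <= 1 -> `|y - x| <= (2 ^+ n)^-1 ->
    `|derive1 F y - derive1 F x| < w' - w.
  by near: n; exact: uniform_continuity01.
have zP k : exists z, dyadic_crossing F w n k -> (k < 2 ^ n)%N ->
    [/\ dyadic R n k < z, z <= dyadic R n k.+1 & downcrossing_zeros F w' z].
  case: (boolP (dyadic_crossing F w n k)) => [/and3P[F0 F1 sw]|_]; last by exists 0.
  have lt := dyadic_lt R n k.
  have [||z + Fz] := @IVT R F _ _ 0 (ltW lt).
  - exact: continuous_subspaceT (derivable_continuous dF).
  - by rewrite ge_min le_max F1 (ltW F0) orbT.
  rewrite in_itv /= => /andP[z1 z2].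
  exists z => _ kn; split => //.
    by rewrite lt_neqAle z1 andbT; apply: contraTneq F0 => ->; rewrite Fz ltxx.
  have [c /andP[c1 c2] E] := mean_value dF lt.
  have z0 := dyadic_ge0 R n k; have z3 := @dyadic_le1 R n k.+1 kn.
  split; first by apply/andP; split; lra.
  split=> //.
  have cs : derive1 F c <= w.
    by move: sw; rewrite /dyadic_slope E dyadicB mulfVK.
  have D := dyadicB R n k.
  have : `|derive1 F z - derive1 F c| < w' - w.
    apply: unif; first by apply/andP; split; lra.
    by rewrite -D ler_norml; apply/andP; split; lra.
  by rewrite ltr_norml => /andP[]; lra.
have [z {}zP] := choice zP.
rewrite crossingsE; set s := [seq _ <- _ | _].
have sP k : k \in s -> dyadic_crossing F w n k /\ (k < 2 ^ n)%N.
  by rewrite mem_filter mem_index_iota => /andP[-> /andP[_ ->]].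
rewrite -(size_map z); apply: counting_ge.
  (* The zeros lie in cells open on the left, because [F] is positive at the left end; these cells
     are disjoint, so no zero is counted twice. *)
  rewrite map_inj_in_uniq ?filter_uniq ?iota_uniq // => i j /sP[iC iN] /sP[jC jN] E.
  have [i1 i2 _] := zP i iC iN; have [j1 j2 _] := zP j jC jN.
  have lt (a b : nat) : z a = z b -> dyadic R n a < z a -> z b <= dyadic R n b.+1 ->
      (a <= b)%N.
    move=> zab a1 b2; rewrite -ltnS -(ltr_nat R).
    have : dyadic R n a < dyadic R n b.+1 by apply: lt_le_trans a1 _; rewrite zab.
    by rewrite /dyadic ltr_pM2r ?invr_gt0 ?exprn_gt0.
  by apply/eqP; rewrite eqn_leq (lt i j) // (lt j i).
by move=> _ /mapP[k /sP[kC kN] ->]; have [] := zP k kC kN.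
Unshelve. all: by end_near. Qed.

(** The index is the ceiling of [x * 2 ^+ n] minus one. The point 0 belongs to no cell, which is
    where [F 0 != 0] will be called upon. *)
Lemma dyadic_cell (R : realType) (x : R) (n : nat) : 0 < x <= 1 ->
  exists k, [/\ (k < 2 ^ n)%N, dyadic R n k < x & x <= dyadic R n k.+1].
Proof.
move=> /andP[x0 x1].
have p0 : 0 < (2 ^+ n : R) by rewrite exprn_gt0.
have ex : exists j : nat, x * 2 ^+ n <= j%:R.
  exists (2 ^ n)%N; rewrite natrX ler_piMl //; exact: ltW.
case: (ex_minnP ex) => j xj jmin.
have j0 : (0 < j)%N.
  by rewrite lt0n; apply: contraTneq xj => ->; rewrite -ltNge mulr_gt0.
exists j.-1; split.
- rewrite prednK //; apply: jmin; rewrite natrX ler_piMl //; exact: ltW.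
- rewrite /dyadic ltr_pdivrMr // ltNge; apply/negP => /jmin.
  by rewrite leqNgt prednK // leqnn.
- by rewrite prednK // /dyadic ler_pdivlMr.
Qed.

(** The cell is shorter than [d], so the derivative stays below [w <= 0] on all of it. The mean
    value theorem left of the zero, right of it and across the cell gives the three conditions of a
    crossing. *)
Lemma zero_dyadic_crossing (R : realType) (F : R -> R) (w x d : R) (n k : nat) :
  (forall x : R, derivable F x 1) -> w <= 0 -> F x = 0 ->
  (forall y, `|y - x| < d -> derive1 F y < w) -> (2 ^+ n)^-1 < d ->
  dyadic R n k < x -> x <= dyadic R n k.+1 ->
  dyadic_crossing F w n k.
Proof.
move=> dF w0 Fx xd nd kx xk.
have D := dyadicB R n k.
have near y : dyadic R n k <= y -> y <= dyadic R n k.+1 -> derive1 F y < w.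
  move=> y1 y2; apply: xd; apply: le_lt_trans nd.
  by rewrite -D ler_norml; apply/andP; split; lra.
apply/and3P; split.
- have [c /andP[c1 c2] E] := mean_value dF kx.
  have : derive1 F c < w by apply: near; lra.
  move: E; rewrite Fx => E Fc.
  have : derive1 F c * (x - dyadic R n k) < 0.
    by rewrite nmulr_rlt0 ?subr_gt0 //; lra.
  lra.
- move: xk; rewrite le_eqVlt => /predU1P[<-|xk]; first by rewrite Fx.
  have [c /andP[c1 c2] E] := mean_value dF xk.
  have : derive1 F c < w by apply: near; lra.
  move: E; rewrite Fx => E Fc.
  have : derive1 F c * (dyadic R n k.+1 - x) < 0.
    by rewrite nmulr_rlt0 ?subr_gt0 //; lra.
  lra.
- have [c /andP[c1 c2] E] := mean_value dF (dyadic_lt R n k).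
  rewrite /dyadic_slope E D mulfVK ?expf_neq0 //.
  by apply/ltW/near; lra.
Qed.

(** For finitely many zeros there is a common radius [d] on which the slope bound persists and a
    least mutual distance [r]. Once the mesh is below both, the zeros occupy distinct cells, each of
    them a crossing. *)
Lemma zeros_le_crossings (R : realType) (F : R -> R) (w : R) :
  (forall x : R, derivable F x 1) -> continuous (derive1 F) -> w <= 0 -> F 0 != 0 ->
  (counting (downcrossing_zeros F w) <=
   limn_einf (fun n => (crossings F w n)%:R%:E) :> \bar R)%E.
Proof.
move=> dF cF' w0 F0; apply: counting_le => s us sZ.
apply: limn_einf_ge.
have [d d0 dP] : exists2 d : R, 0 < d &
    forall x, x \in s -> forall y, `|y - x| < d -> derive1 F y < w.
  elim: s us sZ => [|x s IH] /=; first by exists 1.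
  move=> /andP[xs us] sZ.
  have [|d d0 dP] := IH us; first by move=> y ys; apply: sZ; rewrite inE ys orbT.
  have [_ [_ xw]] := sZ x (mem_head _ _).
  have e0 : 0 < w - derive1 F x by rewrite subr_gt0.
  have /cvgrPdist_lt /(_ _ e0) [d' /= d'0 xd'] := cF' x.
  exists (Num.min d d'); first by rewrite lt_min d0.
  move=> z; rewrite inE => /predU1P[->|zs] y; rewrite lt_min => /andP[yd yd'].
    have := xd' y; rewrite /= distrC => /(_ yd'); rewrite ltr_norml => /andP[]; lra.
  exact: dP yd.
have [r r0 rP] : exists2 r : R, 0 < r &
    forall x y, x \in s -> y \in s -> x != y -> r <= `|x - y|.
  elim: s us {sZ dP} => [|x s IH] /=; first by exists 1.
  move=> /andP[xs us]; have [r r0 rP] := IH us.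
  have [q q0 qP] : exists2 q : R, 0 < q & forall y, y \in s -> q <= `|x - y|.
    elim: s xs {IH us rP} => [|y s IH] /=; first by exists 1.
    rewrite inE negb_or => /andP[xy /IH[q q0 qP]].
    exists (Num.min q `|x - y|); first by rewrite lt_min q0 normr_gt0 subr_eq0.
    move=> z; rewrite inE ge_min => /predU1P[->|/qP ->] //.
    by rewrite lexx orbT.
  exists (Num.min r q); first by rewrite lt_min r0.
  move=> y z; rewrite !inE ge_min => /predU1P[->|ys] /predU1P[->|zs].
  - by rewrite eqxx.
  - by rewrite qP ?orbT.
  - by rewrite distrC qP ?orbT.
  - by move=> yz; rewrite rP.
near=> n.
have nd : (2 ^+ n)^-1 < d by near: n; exact: near_two_expV_lt.
have nr : (2 ^+ n)^-1 < r by near: n; exact: near_two_expV_lt.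
have kP x : exists k, x \in s ->
    [/\ (k < 2 ^ n)%N, dyadic R n k < x & x <= dyadic R n k.+1].
  case: (boolP (x \in s)) => [xs|_]; last by exists 0%N.
  have [/andP[x0 x1] [Fx _]] := sZ x xs.
  have [|k kP] := @dyadic_cell R x n; last by exists k.
  rewrite x1 andbT lt_neqAle x0 andbT.
  by apply: contraNneq F0 => E; rewrite [X in F X]E Fx.
have [k {}kP] := choice kP.
rewrite lee_fin ler_nat crossingsE -(size_map k).
apply: uniq_leq_size.
  rewrite map_inj_in_uniq // => x y xs ys E.
  apply/eqP/negPn/negP => /(rP x y xs ys).
  have [_ x1 x2] := kP x xs; have [_ y1 y2] := kP y ys.
  rewrite E in x1 x2; apply/negP; rewrite -ltNge; apply: lt_trans nr.
  have D := dyadicB R n (k y); rewrite -D ltr_norml; apply/andP; split; lra.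
move=> _ /mapP[x xs ->]; have [kn k1 k2] := kP x xs.
rewrite mem_filter mem_index_iota kn /= andbT.
have [_ [Fx _]] := sZ x xs.
exact: (zero_dyadic_crossing dF w0 Fx (dP x xs) nd k1 k2).
Unshelve. all: by end_near. Qed.

(** * Joint law of the slope and the height *)

(* No measurability is required: the integral of a nonnegative function is the
   supremum of the integrals of the simple functions below it, and restricting
   a simple function to the complement of [N] does not change its integral. *)
Lemma ge0_le_integral_off_null (d : measure_display) (T : measurableType d)
    (R : realType) (mu : {measure set T -> \bar R}) (N : set T) (f g : T -> \bar R) :
  measurable N -> mu N = 0 -> (forall x, 0 <= f x)%E -> (forall x, 0 <= g x)%E ->
  (forall x, ~ N x -> (f x <= g x)%E) ->
  (\int[mu]_x f x <= \int[mu]_x g x)%E.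
Proof.
move=> mN N0 f0 g0 fg; rewrite !ge0_integralTE //.
apply: ge_ereal_sup => _ [h /= hf <-].
apply: le_ereal_sup_tmp; exists (sintegral mu (proj_nnsfun h (measurableC mN))).
  exists (proj_nnsfun h (measurableC mN)) => // x; rewrite /= mindicE.
  have [|] := boolP (x \in ~` N); last by rewrite mulr0.
  by rewrite inE mulr1 => Nx; apply: le_trans (hf x) (fg x Nx).
rewrite -!integralT_nnsfun le_eqVlt; apply/orP; left; apply/eqP.
apply: ge0_ae_eq_integral => //.
- exact/measurable_EFinP.
- exact/measurable_EFinP.
- by move=> x _; rewrite lee_fin.
- by move=> x _; rewrite lee_fin mulr_ge0.
- exists N; split=> // x /= /not_implyP[_ hx]; apply: contrapT => Nx; apply: hx.
  by rewrite mindicE mem_set //= mulr1.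
Qed.

Lemma eq_integral_off_null (d : measure_display) (T : measurableType d)
    (R : realType) (mu : {measure set T -> \bar R}) (N : set T) (f g : T -> \bar R) :
  measurable N -> mu N = 0 -> (forall x, 0 <= f x)%E -> (forall x, 0 <= g x)%E ->
  (forall x, ~ N x -> f x = g x) ->
  (\int[mu]_x f x = \int[mu]_x g x)%E.
Proof.
move=> mN N0 f0 g0 fg; apply/eqP; rewrite eq_le; apply/andP; split;
  by apply: (ge0_le_integral_off_null mN N0) => // x Nx; rewrite fg.
Qed.

Lemma measurable_cos_combination (d : measure_display) (T : measurableType d)
    (R : realType) (a b c : R) (X Y : T -> R) :
  measurable_fun setT X -> measurable_fun setT Y ->
  measurable_fun setT (fun o => cos (a * X o + b * Y o - c)).
Proof.
move=> mX mY; apply: (measurableT_comp (@measurable_cos R)).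
apply: measurable_funB => //; apply: measurable_funD; exact: measurable_funM.
Qed.

(** Independence is read off from the transform: it is that of the product law, and transforms
    determine planar laws. *)
Lemma normal_pair_law (d : measure_display) (T : measurableType d)
    (R : realType) (P : probability T R) (X Y : T -> R) (s t : R) :
  measurable_fun setT X -> measurable_fun setT Y -> s != 0 -> t != 0 ->
  (forall a b c, (\int[P]_o (cos (a * X o + b * Y o - c))%:E =
    (cos c * expR (- (a ^+ 2 * s ^+ 2 + b ^+ 2 * t ^+ 2) / 2))%:E)%E) ->
  forall A : set (measurableTypeR R * measurableTypeR R), measurable A ->
  P [set o | A (X o, Y o)] = normal_pair s t A.
Proof.
move=> mX mY s0 t0 cosE A mA.
pose V : T -> measurableTypeR R * measurableTypeR R := fun o => (X o, Y o).
have mV : measurable_fun setT V by exact: measurable_fun_pair.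
pose V' : {mfun T >-> (measurableTypeR R * measurableTypeR R)%type} :=
  HB.pack_for {mfun T >-> (measurableTypeR R * measurableTypeR R)%type} V
    (isMeasurableFun.Build _ _ _ _ V mV).
rewrite -[LHS]/(distribution P V' A).
apply: cos_transform_inj => // a b c.
rewrite integral_cos_normal_pair //.
rewrite -(@integral_image_law _ _ _ _ R P (distribution P V') V
  (fun p => (cos (a * p.1 + b * p.2 - c))%:E)) //; last first.
  by apply/measurable_EFinP; apply: measurable_cos_combination;
    [exact: measurable_fst|exact: measurable_snd].
rewrite cosE -mulrA -expRD; congr (_ * expR _)%:E.
by rewrite !exprMn; field.
Qed.

(** The mean of [quotient_symbol (V o) h] is [2 / h^2] times [1 - E[cos (h V)]], hence 0, so this
    nonnegative variable vanishes almost surely. Along [h = 2^-n] it tends to the square of [V]. *)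
Lemma cos_transform_degenerate (d : measure_display) (T : measurableType d)
    (R : realType) (P : probability T R) (V : T -> R) :
  measurable_fun setT V ->
  (forall b, (\int[P]_o (cos (b * V o))%:E = 1)%E) ->
  {ae P, forall o, V o = 0}.
Proof.
move=> mV cosE.
have ae1 (n : nat) : {ae P, forall o, quotient_symbol (V o) (2 ^+ n)^-1 = 0}.
  have h0 : (2 ^+ n)^-1 != 0 :> R by rewrite invr_eq0 expf_neq0.
  set h := (2 ^+ n)^-1 in h0 *.
  have mq : measurable_fun setT (fun o => (quotient_symbol (V o) h)%:E : \bar R).
    apply/measurable_EFinP.
    under eq_fun do rewrite quotient_symbolE //.
    apply: measurable_funM => //; apply: measurable_funB => //.
    by apply: (measurableT_comp (@measurable_cos R)); exact: measurable_funM.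
  have : {ae P, forall o, setT o -> (quotient_symbol (V o) h)%:E = cst 0%E o}.
    apply/(ae_eq_integral_abs P measurableT mq).
    under eq_integral do rewrite gee0_abs ?lee_fin ?quotient_symbol_ge0 //
      quotient_symbolE // EFinM.
    rewrite ge0_integralZl //; last 2 first.
    + apply/measurable_EFinP; apply: measurable_funB => //.
      by apply: (measurableT_comp (@measurable_cos R)); exact: measurable_funM.
    + by rewrite lee_fin divr_ge0 // exprn_even_ge0.
    under eq_integral do rewrite EFinB.
    rewrite integralB //; last 2 first.
    + exact: finite_measure_integrable_cst.
    + apply: (@bounded_probability_integrable _ _ _ P _ 1).
        by apply: (measurableT_comp (@measurable_cos R)); exact: measurable_funM.
      by move=> o; exact: cos_max.
    rewrite cosE integral_cst // [X in (_ * (1 * X - _))%E]probability_setT.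
    by rewrite mule1 subee // mule0.
  by apply: filterS => o /(_ Logic.I) [].
apply: (filterS _ (ae_foralln ae1)) => // o q0.
have := @cvg_quotient_symbol R (V o) (fun n => (2 ^+ n)^-1) _ (@cvg_two_expV R).
have H n : (2 ^+ n)^-1 != 0 :> R by rewrite invr_eq0 expf_neq0.
move=> /(_ H); under eq_fun do rewrite q0.
move=> /(cvg_unique (@norm_hausdorff _ R)) /(_ (cvg_cst 0)) /eqP.
by rewrite sqrf_eq0 => /eqP.
Qed.

(** * Density of an independent normal pair and uniqueness of a continuous density *)

Lemma measurable_patch (d : measure_display) (T : measurableType d)
    (R : realType) (f : T -> \bar R) (A : set T) :
  measurable A -> measurable_fun setT f -> measurable_fun setT (f \_ A).
Proof.
by move=> mA mf; apply/(measurable_restrictT _ mA).1; exact: measurable_funTS.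
Qed.

Lemma normal_pair_density (R : realType) (s t : R)
    (A : set (measurableTypeR R * measurableTypeR R)) :
  measurable A ->
  (normal_pair s t A = \int[lebesgue_measure \x lebesgue_measure]_(p in A)
    (normal_pdf 0 s p.1 * normal_pdf 0 t p.2)%:E)%E.
Proof.
move=> mA.
have mpdf u : measurable_fun setT (normal_pdf (0 : R) u) by exact: measurable_normal_pdf.
rewrite integral_mkcond.
set f := (X in X \_ A).
have f0 p : (0 <= (f \_ A) p)%E.
  by rewrite patchE; case: ifP => // _; rewrite lee_fin mulr_ge0 ?normal_pdf_ge0.
have mf : measurable_fun setT (f \_ A).
  have mfT : measurable_fun setT f.
    apply/measurable_EFinP; apply: measurable_funM.
      exact: (measurableT_comp (mpdf s) measurable_fst).
    exact: (measurableT_comp (mpdf t) measurable_snd).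
  exact: measurable_patch mA mfT.
apply: esym; apply: (eq_trans (fubini_tonelli1 (m1 := @lebesgue_measure R) (m2 := @lebesgue_measure R) _ mf f0)).
rewrite /normal_pair /= /product_measure1.
apply: esym; apply: (eq_trans (integral_normal_prob 0 s _)).
  exact: (measurable_fun_xsection (normal_prob 0 t) mA).
apply: eq_integral => x _; rewrite /fubini_F /= muleC.
rewrite /normal_prob -ge0_integralZl ?lee_fin ?normal_pdf_ge0 //; last 3 first.
- exact: (measurable_xsection x mA).
- exact: (measurable_funTS ((measurable_EFinP _ _).2 (mpdf t))).
- by move=> y _; rewrite lee_fin normal_pdf_ge0.
rewrite integral_mkcond; apply: eq_integral => y _; rewrite !patchE.
by rewrite /f; have -> : (y \in xsection A x) = ((x, y) \in A) by rewrite mem_xsection.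
Qed.

(** If [f] exceeded [q] at a point, it would exceed [q] by half the gap on a square around it, and
    so would its integral there by half the gap times the area. Finiteness of the integral of [q] is
    what allows cancellation. *)
Lemma continuous_density_le (R : realType)
    (f q : measurableTypeR R * measurableTypeR R -> R) :
  measurable_fun setT f -> measurable_fun setT q ->
  (forall p, 0 <= f p) -> (forall p, 0 <= q p) ->
  continuous (f : R * R -> R) -> continuous (q : R * R -> R) ->
  (forall A, measurable A ->
    \int[lebesgue_measure \x lebesgue_measure]_(p in A) (f p)%:E =
    \int[lebesgue_measure \x lebesgue_measure]_(p in A) (q p)%:E)%E ->
  (\int[lebesgue_measure \x lebesgue_measure]_p (q p)%:E < +oo)%E ->
  forall p, f p <= q p.
Proof.
move=> mf mq f0 q0 cf cq fq fin [x y]; rewrite leNgt; apply/negP => lt.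
pose e := (f (x, y) - q (x, y)) / 2.
have e0 : 0 < e by rewrite divr_gt0 // subr_gt0.
have cfq : f p - q p @[p --> ((x, y) : R * R)] --> f (x, y) - q (x, y).
  by apply: cvgB; [exact: cf|exact: cq].
have : \forall p \near ((x, y) : R * R), e < f p - q p.
  by apply: (cvgr_gt _ cfq); rewrite /e; lra.
case=> -[/= B1 B2] [[r1 /= r10 rB1] [r2 /= r20 rB2]] B12.
pose r := Num.min r1 r2; have r0 : 0 < r by rewrite lt_min r10.
pose B : set (measurableTypeR R) := `]x - r, x + r[%classic.
pose C : set (measurableTypeR R) := `]y - r, y + r[%classic.
have mBC : measurable (B `*` C) by apply: measurableX; exact: measurable_itv.
have BCe p : (B `*` C) p -> q p + e <= f p.
  move=> [Bp Cp]; have : (B1 `*` B2) p.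
    move: Bp Cp; rewrite /B /C /= !in_itv /= => /andP[b1 b2] /andP[c1 c2].
    have [rr1 rr2] : r <= r1 /\ r <= r2 by rewrite /r !ge_min !lexx orbT.
    split; [apply: rB1 => /=|apply: rB2 => /=];
      rewrite ltr_distlC; apply/andP; split; lra.
  by move/B12 => /= ?; lra.
have finBC : (\int[lebesgue_measure \x lebesgue_measure]_(p in B `*` C) (q p)%:E < +oo)%E.
  apply: le_lt_trans fin; apply: ge0_subset_integral => //.
  - exact/measurable_EFinP.
  - by move=> p _; rewrite lee_fin.
have : (\int[lebesgue_measure \x lebesgue_measure]_(p in B `*` C) (q p + e)%:E <=
        \int[lebesgue_measure \x lebesgue_measure]_(p in B `*` C) (f p)%:E)%E.
  apply: ge0_le_integral => //.
  - by move=> p _; rewrite lee_fin addr_ge0 // ltW.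
  - by apply/measurable_EFinP/measurable_funTS; exact: measurable_funD.
  - by apply/measurable_EFinP/measurable_funTS.
under eq_integral do rewrite EFinD.
rewrite ge0_integralD //; last 3 first.
- by move=> p _; rewrite lee_fin.
- by apply/measurable_EFinP/measurable_funTS.
- by move=> p _; rewrite lee_fin ltW.
rewrite fq // integral_cst //.
rewrite [X in (e%:E * X)%E](_ : _ = ((2 * r) ^+ 2)%:E); last first.
  apply: (eq_trans (product_measure1E (@lebesgue_measure R) (@lebesgue_measure R)
    (measurable_itv _) (measurable_itv _))).
  have leb (z : R) : lebesgue_measure `]z - r, z + r[%classic = (2 * r)%:E.
    rewrite lebesgue_measure_itv /= lte_fin; have -> : z - r < z + r by lra.
    by rewrite -EFinB; congr EFin; ring.
  apply: (eq_trans (f_equal2 mule (leb x) (leb y))).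
  by rewrite -EFinM expr2.
have : (\int[lebesgue_measure \x lebesgue_measure]_(p in B `*` C) (q p)%:E \is a fin_num)%E.
  rewrite ge0_fin_numE //; apply: integral_ge0 => p _; by rewrite lee_fin.
move: (integral _ _ _) => I /fineK <-; rewrite -EFinM -EFinD lee_fin.
have : 0 < e * (2 * r) ^+ 2 by rewrite mulr_gt0 // exprn_gt0 // mulr_gt0.
lra.
Qed.

Lemma continuous_density_unique (R : realType)
    (f q : measurableTypeR R * measurableTypeR R -> R) :
  measurable_fun setT f -> measurable_fun setT q ->
  (forall p, 0 <= f p) -> (forall p, 0 <= q p) ->
  continuous (f : R * R -> R) -> continuous (q : R * R -> R) ->
  (forall A, measurable A ->
    \int[lebesgue_measure \x lebesgue_measure]_(p in A) (f p)%:E =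
    \int[lebesgue_measure \x lebesgue_measure]_(p in A) (q p)%:E)%E ->
  (\int[lebesgue_measure \x lebesgue_measure]_p (q p)%:E < +oo)%E ->
  f =1 q.
Proof.
move=> mf mq f0 q0 cf cq fq fin p; apply: le_anti; apply/andP; split.
  exact: continuous_density_le.
apply: continuous_density_le => //; first by move=> A mA; rewrite fq.
by rewrite fq.
Qed.

(** * Laws of difference quotients and their limit *)

Definition slope_variance (R : realType) (g : R) (S : R -> R -> R) (h : R) : R :=
  2 * (covariance_x g S 0 - covariance_x g S h) / h ^+ 2.

Definition mean_variance (R : realType) (g : R) (S : R -> R -> R) (h : R) : R :=
  (covariance_x g S 0 + covariance_x g S h) / 2.

(** The exponent has no term in [a * b] because the two values have the same variance, which makes
    their sum and difference uncorrelated. *)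
Lemma sea_model_slope_mean_cos (d : measure_display) (T : measurableType d)
    (R : realType) (P : probability T R) (g : R) (S : R -> R -> R)
    (W : R -> R -> {RV P >-> R}) (x y a b c : R) :
  sea_model g S W -> x != y ->
  (\int[P]_o (cos (a * ((W y 0 o - W x 0 o) / (y - x)) +
                   b * ((W x 0 o + W y 0 o) / 2) - c))%:E =
   (cos c * expR (- (a ^+ 2 * slope_variance g S (y - x) +
                     b ^+ 2 * mean_variance g S (y - x)) / 2))%:E)%E.
Proof.
move=> seaW xy; have h0 : y - x != 0 by rewrite subr_eq0 eq_sym.
have := sea_model_cos x y (b / 2 - a / (y - x)) (b / 2 + a / (y - x)) c seaW.
rewrite /slope_variance /mean_variance.
move: (y - x) h0 (covariance_x g S) => h h0 rho E.
transitivity (\int[P]_o (cos ((b / 2 - a / h) * W x 0 o +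
    (b / 2 + a / h) * W y 0 o - c))%:E)%E.
  by apply: eq_integral => o _; congr (cos (_ - c))%:E; field.
by rewrite E; congr (_ * expR _)%:E; field.
Qed.

(** With the left value in place of the half-sum a cross term remains, but it carries the factor
    [y - x] and disappears with the mesh. This form is the one whose limit is the law of slope and
    height at a point. *)
Lemma sea_model_slope_value_cos (d : measure_display) (T : measurableType d)
    (R : realType) (P : probability T R) (g : R) (S : R -> R -> R)
    (W : R -> R -> {RV P >-> R}) (x y a b c : R) :
  sea_model g S W -> x != y ->
  (\int[P]_o (cos (a * ((W y 0 o - W x 0 o) / (y - x)) + b * W x 0 o - c))%:E =
   (cos c * expR (- (a ^+ 2 * slope_variance g S (y - x) +
      b ^+ 2 * covariance_x g S 0 -
      a * b * (y - x) * slope_variance g S (y - x)) / 2))%:E)%E.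
Proof.
move=> seaW xy; have h0 : y - x != 0 by rewrite subr_eq0 eq_sym.
have := sea_model_cos x y (b - a / (y - x)) (a / (y - x)) c seaW.
rewrite /slope_variance.
move: (y - x) h0 (covariance_x g S) => h h0 rho E.
transitivity (\int[P]_o (cos ((b - a / h) * W x 0 o + (a / h) * W y 0 o - c))%:E)%E.
  by apply: eq_integral => o _; congr (cos (_ - c))%:E; field.
by rewrite E; congr (_ * expR _)%:E; field.
Qed.

Lemma dyadic_slopeE (R : realType) (F : R -> R) (n k : nat) :
  dyadic_slope F n k = (F (dyadic R n k.+1) - F (dyadic R n k)) /
    (dyadic R n k.+1 - dyadic R n k).
Proof. by rewrite dyadicB invrK. Qed.

Lemma cvg_dyadic_slope (R : realType) (F : R -> R) :
  derivable F 0 1 -> dyadic_slope F n 0 @[n --> \oo] --> derive1 F 0.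
Proof.
move=> dF; have h0 n : (2 ^+ n)^-1 != 0 :> R by rewrite invr_eq0 expf_neq0.
have /cvg_ex[l Hl] := dF.
have -> : derive1 F 0 = l by rewrite derive1E; exact/cvg_lim.
have /cvgr_dnbhsP := Hl.
move=> /(_ (fun n => (2 ^+ n)^-1) (conj h0 (@cvg_two_expV R))) {}Hl.
apply: cvg_trans Hl; apply: near_eq_cvg; apply: nearW => n.
by rewrite /dyadic_slope /dyadic mul0r mul1r /= /GRing.scale/= addr0 mulr1 invrK mulrC.
Qed.

(** [x_derivative] is arbitrary where a path is not differentiable, so it need not be measurable.
    Setting it to 0 on a measurable null set [N] makes it the everywhere limit of measurable dyadic
    slopes, likewise cut off on [N]. *)
Lemma as_C1_version (d : measure_display) (T : measurableType d)
    (R : realType) (P : probability T R) (W : R -> R -> {RV P >-> R}) :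
  as_C1_in_x W ->
  exists (N : set T) (X : T -> R), [/\ measurable N, P N = 0%E,
    measurable_fun setT X & forall o, ~ N o ->
      [/\ forall x : R, derivable (fun y : R => W y 0 o) x 1,
          continuous (derive1 (fun y : R => W y 0 o)),
          X o = x_derivative W 0 0 o &
          dyadic_slope (fun y : R => W y 0 o) n 0 @[n --> \oo] --> X o]].
Proof.
case=> N [mN N0 NP].
pose X o : R := if o \in N then 0 else x_derivative W 0 0 o.
have good o : ~ N o -> (forall x : R, derivable (fun y : R => W y 0 o) x 1) /\
    continuous (fun x : R => x_derivative W x 0 o).
  by move=> No; apply: contrapT => /NP.
have cvgX o : ~ N o ->
    dyadic_slope (fun y : R => W y 0 o) n 0 @[n --> \oo] --> X o.
  move=> No; rewrite /X memNset //.
  by apply: cvg_dyadic_slope; exact: (good o No).1.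
exists N, X; split => //; last first.
  move=> o No; have [g1 g2] := good o No; split => //; last exact: cvgX.
  by rewrite /X memNset.
apply: (@measurable_fun_cvg _ _ _ _
  (fun n => (fun o => dyadic_slope (fun y : R => W y 0 o) n 0) \_ (~` N))).
  move=> n; apply/(measurable_restrictT _ (measurableC mN)).1; apply: measurable_funTS.
  by apply: measurable_funM => //; exact: measurable_funB.
move=> o _; have [oN|oN] := boolP (o \in N).
  rewrite /X oN; apply: cvg_near_cst; apply: nearW => n.
  by rewrite patchE memNset //=; move: oN; rewrite inE => oN /(_ oN).
have /negP := oN; rewrite inE => No; have := cvgX o No.
apply: cvg_trans; apply: near_eq_cvg; apply: nearW => n.
by rewrite patchE mem_set.
Qed.

Lemma sea_model_dyadic_cos (d : measure_display) (T : measurableType d)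
    (R : realType) (P : probability T R) (g : R) (S : R -> R -> R)
    (W : R -> R -> {RV P >-> R}) (n k : nat) (a b c : R) :
  sea_model g S W ->
  (\int[P]_o (cos (a * dyadic_slope (fun y : R => W y 0 o) n k +
     b * ((W (dyadic R n k) 0 o + W (dyadic R n k.+1) 0 o) / 2) - c))%:E =
   (cos c * expR (- (a ^+ 2 * slope_variance g S (2 ^+ n)^-1 +
                     b ^+ 2 * mean_variance g S (2 ^+ n)^-1) / 2))%:E)%E.
Proof.
move=> seaW; rewrite -(dyadicB R n k) -(sea_model_slope_mean_cos a b c seaW); last first.
  by rewrite lt_eqF // dyadic_lt.
by apply: eq_integral => o _; rewrite dyadic_slopeE.
Qed.

Lemma measurable_dyadic_slope (d : measure_display) (T : measurableType d)
    (R : realType) (P : probability T R) (W : R -> R -> {RV P >-> R}) (n k : nat) :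
  measurable_fun setT (fun o => dyadic_slope (fun y : R => W y 0 o) n k).
Proof. by apply: measurable_funM => //; exact: measurable_funB. Qed.

Lemma sea_model_variance_finite (d : measure_display) (T : measurableType d)
    (R : realType) (P : probability T R) (g : R) (S : R -> R -> R)
    (W : R -> R -> {RV P >-> R}) :
  sea_model g S W -> (sea_covariance g S 0 0 < +oo)%E.
Proof.
by move=> seaW; have [_] := sea_model_covariance 0 0 seaW; rewrite subrr => ->; exact: ltry.
Qed.

Lemma cvg_slope_variance (d : measure_display) (T : measurableType d)
    (R : realType) (P : probability T R) (g : R) (S : R -> R -> R)
    (W : R -> R -> {RV P >-> R}) :
  sea_model g S W -> as_C1_in_x W ->
  slope_variance g S (2 ^+ n)^-1 @[n --> \oo] --> fine (spectral_moment g S 2 0).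
Proof.
move=> seaW C1; have [dS _ _ _ _] := seaW.
have fin := sea_model_variance_finite seaW.
have h0 n : (2 ^+ n)^-1 != 0 :> R by rewrite invr_eq0 expf_neq0.
have [N [X [mN N0 mX NX]]] := as_C1_version C1.
have [M vM] : exists M, \forall n \near \oo, slope_variance g S (2 ^+ n)^-1 <= M.
  apply: (@gaussian_variance_bounded _ _ _ P
    (fun n o => dyadic_slope (fun y : R => W y 0 o) n 0) X) => //.
  - by move=> n; exact: measurable_dyadic_slope.
  - exists N; split => // o /= nD; apply: contrapT => /NX[_ _ _]; exact: nD.
  - move=> n s; have := sea_model_dyadic_cos n 0 s 0 0 seaW.
    rewrite cos0 mul1r expr0n mul0r addr0 => <-.
    by apply: eq_integral => o _; rewrite mul0r addr0 subr0.
have fin2 : (spectral_moment g S 2 0 < +oo)%E.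
  apply: le_lt_trans (ltry M).
  exact: (spectral_moment_20_le dS fin h0 (@cvg_two_expV R) vM).
exact: (cvg_spectral_increment dS fin fin2 h0 (@cvg_two_expV R)).
Qed.

(** The covariance at [h] falls short of that at 0 by [h^2 / 2] times the slope variance, and the
    latter converges. *)
Lemma cvg_covariance_x (d : measure_display) (T : measurableType d)
    (R : realType) (P : probability T R) (g : R) (S : R -> R -> R)
    (W : R -> R -> {RV P >-> R}) :
  sea_model g S W -> as_C1_in_x W ->
  covariance_x g S (2 ^+ n)^-1 @[n --> \oo] --> covariance_x g S 0.
Proof.
move=> seaW C1.
have h0 n : (2 ^+ n)^-1 != 0 :> R by rewrite invr_eq0 expf_neq0.
have -> : (fun n => covariance_x g S (2 ^+ n)^-1) = (fun n => covariance_x g S 0 -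
    slope_variance g S (2 ^+ n)^-1 * (2 ^+ n)^-1 * (2 ^+ n)^-1 / 2).
  apply/funext => n; rewrite /slope_variance; move: (2 ^+ n)^-1 (h0 n) (covariance_x g S) => h hn rho.
  by field.
rewrite -[X in _ --> X]subr0.
have -> : 0 = fine (spectral_moment g S 2 0) * 0 * 0 / 2 :> R by rewrite !mulr0 mul0r.
apply: cvgB; first exact: cvg_cst.
by apply: cvgMl; apply: cvgM; [apply: cvgM; [exact: (cvg_slope_variance seaW C1)|]|];
  exact: cvg_two_expV.
Qed.

Lemma slope_value_law_cos (d : measure_display) (T : measurableType d)
    (R : realType) (P : probability T R) (g : R) (S : R -> R -> R)
    (W : R -> R -> {RV P >-> R}) (N : set T) (X : T -> R) (a b c : R) :
  sea_model g S W -> as_C1_in_x W ->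
  measurable N -> P N = 0%E -> measurable_fun setT X ->
  (forall o, ~ N o ->
    dyadic_slope (fun y : R => W y 0 o) n 0 @[n --> \oo] --> X o) ->
  (\int[P]_o (cos (a * X o + b * W 0 0 o - c))%:E =
   (cos c * expR (- (a ^+ 2 * fine (spectral_moment g S 2 0) +
                     b ^+ 2 * covariance_x g S 0) / 2))%:E)%E.
Proof.
move=> seaW C1 mN N0 mX NX.
pose f n o := (cos (a * dyadic_slope (fun y : R => W y 0 o) n 0 + b * W 0 0 o - c))%:E.
have mW : measurable_fun setT (W 0 0) by [].
have mf n : measurable_fun setT (f n).
  apply/measurable_EFinP; apply: measurable_cos_combination => //.
  exact: measurable_dyadic_slope.
have [||||_ _ /=] := @dominated_convergence _ _ _ P setT measurableT f
  (fun o => (cos (a * X o + b * W 0 0 o - c))%:E) (cst 1%E) mf.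
- by apply/measurable_EFinP; exact: measurable_cos_combination.
- exists N; split => // o /= nD; apply: contrapT => /NX DX; apply: nD => _.
  apply: cvg_EFin; first exact: nearW.
  apply: continuous_cvg; first exact: continuous_cos.
  apply: cvgB; last exact: cvg_cst.
  by apply: cvgD; [exact: cvgMr|exact: cvg_cst].
- exact: finite_measure_integrable_cst.
- by apply: aeW => o n _; rewrite /f lee_fin cos_max.
move=> H1.
have x0 n : dyadic R n 0 != dyadic R n 1 by rewrite lt_eqF // dyadic_lt.
have d0 n : dyadic R n 0 = 0 by rewrite /dyadic mul0r.
have E n : (\int[P]_o f n o = (cos c * expR (- (a ^+ 2 * slope_variance g S (2 ^+ n)^-1 +
      b ^+ 2 * covariance_x g S 0 -
      a * b * (2 ^+ n)^-1 * slope_variance g S (2 ^+ n)^-1) / 2))%:E)%E.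
  have := sea_model_slope_value_cos a b c seaW (x0 n); rewrite dyadicB => <-.
  by apply: eq_integral => o _; rewrite /f dyadic_slopeE dyadicB d0.
move: H1; under eq_fun do rewrite E.
move=> H1; apply: (cvg_unique (@ereal_hausdorff R) H1).
apply: cvg_EFin; first exact: nearW.
apply: cvgMr; apply: continuous_cvg; first exact: continuous_expR.
apply: cvgMl; apply: cvgN.
have H := cvg_slope_variance seaW C1.
rewrite -[X in _ --> X]subr0.
have -> : 0 = a * b * 0 * fine (spectral_moment g S 2 0) by rewrite mulr0 mul0r.
apply: cvgB; first by apply: cvgD; [exact: cvgMr|exact: cvg_cst].
by apply: cvgM => //; apply: cvgMr; exact: cvg_two_expV.
Qed.

Lemma joint_density_not_null (d : measure_display) (T : measurableType d)
    (R : realType) (P : probability T R) (X Y : T -> R) (f : R * R -> R)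
    (B : set (measurableTypeR R * measurableTypeR R)) :
  joint_density P X Y f -> measurable B ->
  (lebesgue_measure \x lebesgue_measure)%E B = 0%E ->
  ~ {ae P, forall o, B (X o, Y o)}.
Proof.
move=> [mf f0 fE] mB B0 [N [mN N0 NB]].
have : (\int[P]_o (\1_B (X o, Y o))%:E = 1)%E.
  transitivity (\int[P]_o (cst 1%E o))%E; last first.
    by rewrite integral_cst // [X in (_ * X)%E]probability_setT mule1.
  apply: (eq_integral_off_null mN N0) => [x|x|x Nx]; rewrite ?lee_fin //=.
  by rewrite indicE mem_set //; apply: contrapT => /NB.
rewrite fE // null_set_integral //.
  by move/eqP; rewrite eq_sym onee_eq0.
by apply: measurable_funTS; apply/measurable_EFinP.
Qed.

Lemma null_axes (R : realType) :
  ((lebesgue_measure \x lebesgue_measure)%E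
     ([set 0%R] `*` setT : set (measurableTypeR R * measurableTypeR R)) = 0 :> \bar R)%E /\
  ((lebesgue_measure \x lebesgue_measure)%E
     (setT `*` [set 0%R] : set (measurableTypeR R * measurableTypeR R)) = 0 :> \bar R)%E.
Proof.
have z : lebesgue_measure ([set 0] : set (measurableTypeR R)) = 0%E.
  exact: lebesgue_measure_set1.
have mz : measurable ([set 0] : set (measurableTypeR R)) by exact: measurable_set1.
have mT : measurable ([set: measurableTypeR R]) by [].
have E A B := @product_measure1E _ _ _ _ R (@lebesgue_measure R) (@lebesgue_measure R) A B.
split; [apply: (eq_trans (E _ _ mz mT))|apply: (eq_trans (E _ _ mT mz))].
  by apply: (eq_trans (f_equal (fun u => u * _)%E z)); rewrite mul0e.
by apply: (eq_trans (f_equal (fun u => _ * u)%E z)); rewrite mule0.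
Qed.

(** A zero variance would place the pair almost surely on one of the coordinate axes, a Lebesgue
    null set, against the existence of a density. *)
Lemma sea_model_variances_gt0 (d : measure_display) (T : measurableType d)
    (R : realType) (P : probability T R) (g : R) (S : R -> R -> R)
    (W : R -> R -> {RV P >-> R}) (f : R * R -> R) :
  sea_model g S W -> as_C1_in_x W ->
  joint_density P (x_derivative W 0 0) (W 0 0) f ->
  0 < fine (spectral_moment g S 2 0) /\ 0 < covariance_x g S 0.
Proof.
move=> seaW C1 fP; have [dS _ _ _ _] := seaW.
have [N [X [mN N0 mX NX]]] := as_C1_version C1.
have NX4 o (No : ~ N o) := let: And4 _ _ _ DX := NX o No in DX.
have cosE a b := slope_value_law_cos a b 0 seaW C1 mN N0 mX NX4.
have {}cosE a b : (\int[P]_o (cos (a * X o + b * W 0 0 o))%:E =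
   (expR (- (a ^+ 2 * fine (spectral_moment g S 2 0) +
             b ^+ 2 * covariance_x g S 0) / 2))%:E)%E.
  have := cosE a b; rewrite cos0 mul1r => <-.
  by apply: eq_integral => o _; rewrite subr0.
have [z1 z2] := null_axes R.
have mN0 : measurable ([set 0] : set (measurableTypeR R)) by exact: measurable_set1.
split; rewrite lt_neqAle; apply/andP; split.
- apply/negP => /eqP l0.
  have X0 : {ae P, forall o, X o = 0}.
    apply: cos_transform_degenerate => // b; have := cosE b 0.
    rewrite -l0 mulr0 expr0n mul0r addr0 oppr0 mul0r expR0 => <-.
    by apply: eq_integral => o _; rewrite mul0r addr0.
  apply: (joint_density_not_null fP (measurableX mN0 measurableT) z1).
  have NN : {ae P, forall o, ~ N o}.
    by exists N; split=> // o /= /contrapT.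
  by apply: filterS2 X0 NN => o X0 /NX[_ _ <- _].
- rewrite fine_ge0 // (spectral_moment_20 g dS); apply: integral_ge0 => p _.
  by rewrite lee_fin mulr_ge0 ?sqr_ge0 // spectral_ext_ge0.
- apply/negP => /eqP l0.
  apply: (joint_density_not_null fP (measurableX measurableT mN0) z2).
  have : {ae P, forall o, W 0 0 o = 0}.
    apply: cos_transform_degenerate => // b; have := cosE 0 b.
    rewrite -l0 mulr0 expr0n mul0r addr0 oppr0 mul0r expR0 => <-.
    by apply: eq_integral => o _; rewrite mul0r add0r.
  by apply: filterS => o ->.
- have [+ _] := sea_model_covariance 0 0 seaW; rewrite subrr => E.
  rewrite -lee_fin -E; apply: integral_ge0 => o _.
  by rewrite lee_fin -expr2 sqr_ge0.
Qed.

Lemma slope_value_law (d : measure_display) (T : measurableType d)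
    (R : realType) (P : probability T R) (g : R) (S : R -> R -> R)
    (W : R -> R -> {RV P >-> R}) (f : R * R -> R) :
  sea_model g S W -> as_C1_in_x W ->
  joint_density P (x_derivative W 0 0) (W 0 0) f ->
  forall A : set (measurableTypeR R * measurableTypeR R), measurable A ->
  (\int[P]_o (\1_A (x_derivative W 0 0 o, W 0 0 o))%:E =
   normal_pair (Num.sqrt (fine (spectral_moment g S 2 0)))
     (Num.sqrt (covariance_x g S 0)) A)%E.
Proof.
move=> seaW C1 fP A mA.
have [l0 r0] := sea_model_variances_gt0 seaW C1 fP.
have [N [X [mN N0 mX NX]]] := as_C1_version C1.
have mV : measurable [set o | A (X o, W 0 0 o)].
  rewrite -[X in measurable X]setTI.
  by apply: (@measurable_fun_pair _ _ _ _ _ _ X (W 0 0) mX).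
have NX4 o (No : ~ N o) := let: And4 _ _ _ DX := NX o No in DX.
have cosE a b c := slope_value_law_cos a b c seaW C1 mN N0 mX NX4.
transitivity (P [set o | A (X o, W 0 0 o)]).
  transitivity (\int[P]_o (\1_[set o | A (X o, W 0 0 o)] o)%:E)%E; last first.
    by rewrite integral_indic // setIT.
  apply: (eq_integral_off_null mN N0) => [? | ? | o No]; rewrite ?lee_fin //.
  by have [_ _ <- _] := NX o No; rewrite !indicE; congr ((_ : bool)%:R)%:E; apply/idP/idP; rewrite !inE.
move: l0 r0 cosE; move: (fine _) (covariance_x g S 0) => l r l0 r0 cosE.
apply: normal_pair_law => //; [by rewrite gt_eqF ?sqrtr_gt0..|].
by move=> a b c; rewrite !sqr_sqrtr ?ltW.
Qed.

Lemma normal_pair_continuous_density (R : realType) (s t z y : R) (f : R * R -> R) :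
  s != 0 -> t != 0 ->
  measurable_fun setT (f : measurableTypeR R * measurableTypeR R -> R) ->
  (forall p, 0 <= f p) -> continuous f ->
  (forall A, measurable A -> normal_pair s t A =
    \int[lebesgue_measure \x lebesgue_measure]_(p in A) (f p)%:E)%E ->
  f (z, y) = normal_pdf 0 s z * normal_pdf 0 t y.
Proof.
move=> s0 t0 mf f0 cf fE.
have mpdf u : measurable_fun setT (normal_pdf (0 : R) u) by exact: measurable_normal_pdf.
apply: (@continuous_density_unique R f
  (fun p => normal_pdf 0 s p.1 * normal_pdf 0 t p.2)) => //.
- apply: measurable_funM.
    exact: (measurableT_comp (mpdf s) measurable_fst).
  exact: (measurableT_comp (mpdf t) measurable_snd).
- by move=> p; rewrite mulr_ge0 ?normal_pdf_ge0.
- move=> p; apply: cvgM.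
    apply: (@continuous_comp _ _ _ fst (normal_pdf 0 s)); first exact: cvg_fst.
    exact: continuous_normal_pdf s0 _.
  apply: (@continuous_comp _ _ _ snd (normal_pdf 0 t)); first exact: cvg_snd.
  exact: continuous_normal_pdf t0 _.
- by move=> A mA; rewrite -fE // normal_pair_density.
- by rewrite -normal_pair_density // (le_lt_trans (probability_le1 _ _)) // ltry.
Qed.

(** A density is fixed only up to a null set, yet the conditional mean evaluates it on a line;
    continuity selects the product of normal densities at every point. *)
Lemma slope_value_density (d : measure_display) (T : measurableType d)
    (R : realType) (P : probability T R) (g : R) (S : R -> R -> R)
    (W : R -> R -> {RV P >-> R}) (f : R * R -> R) (z y : R) :
  sea_model g S W -> as_C1_in_x W ->
  joint_density P (x_derivative W 0 0) (W 0 0) f -> continuous f ->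
  f (z, y) = normal_pdf 0 (Num.sqrt (fine (spectral_moment g S 2 0))) z *
             normal_pdf 0 (Num.sqrt (covariance_x g S 0)) y.
Proof.
move=> seaW C1 fP cf; have [mf f0 fE] := fP.
have [l0 r0] := sea_model_variances_gt0 seaW C1 fP.
apply: (normal_pair_continuous_density _ _ _ _ mf f0 cf).
- exact: lt0r_neq0 (etrans (sqrtr_gt0 _) l0).
- exact: lt0r_neq0 (etrans (sqrtr_gt0 _) r0).
- by move=> A mA; rewrite -(slope_value_law seaW C1 fP mA) fE.
Qed.

(** * Rice's formula *)

(** The integrand is [- z p(z)] cut at [min w 0], and [- z p(z)] is the derivative of [s^2 p(z)]. *)
Lemma neg_part_normal_pdf_integral (R : realType) (s w : R) : s != 0 ->
  (\int[lebesgue_measure]_z (neg_part z * \1_(`]-oo, w]) z * normal_pdf 0 s z)%:E =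
   (s ^+ 2 * normal_pdf 0 s (Num.min w 0))%:E)%E.
Proof.
move=> s0; set b := Num.min w 0.
have b0 : b <= 0 by rewrite /b ge_min lexx orbT.
pose f (z : R) := - z * normal_pdf 0 s z.
have fE z : (neg_part z * \1_(`]-oo, w]) z * normal_pdf 0 s z)%:E =
    ((EFin \o f) \_ `]-oo, b]) z.
  rewrite patchE mem_setE in_itv /= indicE mem_setE in_itv /= /neg_part /b /f.
  rewrite le_min; case: (leP z w) => _ /=; last by rewrite mulr0 mul0r.
  rewrite mulr1; case: (leP z 0) => z0.
    by rewrite max_l // oppr_ge0.
  by rewrite max_r ?mul0r // oppr_le0 ltW.
under eq_integral do rewrite fE.
rewrite -integral_mkcond.
have s20 : 0 < s ^+ 2 by rewrite exprn_even_gt0.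
have cf : continuous f.
  move=> z; apply: cvgM; first by apply: cvgN; exact: cvg_id.
  exact: continuous_normal_pdf s0 z.
apply: (@integral_FTC_exhaust R f (fun z => s ^+ 2 * normal_pdf 0 s z) _
  (fun n => b - n.+1%:R) (fun=> b)) => //.
- move=> x; have dp := is_derive_normal_pdf 0 x s0.
  have := is_deriveZ (s ^+ 2) dp.
  rewrite subr0 /GRing.scale /= /f => H.
  apply: (@is_derive_eq _ _ _ _ _ _ _ _ H).
  by rewrite mulrA mulrN mulrCA mulfV ?mulr1 // gt_eqF.
- apply: (@integrableS _ _ _ lebesgue_measure setT) => //.
  apply: (@integrable_normal_pdf_growth R 0 s 1 (fun z => - z)) => //.
  + exact: measurable_funN.
  + move=> z; rewrite normrN mul1r subr0 -(real_normK (num_real z)).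
    by move: `|z| => u; nra.
- by move=> n; rewrite ltrBlDr ltrDl.
- by move=> n z; rewrite /= !in_itv /= => /andP[].
- move=> z; rewrite /= in_itv /= => zb; near=> n; rewrite zb andbT lerBlDr.
  rewrite -lerBlDl; near: n.
  exists (Num.bound (b - z)) => //= n /= bn.
  apply: (le_trans (ltW (archi_boundP _))); first by rewrite subr_ge0.
  by rewrite ler_nat; exact: leqW.
- rewrite -[X in _ --> X]subr0; apply: cvgB; first exact: cvg_cst.
  (* By [normal_pdf_sqr_le], [C] bounds [x^2 p(x)] for all [x]. Since [k <= (b - k)^2] when [k >= 1]
     and [b <= 0], the density at [b - k] is at most [C / k]. *)
  pose C := 4 * s ^+ 2 * (normal_peak s / normal_peak (Num.sqrt 2 * s)) *
    normal_peak (Num.sqrt 2 * s).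
  apply: (@squeeze_cvgr _ _ _ _ (cst 0) (fun n => s ^+ 2 * (C * n.+1%:R^-1))).
  + near=> n; rewrite mulr_ge0 ?normal_pdf_ge0 ?(ltW s20) //=.
    rewrite ler_pM2l // ler_pdivlMr //.
    have q0 : (Num.sqrt 2 * s : R) != 0 by rewrite mulf_neq0 // sqrtr_eq0 -ltNge.
    apply: (@le_trans _ _ ((b - n.+1%:R - 0) ^+ 2 * normal_pdf 0 s (b - n.+1%:R))).
      rewrite mulrC ler_wpM2r ?normal_pdf_ge0 // subr0.
      have sqr_far (m c : R) : 1 <= m -> c <= 0 -> m <= (c - m) ^+ 2 by nra.
      by apply: sqr_far => //; rewrite ler1n.
    apply: (le_trans (normal_pdf_sqr_le 0 _ s0)).
    have [p1 p2] := (normal_peak_gt0 s0, normal_peak_gt0 q0).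
    apply: ler_wpM2l; last exact: normal_pdf_ub.
    by apply: mulr_ge0; [rewrite mulr_ge0 ?sqr_ge0|rewrite divr_ge0 ?ltW].
  + exact: cvg_cst.
  + rewrite -[X in _ --> X](mulr0 (s ^+ 2)); apply: cvgMr.
    by rewrite -[X in _ --> X](mulr0 C); apply: cvgMr; exact: cvg_harmonic.
Unshelve. all: by end_near. Qed.

(** Here [p.1] is the difference quotient and [p.2] the half-sum of two values at distance [h], so
    the left value is [p.2 - h * p.1 / 2] and the right one [p.2 + h * p.1 / 2]. *)
Definition crossing_set (R : realType) (h w : R) :
    set (measurableTypeR R * measurableTypeR R) :=
  [set p | p.1 <= w /\ h * p.1 / 2 < p.2 <= - (h * p.1 / 2)].

Lemma measurable_crossing_set (R : realType) (h w : R) :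
  measurable (crossing_set h w).
Proof.
have m1 : measurable_fun setT (fun p : measurableTypeR R * measurableTypeR R => p.1 : R).
  exact: measurable_fst.
have m2 : measurable_fun setT (fun p : measurableTypeR R * measurableTypeR R => p.2 : R).
  exact: measurable_snd.
have mh : measurable_fun setT
    (fun p : measurableTypeR R * measurableTypeR R => h * p.1 / 2 : R).
  by apply: measurable_funM => //; exact: measurable_funM.
have -> : crossing_set h w = [set p | p.1 <= w] `&` ([set p | h * p.1 / 2 < p.2] `&`
    [set p | p.2 <= - (h * p.1 / 2)]).
  apply/seteqP; split => p /=.
    by case=> pw /andP[p1 p2].
  by case=> pw [p1 p2]; split => //; apply/andP.
rewrite -[X in measurable X]setTI; apply: measurableI => //; apply: measurableI.
  have := measurable_fun_ler m1 (measurable_cst w).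
  by move=> /(_ measurableT [set true]); rewrite setTI; exact.
apply: measurableI.
  have := measurable_fun_ltr mh m2.
  by move=> /(_ measurableT [set true]); rewrite setTI; exact.
have := measurable_fun_ler m2 (measurable_funN mh).
by move=> /(_ measurableT [set true]); rewrite setTI; exact.
Qed.

Definition crossing_means (R : realType) (h z : R) : set (measurableTypeR R) :=
  `]h * z / 2, - (h * z / 2)]%classic.

Lemma normal_pair_crossing_set (R : realType) (s t h w : R) : s != 0 ->
  (normal_pair s t (crossing_set h w) =
   \int[lebesgue_measure]_z
     (normal_prob 0 t (crossing_means h z) *
      (\1_(`]-oo, w]) z * normal_pdf 0 s z)%:E))%E.
Proof.
move=> s0; have mA := measurable_crossing_set h w.
rewrite {1}/normal_pair /= /product_measure1.
apply: (eq_trans (integral_normal_prob 0 s _)).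
  exact: (measurable_fun_xsection (normal_prob 0 t) mA).
apply: eq_integral => z _ /=; rewrite EFinM muleA; congr (_ * _)%E.
rewrite indicE mem_setE in_itv /=; case: (leP z w) => zw; last first.
  rewrite mule0 (_ : xsection _ z = set0) ?measure0 //.
  by rewrite -subset0 => y; rewrite /xsection /= inE => -[/=]; rewrite leNgt zw.
rewrite mule1; congr normal_prob; apply/seteqP.
by split => y; rewrite /crossing_means /xsection /= inE /crossing_set /= in_itv /= => H; [case: H|split].
Qed.

Lemma lebesgue_measure_crossing (R : realType) (h z : R) : 0 < h ->
  lebesgue_measure (crossing_means h z) =
    (h * neg_part z)%:E.
Proof.
move=> h0; rewrite /crossing_means lebesgue_measure_itv /= lte_fin /neg_part.
have [z0|z0] := leP 0 z.
  have hz : 0 <= h * z by rewrite mulr_ge0 // ltW.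
  rewrite max_r ?oppr_le0 // mulr0; case: ifPn => // H.
  by exfalso; move: H; rewrite ltNge => /negP; apply; lra.
have hz : h * z < 0 by rewrite pmulr_rlt0.
rewrite max_l ?oppr_ge0 ?ltW //; have -> : h * z / 2 < - (h * z / 2) by lra.
by rewrite -EFinB; congr EFin; field.
Qed.

Lemma normal_pdf_even_le (R : realType) (t x y : R) : t != 0 -> `|y| <= `|x| ->
  normal_pdf 0 t x <= normal_pdf 0 t y.
Proof.
move=> t0 yx; rewrite !normal_pdfE // /normal_fun ler_pM2l ?normal_peak_gt0 //.
rewrite ler_expR !mulNr lerN2 !subr0 ler_wpM2r //.
  by rewrite invr_ge0 mulrn_wge0 ?sqr_ge0.
by rewrite -(real_normK (num_real x)) -(real_normK (num_real y)) ler_sqr ?nnegrE.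
Qed.

(** The interval is symmetric about 0, so the even density is largest at 0 and smallest at the ends.
    For [z >= 0] the interval is empty and all three terms are 0. *)
Lemma normal_prob_crossing_bounds (R : realType) (t h z : R) : t != 0 -> 0 < h ->
  ((normal_pdf 0 t (h * z / 2) * (h * neg_part z))%:E <=
    normal_prob 0 t (crossing_means h z)
   <= (normal_pdf 0 t 0 * (h * neg_part z))%:E)%E.
Proof.
move=> t0 h0; have mI : measurable (crossing_means h z) by exact: measurable_itv.
rewrite !EFinM -!EFinM 2!EFinM -(lebesgue_measure_crossing z h0).
have mpdf : measurable_fun (crossing_means h z) (EFin \o normal_pdf 0 t).
  by apply: measurable_funTS; apply/measurable_EFinP; exact: measurable_normal_pdf.
rewrite /normal_prob -!integral_cst //; apply/andP; split; apply: ge0_le_integral => //=.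
- by move=> *; rewrite lee_fin normal_pdf_ge0.
- move=> y; rewrite /crossing_means /= in_itv /= => /andP[y1 y2]; rewrite lee_fin.
  apply: normal_pdf_even_le => //; rewrite ler_norml.
  have := ler_norm (- (h * z / 2)); rewrite normrN => H.
  by apply/andP; split; lra.
- by move=> *; rewrite lee_fin normal_pdf_ge0.
- by move=> y _; rewrite lee_fin normal_pdf_even_le // normr0.
Qed.

(* For [v = s ^+ 2] this is Rice's intensity of downcrossings with slope at most
   [w], when the value and the slope have standard deviations [t] and [s]; the
   lower bound at positive mesh has a smaller effective slope variance [v]. *)
Definition crossing_bound (R : realType) (s t v w : R) : R :=
  normal_peak t * normal_peak s *
  (v * expR (- (Num.min w 0) ^+ 2 / (v *+ 2))).

Lemma measurable_neg_part (R : realType) : measurable_fun setT (@neg_part R).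
Proof. by apply: measurable_maxr => //; exact: measurable_funN. Qed.

Lemma neg_part_ge0 (R : realType) (z : R) : 0 <= neg_part z.
Proof. by rewrite /neg_part le_max lexx orbT. Qed.

Lemma crossing_law_integral (R : realType) (c s w : R) : s != 0 -> 0 <= c ->
  (\int[lebesgue_measure]_z
     (c * (neg_part z * \1_(`]-oo, w]) z * normal_pdf 0 s z))%:E =
   (c * (normal_peak s * (s ^+ 2 * expR (- (Num.min w 0) ^+ 2 / (s ^+ 2 *+ 2)))))%:E)%E.
Proof.
move=> s0 c0; have := neg_part_normal_pdf_integral w s0 => E.
under eq_integral do rewrite EFinM.
rewrite ge0_integralZl //; last 2 first.
- apply/measurable_EFinP; apply: measurable_funM; last exact: measurable_normal_pdf.
  by apply: measurable_funM; [exact: measurable_neg_part|exact: measurable_indic].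
- by move=> z _; rewrite lee_fin !mulr_ge0 ?neg_part_ge0 ?normal_pdf_ge0.
rewrite E normal_pdfE // /normal_fun subr0 -EFinM; congr EFin; ring.
Qed.

Lemma crossing_law_le (R : realType) (s t h w : R) : s != 0 -> t != 0 -> 0 < h ->
  (normal_pair s t (crossing_set h w) <= (h * crossing_bound s t (s ^+ 2) w)%:E)%E.
Proof.
move=> s0 t0 h0; rewrite normal_pair_crossing_set //.
have p0 := normal_peak_ge0 t.
have -> : h * crossing_bound s t (s ^+ 2) w = (h * normal_peak t) *
    (normal_peak s * (s ^+ 2 * expR (- (Num.min w 0) ^+ 2 / (s ^+ 2 *+ 2)))).
  by rewrite /crossing_bound; ring.
have c0 : 0 <= h * normal_peak t by rewrite mulr_ge0 // ltW.
rewrite -crossing_law_integral //.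
apply: (ge0_le_integral_off_null measurable0 (measure0 _)) => z.
- by rewrite mule_ge0 // lee_fin mulr_ge0 ?normal_pdf_ge0.
- by rewrite lee_fin !mulr_ge0 ?neg_part_ge0 ?normal_pdf_ge0 // ltW.
- move=> _; have /andP[_ le2] := normal_prob_crossing_bounds z t0 h0.
  have -> : h * normal_peak t * (neg_part z * \1_(`]-oo, w]) z * normal_pdf 0 s z) =
      (normal_pdf 0 t 0 * (h * neg_part z)) * (\1_(`]-oo, w]) z * normal_pdf 0 s z).
    rewrite (normal_pdfE 0 t0) /normal_fun subrr expr0n oppr0 mul0r expR0; ring.
  by rewrite [X in (_ <= X)%E]EFinM; apply: lee_wpmul2r => //;
    rewrite lee_fin mulr_ge0 ?normal_pdf_ge0.
Qed.

(** Used with [y] proportional to [x]: inverse variances add, and the product is again a normal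
    density in [x] up to its normalization. *)
Lemma normal_pdf_mul (R : realType) (s t r x y : R) : s != 0 -> t != 0 -> r != 0 ->
  x ^+ 2 / s ^+ 2 + y ^+ 2 / t ^+ 2 = x ^+ 2 / r ^+ 2 ->
  normal_pdf 0 t y * normal_pdf 0 s x =
  normal_peak t * normal_peak s / normal_peak r * normal_pdf 0 r x.
Proof.
move=> s0 t0 r0 E; rewrite !normal_pdfE // /normal_fun !subr0.
have -> : expR (- x ^+ 2 / (r ^+ 2 *+ 2)) =
    expR (- y ^+ 2 / (t ^+ 2 *+ 2)) * expR (- x ^+ 2 / (s ^+ 2 *+ 2)).
  rewrite -expRD; congr expR.
  transitivity (- (x ^+ 2 / r ^+ 2) / 2); first by field.
  by rewrite -E; field; rewrite s0.
have : normal_peak r != 0 by rewrite gt_eqF // normal_peak_gt0.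
move: (normal_peak r) (normal_peak s) (normal_peak t) (expR _) (expR _).
by move=> a b c p q a0; field.
Qed.

(** The density of the half-sum is replaced by its value at the end [h z / 2], which is Gaussian in
    the slope [z]. Multiplied by the slope density it gives inverse variance
    [1 / s^2 + h^2 / (4 t^2)], the inverse of the variance in the bound. *)
Lemma crossing_law_ge (R : realType) (s t h w : R) : s != 0 -> t != 0 -> 0 < h ->
  ((h * crossing_bound s t (s ^+ 2 / (1 + h ^+ 2 * s ^+ 2 / (4 * t ^+ 2))) w)%:E <=
   normal_pair s t (crossing_set h w))%E.
Proof.
move=> s0 t0 h0; rewrite normal_pair_crossing_set //.
have [s2 t2] : 0 < s ^+ 2 /\ 0 < t ^+ 2 by rewrite !exprn_even_gt0.
set v := s ^+ 2 / _.
have d0 : 0 < 1 + h ^+ 2 * s ^+ 2 / (4 * t ^+ 2).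
  by rewrite ltr_pwDl // divr_ge0 // mulr_ge0 // ltW // exprn_gt0.
have v0 : 0 < v by rewrite divr_gt0.
pose r := Num.sqrt v; have r0 : r != 0 by apply: lt0r_neq0; rewrite sqrtr_gt0.
have r2 : r ^+ 2 = v by rewrite sqr_sqrtr // ltW.
have [ps pt pr] : [/\ 0 < normal_peak s, 0 < normal_peak t & 0 < normal_peak r].
  by split; exact: normal_peak_gt0.
pose c := h * (normal_peak t * normal_peak s / normal_peak r).
have c0 : 0 <= c by rewrite ltW // mulr_gt0 // divr_gt0 // mulr_gt0.
have -> : h * crossing_bound s t v w =
    c * (normal_peak r * (r ^+ 2 * expR (- (Num.min w 0) ^+ 2 / (r ^+ 2 *+ 2)))).
  rewrite r2 /crossing_bound /c; move: (v * _) => e.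
  by field; rewrite gt_eqF.
rewrite -crossing_law_integral //.
apply: (ge0_le_integral_off_null measurable0 (measure0 _)) => z.
- by rewrite lee_fin mulr_ge0 // !mulr_ge0 ?neg_part_ge0 ?normal_pdf_ge0.
- by rewrite mule_ge0 // lee_fin mulr_ge0 ?normal_pdf_ge0.
- move=> _; have /andP[le1 _] := normal_prob_crossing_bounds z t0 h0.
  have -> : c * (neg_part z * \1_(`]-oo, w]) z * normal_pdf 0 r z) =
      (normal_pdf 0 t (h * z / 2) * (h * neg_part z)) *
      (\1_(`]-oo, w]) z * normal_pdf 0 s z).
    have H : normal_pdf 0 t (h * z / 2) * normal_pdf 0 s z =
        normal_peak t * normal_peak s / normal_peak r * normal_pdf 0 r z.
      apply: normal_pdf_mul => //; rewrite r2 /v; field.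
      rewrite s0 t0 /= andbT; apply: lt0r_neq0.
      by rewrite ltr_wpDr ?sqr_ge0 // mulr_gt0.
    transitivity (h * (neg_part z * \1_(`]-oo, w]) z) *
      (normal_pdf 0 t (h * z / 2) * normal_pdf 0 s z)); last by ring.
    by rewrite H /c; move: (_ / _) => q; ring.
  by rewrite EFinM; apply: lee_wpmul2r => //; rewrite lee_fin mulr_ge0 ?normal_pdf_ge0.
Qed.

Lemma dyadic_crossingE (d : measure_display) (T : measurableType d)
    (R : realType) (P : probability T R) (W : R -> R -> {RV P >-> R}) (w : R)
    (n k : nat) (o : T) :
  dyadic_crossing (fun y : R => W y 0 o) w n k <->
  crossing_set (2 ^+ n)^-1 w (dyadic_slope (fun y : R => W y 0 o) n k,
    (W (dyadic R n k) 0 o + W (dyadic R n k.+1) 0 o) / 2).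
Proof.
rewrite /dyadic_crossing /crossing_set /=.
have -> : (2 ^+ n)^-1 * dyadic_slope (fun y : R => W y 0 o) n k / 2 =
    (W (dyadic R n k.+1) 0 o - W (dyadic R n k) 0 o) / 2.
  by rewrite /dyadic_slope mulrCA mulVf ?expf_neq0 // mulr1.
move: (W _ _ _) (W _ _ _) (dyadic_slope _ _ _) => a b c; split.
  by case/and3P => ? ? cw; split => //; apply/andP; split; lra.
by case=> cw /andP[? ?]; apply/and3P; split; lra.
Qed.

Lemma measurable_dyadic_crossing (d : measure_display) (T : measurableType d)
    (R : realType) (P : probability T R) (W : R -> R -> {RV P >-> R}) (w : R)
    (n k : nat) :
  measurable [set o | dyadic_crossing (fun y : R => W y 0 o) w n k].
Proof.
have -> : [set o | dyadic_crossing (fun y : R => W y 0 o) w n k] =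
    (fun o => (dyadic_slope (fun y : R => W y 0 o) n k,
      (W (dyadic R n k) 0 o + W (dyadic R n k.+1) 0 o) / 2)) @^-1`
    crossing_set (2 ^+ n)^-1 w.
  by apply/seteqP; split => o /dyadic_crossingE.
rewrite -[X in measurable X]setTI.
apply: measurable_fun_pair measurableT _ (measurable_crossing_set _ _).
  exact: measurable_dyadic_slope.
by apply: measurable_funM => //; exact: measurable_funD.
Qed.

Lemma crossings_indicE (R : realType) (F : R -> R) (w : R) (n : nat) :
  (crossings F w n)%:R%:E =
  (\sum_(0 <= k < 2 ^ n) ((dyadic_crossing F w n k)%:R : R)%:E)%E.
Proof. by rewrite /crossings natr_sum sumEFin. Qed.

Lemma measurable_dyadic_crossing_indic (d : measure_display) (T : measurableType d)
    (R : realType) (P : probability T R) (W : R -> R -> {RV P >-> R}) (w : R)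
    (n k : nat) :
  measurable_fun setT
    (fun o => ((dyadic_crossing (fun y : R => W y 0 o) w n k)%:R : R)%:E : \bar R).
Proof.
apply/measurable_EFinP.
rewrite (_ : (fun _ => _) = \1_[set o | dyadic_crossing (fun y : R => W y 0 o) w n k]).
  by apply: measurable_indic; exact: measurable_dyadic_crossing.
by apply/funext => o; rewrite indicE mem_setE.
Qed.

Lemma measurable_crossings (d : measure_display) (T : measurableType d)
    (R : realType) (P : probability T R) (W : R -> R -> {RV P >-> R}) (w : R)
    (n : nat) :
  measurable_fun setT (fun o => (crossings (fun y : R => W y 0 o) w n)%:R%:E : \bar R).
Proof.
under eq_fun do rewrite crossings_indicE.
apply: emeasurable_sum => k; exact: measurable_dyadic_crossing_indic.
Qed.

(** The covariance depends on the mesh only, so the [2 ^ n] cells contribute equally. *)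
Lemma expected_crossings (d : measure_display) (T : measurableType d)
    (R : realType) (P : probability T R) (g : R) (S : R -> R -> R)
    (W : R -> R -> {RV P >-> R}) (s t w : R) (n : nat) :
  sea_model g S W -> s != 0 -> t != 0 ->
  slope_variance g S (2 ^+ n)^-1 = s ^+ 2 -> mean_variance g S (2 ^+ n)^-1 = t ^+ 2 ->
  (\int[P]_o (crossings (fun y : R => W y 0 o) w n)%:R%:E =
   (2 ^+ n)%:E * normal_pair s t (crossing_set (2 ^+ n)^-1 w))%E.
Proof.
move=> seaW s0 t0 sE tE.
under eq_integral do rewrite crossings_indicE.
rewrite ge0_integral_sum //; last first.
  by move=> k; exact: measurable_dyadic_crossing_indic.
transitivity (\sum_(0 <= k < 2 ^ n) normal_pair s t (crossing_set (2 ^+ n)^-1 w))%E.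
  apply: eq_bigr => k _.
  rewrite -(@normal_pair_law _ _ _ P (fun o => dyadic_slope (fun y : R => W y 0 o) n k)
    (fun o => (W (dyadic R n k) 0 o + W (dyadic R n k.+1) 0 o) / 2)) //; last first.
  - exact: measurable_crossing_set.
  - by move=> a b c; rewrite (sea_model_dyadic_cos n k a b c seaW) sE tE.
  - by apply: measurable_funM => //; exact: measurable_funD.
  - exact: measurable_dyadic_slope.
  have := integral_indic P measurableT (measurable_dyadic_crossing W w n k).
  rewrite setIT => E; transitivity (P [set o | dyadic_crossing (fun y : R => W y 0 o) w n k]).
    by rewrite -E; apply: eq_integral => o _; rewrite indicE mem_setE.
  by congr (P _); apply/seteqP; split => o /dyadic_crossingE.
have : (normal_pair s t (crossing_set (2 ^+ n)^-1 w) \is a fin_num)%E.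
  by apply: fin_num_measure; exact: measurable_crossing_set.
move=> /fineK <-; rewrite sumEFin -EFinM big_const_nat subn0 iter_addr addr0.
by rewrite -[(_ *+ 2 ^ n)%R]mulr_natl natrX.
Qed.

Lemma cvg_normal_peak (R : realType) (s : nat -> R) (l : R) :
  l != 0 -> s n @[n --> \oo] --> l -> normal_peak (s n) @[n --> \oo] --> normal_peak l.
Proof.
move=> l0 sl; rewrite /normal_peak; apply: cvgV.
  rewrite sqrtr_eq0 -ltNge mulrn_wgt0 // mulr_gt0 ?pi_gt0 //.
  by rewrite exprn_even_gt0.
apply: continuous_cvg; first exact: sqrt_continuous.
rewrite -mulr_natl; under eq_fun do rewrite -mulr_natl.
by apply: cvgMr; apply: cvgMl; rewrite expr2; under eq_fun do rewrite expr2; exact: cvgM.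
Qed.

Lemma cvg_crossing_bound (R : realType) (s t v : nat -> R) (ls lt lv w : R) :
  ls != 0 -> lt != 0 -> lv != 0 ->
  s n @[n --> \oo] --> ls -> t n @[n --> \oo] --> lt -> v n @[n --> \oo] --> lv ->
  crossing_bound (s n) (t n) (v n) w @[n --> \oo] --> crossing_bound ls lt lv w.
Proof.
move=> ls0 lt0 lv0 sl tl vl; rewrite /crossing_bound; apply: cvgM.
  by apply: cvgM; exact: cvg_normal_peak.
apply: cvgM => //; apply: continuous_cvg; first exact: continuous_expR.
apply: cvgMr; apply: cvgV; first by rewrite mulrn_eq0.
by rewrite -mulr_natl; under eq_fun do rewrite -mulr_natl; exact: cvgMr.
Qed.

Lemma cvg_expected_crossings (d : measure_display) (T : measurableType d)
    (R : realType) (P : probability T R) (g : R) (S : R -> R -> R)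
    (W : R -> R -> {RV P >-> R}) (l r w : R) :
  sea_model g S W -> 0 < l -> 0 < r ->
  slope_variance g S (2 ^+ n)^-1 @[n --> \oo] --> l ->
  covariance_x g S (2 ^+ n)^-1 @[n --> \oo] --> r ->
  covariance_x g S 0 = r ->
  (\int[P]_o (crossings (fun y : R => W y 0%R o) w n)%:R%:E)%E @[n --> \oo] -->
    (crossing_bound (Num.sqrt l) (Num.sqrt r) l w)%:E.
Proof.
move=> seaW l0 r0 vl rr rho0.
pose v n := slope_variance g S (2 ^+ n)^-1.
pose u n := mean_variance g S (2 ^+ n)^-1.
have ul : u n @[n --> \oo] --> r.
  rewrite /u /mean_variance rho0 (_ : r = (r + r) / 2); last by field.
  apply: cvgMl; apply: cvgD => //; rewrite (_ : (r + r) / 2 = r); last by field.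
  exact: cvg_cst.
pose h n : R := (2 ^+ n)^-1.
pose s n := Num.sqrt (v n); pose t n := Num.sqrt (u n).
have sl : s n @[n --> \oo] --> Num.sqrt l.
  by apply: continuous_cvg => //; exact: sqrt_continuous.
have tl : t n @[n --> \oo] --> Num.sqrt r.
  by apply: continuous_cvg => //; exact: sqrt_continuous.
have [sl0 tr0] : Num.sqrt l != 0 /\ Num.sqrt r != 0.
  by rewrite !lt0r_neq0 ?sqrtr_gt0.
(* The effective slope variance of the lower bound; it has the same limit as [s n ^+ 2]. *)
pose q n := s n ^+ 2 / (1 + h n ^+ 2 * s n ^+ 2 / (4 * t n ^+ 2)).
have sqrl : s n ^+ 2 @[n --> \oo] --> l.
  rewrite -[X in _ --> X](sqr_sqrtr (ltW l0)) expr2.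
  by under eq_fun do rewrite expr2; exact: cvgM.
have sqrt' : t n ^+ 2 @[n --> \oo] --> r.
  rewrite -[X in _ --> X](sqr_sqrtr (ltW r0)) expr2.
  by under eq_fun do rewrite expr2; exact: cvgM.
have ql : q n @[n --> \oo] --> l.
  rewrite -[X in _ --> X]divr1; apply: cvgM => //.
  apply: cvgV; first exact: oner_neq0.
  rewrite -[X in _ --> X]addr0; apply: cvgD; first exact: cvg_cst.
  rewrite (_ : 0 = 0 * 0 * l / (4 * r)); last by rewrite !mul0r.
  apply: cvgM.
    apply: cvgM => //; under eq_fun do rewrite expr2.
    by apply: cvgM; exact: cvg_two_expV.
  by apply: cvgV; [rewrite mulf_neq0 // gt_eqF|exact: cvgMr].
apply: (@squeeze_cvge _ _ _ _
  (fun n => (crossing_bound (s n) (t n) (q n) w)%:E) _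
  (fun n => (crossing_bound (s n) (t n) (s n ^+ 2) w)%:E)).
- near=> n.
  have vn : 0 < v n by near: n; exact: (cvgr_gt _ vl).
  have un : 0 < u n by near: n; exact: (cvgr_gt _ ul).
  have sn : s n != 0 by rewrite lt0r_neq0 // sqrtr_gt0.
  have tn : t n != 0 by rewrite lt0r_neq0 // sqrtr_gt0.
  have h0 : 0 < h n by rewrite invr_gt0 exprn_gt0.
  have hn : 2 ^+ n * h n = 1 by rewrite /h mulfV // expf_neq0.
  rewrite (@expected_crossings _ _ _ P g S W (s n) (t n)) //; last 2 first.
  + by rewrite sqr_sqrtr // ltW.
  + by rewrite sqr_sqrtr // ltW.
  (* The number of cells cancels the mesh in the bounds for one cell. *)
  have scale (b : R) : b%:E = ((2 ^+ n)%:E * (h n * b)%:E)%E.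
    by rewrite -EFinM mulrA hn mul1r.
  rewrite (scale (crossing_bound _ _ (q n) w)) (scale (crossing_bound _ _ (_ ^+ 2) w)).
  have p0 : (0 <= (2 ^+ n)%:E :> \bar R)%E by rewrite lee_fin exprn_ge0.
  apply/andP; split; apply: lee_wpmul2l => //.
    exact: crossing_law_ge.
  exact: crossing_law_le.
- apply: cvg_EFin; first exact: nearW.
  by apply: cvg_crossing_bound => //; rewrite gt_eqF.
- apply: cvg_EFin; first exact: nearW.
  by apply: cvg_crossing_bound => //; rewrite gt_eqF.
Unshelve. all: by end_near. Qed.

(** * From dyadic crossings to zeros *)

Lemma sum_nat_pairs (f : nat -> nat) (m : nat) :
  (\sum_(0 <= j < m.*2) f j = \sum_(0 <= k < m) (f k.*2 + f k.*2.+1))%N.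
Proof.
elim: m => [|m IH]; first by rewrite !big_geq.
by rewrite doubleS !big_nat_recr //= IH addnA.
Qed.

Lemma dyadic_double (R : realType) (n k : nat) : dyadic R n.+1 k.*2 = dyadic R n k.
Proof.
rewrite /dyadic exprS -muln2 natrM; field.
by rewrite expf_neq0.
Qed.

Lemma dyadic_slope_crossing_le0 (R : realType) (F : R -> R) (n k : nat) :
  0 < F (dyadic R n k) -> F (dyadic R n k.+1) <= 0 -> dyadic_slope F n k <= 0.
Proof.
move=> F0 F1; rewrite /dyadic_slope nmulr_rle0 ?exprn_ge0 //; lra.
Qed.

(** When a crossing cell is halved, the sign at the midpoint decides which half inherits the
    crossing. At threshold 0 the slope condition follows from the signs; for other thresholds
    refinement may lose crossings. *)
Lemma crossings_nondecreasing (R : realType) (F : R -> R) :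
  {homo crossings F 0 : m n / (m <= n)%N}.
Proof.
apply: homo_leq => [//||n]; first exact: leq_trans.
rewrite /crossings expnS mul2n sum_nat_pairs; apply: leq_sum => k _.
have [/and3P[F0 F1 _]|//] := boolP (dyadic_crossing F 0 n k).
rewrite /dyadic_crossing -doubleS !dyadic_double F0 F1 /=.
have [mid|mid] := ltP 0 (F (dyadic R n.+1 k.*2.+1)); last first.
  by rewrite /= dyadic_slope_crossing_le0 ?dyadic_double.
by rewrite /= dyadic_slope_crossing_le0 -?doubleS ?dyadic_double.
Qed.

Lemma crossings_mono (R : realType) (F : R -> R) (w w' : R) (n : nat) :
  w <= w' -> (crossings F w n <= crossings F w' n)%N.
Proof.
move=> ww'; apply: leq_sum => k _; rewrite /dyadic_crossing.
case: (0 < _) => //=; case: (_ <= 0) => //=.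
by case: (leP (dyadic_slope F n k) w) => //= /le_trans -> //.
Qed.

(** A reverse Fatou lemma whose integrable majorant is built as the limit of the increasing [g n]:
    monotone convergence gives it the finite integral [b]. The suprema of tails of [f] lie below it
    and decrease to the upper limit. *)
Lemma integral_limn_esup_ge (d : measure_display) (T : measurableType d)
    (R : realType) (mu : {measure set T -> \bar R}) (f g : nat -> T -> \bar R)
    (a b : R) :
  (forall n, measurable_fun setT (f n)) -> (forall n x, 0 <= f n x)%E ->
  (forall n, measurable_fun setT (g n)) -> (forall n x, f n x <= g n x)%E ->
  (forall x, nondecreasing_seq (g ^~ x)) ->
  (\int[mu]_x f n x)%E @[n --> \oo] --> a%:E ->
  (\int[mu]_x g n x)%E @[n --> \oo] --> b%:E ->
  (a%:E <= \int[mu]_x limn_esup (f ^~ x))%E.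
Proof.
move=> mf f0 mg fg ndg fa gb.
have g0 n x : (0 <= g n x)%E := le_trans (f0 n x) (fg n x).
pose G x := limn (g ^~ x).
have GE x : G x = ereal_sup (range (g ^~ x)).
  by apply/cvg_lim => //; exact: ereal_nondecreasing_cvgn.
have gG n x : (g n x <= G x)%E.
  by rewrite GE; apply: ereal_sup_ubound; exists n.
have mG : measurable_fun setT G.
  apply: (@emeasurable_fun_cvg _ _ _ setT g) => // x _.
  by rewrite GE; exact: ereal_nondecreasing_cvgn.
have G0 x : (0 <= G x)%E := le_trans (g0 0 x) (gG 0 x).
have iG : (\int[mu]_x G x = b%:E)%E.
  apply: (@cvg_unique _ (@ereal_hausdorff R) _ _ _ _ _ gb).
  exact: (@cvg_monotone_convergence _ _ _ mu setT measurableT g).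
have iiG : mu.-integrable setT G.
  apply/integrableP; split => //.
  by under eq_integral do rewrite gee0_abs //; rewrite iG ltry.
have fG n x : (f n x <= G x)%E := le_trans (fg n x) (gG n x).
pose F n x := esups (f ^~ x) n.
have F0 n x : (0 <= F n x)%E.
  by apply: (le_trans (f0 n x)); apply: ereal_sup_ubound; exists n => /=.
have FG n x : (F n x <= G x)%E.
  by apply: ge_ereal_sup => _ [k _ <-].
have mF n : measurable_fun setT (F n) by exact: measurable_fun_esups.
have [||||_ _ /= Fcvg] := @dominated_convergence _ _ _ mu setT measurableT F
  (fun x => limn_esup (f ^~ x)) G mF.
- exact: measurable_fun_limn_esup.
- apply: aeW => x _; rewrite limn_esup_lim; exact: is_cvg_esups.
- exact: iiG.
- by apply: aeW => x n _; rewrite gee0_abs.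
apply: (lee_cvg_to fa Fcvg); apply: nearW => n; apply: ge0_le_integral => //.
by move=> x _; apply: ereal_sup_ubound; exists n => /=.
Qed.

Lemma joint_density_value_neq0 (d : measure_display) (T : measurableType d)
    (R : realType) (P : probability T R) (X Y : T -> R) (f : R * R -> R) :
  joint_density P X Y f -> measurable_fun setT Y ->
  measurable [set o | Y o = 0] /\ P [set o | Y o = 0] = 0%E.
Proof.
move=> [mf f0 fE] mY; have [_ z2] := null_axes R.
have mB : measurable ([set: measurableTypeR R] `*` ([set 0%R] : set (measurableTypeR R))).
  by apply: measurableX => //; exact: measurable_set1.
have mY0 : measurable [set o | Y o = 0].
  by rewrite -[X in measurable X]setTI; exact: (mY measurableT _ (measurable_set1 0)).
split => //; transitivity (\int[P]_o (\1_[set o | Y o = 0] o)%:E)%E.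
  by rewrite integral_indic // setIT.
transitivity (\int[P]_o (\1_([set: measurableTypeR R] `*` [set 0%R]) (X o, Y o))%:E)%E.
  apply: eq_integral => o _; rewrite !indicE; congr ((_ : bool)%:R)%:E.
  by apply/idP/idP; rewrite !inE; [move=> Y0; split|case].
rewrite fE // null_set_integral //.
by apply: measurable_funTS; apply/measurable_EFinP.
Qed.

Definition downcrossing_intensity (R : realType) (g : R) (S : R -> R -> R) (w : R) : R :=
  crossing_bound (Num.sqrt (fine (spectral_moment g S 2 0)))
    (Num.sqrt (covariance_x g S 0)) (fine (spectral_moment g S 2 0)) w.

Lemma cvg_crossings_intensity (d : measure_display) (T : measurableType d)
    (R : realType) (P : probability T R) (g : R) (S : R -> R -> R)
    (W : R -> R -> {RV P >-> R}) (f : R * R -> R) (w : R) :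
  sea_model g S W -> as_C1_in_x W ->
  joint_density P (x_derivative W 0 0) (W 0 0) f ->
  (\int[P]_o (crossings (fun y : R => W y 0%R o) w n)%:R%:E)%E @[n --> \oo] -->
    (downcrossing_intensity g S w)%:E.
Proof.
move=> seaW C1 fP.
have [l0 r0] := sea_model_variances_gt0 seaW C1 fP.
exact: (cvg_expected_crossings (w := w) seaW l0 r0 (cvg_slope_variance seaW C1)
  (cvg_covariance_x seaW C1) erefl).
Qed.

Lemma regular_path (d : measure_display) (T : measurableType d)
    (R : realType) (P : probability T R) (W : R -> R -> {RV P >-> R}) (f : R * R -> R) :
  as_C1_in_x W -> joint_density P (x_derivative W 0 0) (W 0 0) f ->
  exists N : set T, [/\ measurable N, P N = 0%E &
  forall o, ~ N o -> [/\ forall x : R, derivable (fun y : R => W y 0%R o) x 1,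
    continuous (derive1 (fun y : R => W y 0%R o)) & W 0 0 o != 0]].
Proof.
move=> C1 fP.
have [N [X [mN N0 mX NX]]] := as_C1_version C1.
have [mZ Z0] := joint_density_value_neq0 fP (measurable_funPT (W 0 0)).
exists (N `|` [set o | W 0 0 o = 0]); split.
- exact: measurableU.
- by rewrite null_set_setU.
- move=> o /not_orP[No /eqP W0]; have [dF cF _ _] := NX o No; split => //.
Qed.

Lemma downcrossing_zeros_le (d : measure_display) (T : measurableType d)
    (R : realType) (P : probability T R) (g : R) (S : R -> R -> R)
    (W : R -> R -> {RV P >-> R}) (f : R * R -> R) (w : R) :
  sea_model g S W -> as_C1_in_x W ->
  joint_density P (x_derivative W 0 0) (W 0 0) f -> w <= 0 ->
  (\int[P]_o counting (downcrossing_zeros (fun y : R => W y 0%R o) w) <=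
   (downcrossing_intensity g S w)%:E)%E.
Proof.
move=> seaW C1 fP.
move=> w0; have [N [mN N0 NP]] := regular_path C1 fP.
pose M n o : \bar R := (crossings (fun y : R => W y 0%R o) w n)%:R%:E.
have mM n : measurable_fun setT (M n) by exact: measurable_crossings.
have M0 n o : (0 <= M n o)%E by rewrite lee_fin.
apply: (@le_trans _ _ (\int[P]_o limn_einf (M ^~ o))%E).
  apply: (ge0_le_integral_off_null mN N0) => [y|y|o No].
  - exact: measure_ge0.
  - by apply: limn_einf_ge; exact: nearW.
  - by have [dF cF F0] := NP o No; exact: zeros_le_crossings.
apply: le_trans (fatou P measurableT mM _) _; first by move=> n o _.
by have [-> _] := cvg_limn_einf_sup (cvg_crossings_intensity (w := w) seaW C1 fP).
Qed.

(** The majorants for the reverse Fatou lemma are the counts at threshold 0, which exceed those at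
    [w <= 0] and whose means converge too. *)
Lemma downcrossing_zeros_ge (d : measure_display) (T : measurableType d)
    (R : realType) (P : probability T R) (g : R) (S : R -> R -> R)
    (W : R -> R -> {RV P >-> R}) (f : R * R -> R) (w w' : R) :
  sea_model g S W -> as_C1_in_x W ->
  joint_density P (x_derivative W 0 0) (W 0 0) f -> w < w' -> w <= 0 ->
  ((downcrossing_intensity g S w)%:E <=
   \int[P]_o counting (downcrossing_zeros (fun y : R => W y 0%R o) w'))%E.
Proof.
move=> seaW C1 fP.
move=> ww' w0; have [N [mN N0 NP]] := regular_path C1 fP.
pose M v n o : \bar R := (crossings (fun y : R => W y 0%R o) v n)%:R%:E.
have mM v n : measurable_fun setT (M v n) by exact: measurable_crossings.
have M0 v n o : (0 <= M v n o)%E by rewrite lee_fin.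
apply: (@le_trans _ _ (\int[P]_o limn_esup (M w ^~ o))%E).
  apply: (@integral_limn_esup_ge _ _ _ P (M w) (M 0) _ (downcrossing_intensity g S 0)) => //.
  - by move=> n o; rewrite lee_fin ler_nat crossings_mono.
  - by move=> o m n mn; rewrite lee_fin ler_nat; exact: crossings_nondecreasing.
  - exact: (cvg_crossings_intensity seaW C1 fP).
  - exact: (cvg_crossings_intensity seaW C1 fP).
apply: (ge0_le_integral_off_null mN N0) => [y|y|o No].
- rewrite limn_esup_lim; apply: lime_ge; first exact: is_cvg_esups.
  apply: nearW => n; apply: le_trans (M0 w n y) _.
  by apply: ereal_sup_ubound; exists n => /=.
- exact: measure_ge0.
- have [dF cF F0] := NP o No; apply: limn_esup_le.
  exact: crossings_le_zeros.
Qed.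

Lemma cvg_downcrossing_intensity (R : realType) (g : R) (S : R -> R -> R)
    (u : nat -> R) (w : R) :
  w <= 0 -> u n @[n --> \oo] --> w ->
  downcrossing_intensity g S (u n) @[n --> \oo] --> downcrossing_intensity g S w.
Proof.
move=> w0 uw; apply: cvgMr; apply: cvgMr.
apply: continuous_cvg; first exact: continuous_expR.
apply: cvgMl; apply: cvgN.
have mw : Num.min (u n) 0 @[n --> \oo] --> Num.min w 0.
  have cm : {for w, continuous (id \min cst 0 : R -> R^o)}.
    by apply: continuous_min; [exact: cvg_id|exact: cvg_cst].
  exact: (cvg_comp _ _ uw cm).
by rewrite expr2; under eq_fun do rewrite expr2; exact: cvgM.
Qed.

(** The closed threshold is enclosed between strict ones, and continuity of the intensity closes the
    gap. Replacing [w] by [min w 0] is harmless, since wave centers have negative slope. *)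
Lemma expected_wave_centers (d : measure_display) (T : measurableType d)
    (R : realType) (P : probability T R) (g : R) (S : R -> R -> R)
    (W : R -> R -> {RV P >-> R}) (f : R * R -> R) (w : R) :
  sea_model g S W -> as_C1_in_x W ->
  joint_density P (x_derivative W 0 0) (W 0 0) f ->
  (\int[P]_o counting (wave_centers W o `&` [set x : R | (x_derivative W x 0 o <= w)%R]) =
   (downcrossing_intensity g S w)%:E)%E.
Proof.
move=> seaW C1 fP.
set m := Num.min w 0.
have m0 : m <= 0 by rewrite /m ge_min lexx orbT.
have -> : downcrossing_intensity g S w = downcrossing_intensity g S m.
  by rewrite /downcrossing_intensity /crossing_bound (min_l m0).
have count_le (A B : T -> set R) : (forall o, A o `<=` B o) ->
    (\int[P]_o counting (A o) <= \int[P]_o counting (B o) :> \bar R)%E.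
  move=> AB; apply: (ge0_le_integral_off_null measurable0 (measure0 _)) => o.
  - exact: measure_ge0.
  - exact: measure_ge0.
  - move=> _; apply: counting_le => s us sA.
    by apply: counting_ge => // x /sA; exact: AB.
have inv0 : (n.+1%:R^-1 : R) @[n --> \oo] --> (0 : R) by exact: cvg_harmonic.
apply/eqP; rewrite eq_le; apply/andP; split; last first.
  have H : (downcrossing_intensity g S (m - n.+1%:R^-1))%:E @[n --> \oo] -->
      (downcrossing_intensity g S m)%:E.
    apply: cvg_EFin; first exact: nearW.
    apply: cvg_downcrossing_intensity => //.
    by rewrite -[X in _ --> X]subr0; apply: cvgB => //; exact: cvg_cst.
  apply: (lee_cvg_to H (cvg_cst _)); apply: nearW => n.
  have i0 : 0 < (n.+1%:R^-1 : R) by rewrite invr_gt0.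
  apply: (le_trans (downcrossing_zeros_ge (w' := m) seaW C1 fP _ _)).
  - by rewrite ltrBlDr ltrDl.
  - by rewrite (le_trans _ m0) // lerBlDr lerDl ltW.
  - apply: count_le => o x [x01 [Fx xm]]; split; last first.
      by apply/ltW/(lt_le_trans xm); rewrite /m ge_min lexx.
    by split=> //; split => //; exact: lt_le_trans xm m0.
(* For [w >= 0] the condition of negative slope is already strict, so no enlarged threshold is
   called for. *)
have [w0|w0] := leP 0 w.
  apply: le_trans (downcrossing_zeros_le seaW C1 fP m0).
  apply: count_le => o x [[x01 [Fx x0]] _]; split => //; split => //.
  by rewrite /m min_r.
have mw : m = w by rewrite /m min_l // ltW.
(* For [w < 0] the enlarged threshold is eventually nonpositive, as [downcrossing_zeros_le]
   demands. *)
have H : (downcrossing_intensity g S (w + n.+1%:R^-1))%:E @[n --> \oo] -->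
    (downcrossing_intensity g S w)%:E.
  apply: cvg_EFin; first exact: nearW.
  apply: cvg_downcrossing_intensity; first exact: ltW.
  by rewrite -[X in _ --> X]addr0; apply: cvgD => //; exact: cvg_cst.
rewrite mw; apply: (lee_cvg_to (cvg_cst _) H); near=> n.
have i0 : 0 < (n.+1%:R^-1 : R) by rewrite invr_gt0.
have iw : (n.+1%:R^-1 : R) <= - w.
  by near: n; apply: (cvgr_le _ inv0); rewrite oppr_gt0.
apply: le_trans (downcrossing_zeros_le (w := w + n.+1%:R^-1) seaW C1 fP _).
  apply: count_le => o x [[x01 [Fx x0]] xw]; split => //; split => //.
  by apply: (le_lt_trans xw); rewrite ltrDl.
by rewrite -lerBrDl sub0r.
Unshelve. all: by end_near. Qed.

(** * The Palm distribution as a ratio of intensities *)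

Lemma palm_slope_cdfE (d : measure_display) (T : measurableType d)
    (R : realType) (P : probability T R) (g : R) (S : R -> R -> R)
    (W : R -> R -> {RV P >-> R}) (f : R * R -> R) (w : R) :
  sea_model g S W -> as_C1_in_x W ->
  joint_density P (x_derivative W 0 0) (W 0 0) f ->
  (palm_slope_cdf W w =
    (downcrossing_intensity g S w)%:E / (downcrossing_intensity g S 0)%:E)%E.
Proof.
move=> seaW C1 fP; rewrite /palm_slope_cdf.
have -> : (\int[P]_o counting (wave_centers W o) =
    \int[P]_o counting (wave_centers W o `&`
      [set x : R | (x_derivative W x 0 o <= 0)%R]))%E.
  apply: eq_integral => o _; congr counting; apply/esym/setIidPl.
  by move=> x [_ [_ /ltW]].
by rewrite !(expected_wave_centers _ seaW C1 fP).
Qed.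

Lemma crossing_bound_ratio (R : realType) (s t v w : R) :
  s != 0 -> t != 0 -> v != 0 ->
  ((crossing_bound s t v w)%:E / (crossing_bound s t v 0)%:E =
   (expR (- (Num.min w 0) ^+ 2 / (v *+ 2)))%:E)%E.
Proof.
move=> s0 t0 v0; rewrite /crossing_bound minxx expr0n oppr0 mul0r expR0 mulr1.
have p0 : normal_peak t * normal_peak s * v != 0.
  by rewrite !mulf_neq0 // gt_eqF // normal_peak_gt0.
rewrite mulrA; move: (_ * v) p0 => c c0.
by rewrite inver (negbTE c0) -EFinM mulrAC mulfV // mul1r.
Qed.

Lemma cond_mean_neg_part (R : realType) (s t w : R) (f : R * R -> R) :
  s != 0 -> t != 0 ->
  (forall z, f (z, 0) = normal_pdf 0 s z * normal_pdf 0 t 0) ->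
  cond_mean_density0 f (fun z => neg_part z * \1_(`]-oo, w]) z) =
    (crossing_bound s t (s ^+ 2) w)%:E.
Proof.
move=> s0 t0 fE; rewrite /crossing_bound -mulrA.
rewrite -(crossing_law_integral w s0 (normal_peak_ge0 t)).
apply: eq_integral => z _; rewrite fE (normal_pdfE 0 t0) /normal_fun.
rewrite subrr expr0n oppr0 mul0r expR0 mulr1; congr EFin; ring.
Qed.

Lemma neg_part_indic (R : realType) (z : R) :
  neg_part z = neg_part z * \1_(`]-oo, 0]) z.
Proof.
rewrite indicE mem_setE in_itv /=; have [z0|z0] := leP z 0; first by rewrite mulr1.
by rewrite mulr0 /neg_part max_r // oppr_le0 ltW.
Qed.

(** The density is the negative part times the standard normal density, divided by the normal peak,
    so the integral is that of [crossing_law_integral] with unit variance. *)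
Lemma neg_rayleigh_pdf_integral (R : realType) (c : R) :
  (\int[lebesgue_measure]_(r in `]-oo, c]) (neg_rayleigh_pdf r)%:E =
   (expR (- (Num.min c 0) ^+ 2 / 2))%:E)%E.
Proof.
have one0 : (1 : R) != 0 by exact: oner_neq0.
have p0 : normal_peak (1 : R) != 0 by rewrite gt_eqF // normal_peak_gt0.
have := @crossing_law_integral R (normal_peak 1)^-1 1 c one0.
rewrite invr_ge0 normal_peak_ge0 => /(_ isT).
rewrite mulKf // expr1n mul1r => <-.
rewrite integral_mkcond; apply: eq_integral => z _.
rewrite patchE mem_setE in_itv /= indicE mem_setE in_itv /=.
case: (leP z c) => zc; last by rewrite mulr0 mul0r mulr0.
rewrite mulr1 (normal_pdfE 0 one0) /normal_fun subr0 expr1n /neg_rayleigh_pdf.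
rewrite /neg_part; congr EFin; have [z0|z0] := ltP z 0.
  by rewrite max_l ?oppr_ge0 1?ltW // mulrCA mulKf.
by rewrite max_r ?oppr_le0 // mul0r mulr0.
Qed.

Theorem theorem6p1 (d : measure_display) (T : measurableType d) (R : realType)
    (P : probability T R) (g : R) (S : R -> R -> R)
    (W : R -> R -> {RV P >-> R})
    (g_gt0 : 0 < g)
    (W_sea : sea_model g S W)
    (W_nondegenerate : exists f : R * R -> R,
       joint_density P (x_derivative W 0 0) (W 0 0) f)
    (W_C1 : as_C1_in_x W) :
  (forall f : R * R -> R,
     joint_density P (x_derivative W 0 0) (W 0 0) f -> continuous f ->
     forall w : R,
       palm_slope_cdf W w =
       (cond_mean_density0 f (fun z : R => (neg_part z * \1_(`]-oo, w]) z)%R) /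
        cond_mean_density0 f (fun z : R => neg_part z))%E) /\
  (forall (d' : measure_display) (T' : measurableType d')
     (P' : probability T' R) (Rm : {RV P' >-> R}),
     (forall A : set R, measurable A ->
        distribution P' Rm A =
        (\int[lebesgue_measure]_(r in A) (neg_rayleigh_pdf r)%:E)%E) ->
     forall w : R,
       palm_slope_cdf W w =
       P' [set o | Num.sqrt (fine (spectral_moment g S 2 0)) * Rm o <= w]).
Proof.
(* [f0] certifies positive variances for both claims; the first claim concerns any continuous
   density [f], which need not be [f0]. *)
have [f0 f0P] := W_nondegenerate.
have [l0 r0] := sea_model_variances_gt0 W_sea W_C1 f0P.
have s0 := lt0r_neq0 (etrans (sqrtr_gt0 _) l0).
have t0 := lt0r_neq0 (etrans (sqrtr_gt0 _) r0).
split=> [f fP cf w|d' T' P' Rm RmE w]; rewrite (palm_slope_cdfE w W_sea W_C1 f0P).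
  have fE z := slope_value_density z 0 W_sea W_C1 fP cf.
  have -> : cond_mean_density0 f (fun z : R => neg_part z) =
      cond_mean_density0 f (fun z => neg_part z * \1_(`]-oo, 0]) z).
    by apply: eq_integral => z _; rewrite -neg_part_indic.
  by rewrite !(cond_mean_neg_part _ s0 t0 fE) (sqr_sqrtr (ltW l0)).
rewrite (crossing_bound_ratio w s0 t0 (lt0r_neq0 l0)).
move: (fine _) l0 => l l0; have sl : 0 < Num.sqrt l by rewrite sqrtr_gt0.
transitivity (distribution P' Rm `]-oo, w / Num.sqrt l]); last first.
  by congr (P' _); apply/seteqP; split => o /=; rewrite in_itv /= ler_pdivlMr // mulrC.
rewrite RmE // neg_rayleigh_pdf_integral; congr (expR _)%:E.
have -> : Num.min (w / Num.sqrt l) 0 = Num.min w 0 / Num.sqrt l.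
  by rewrite -[in LHS](mul0r (Num.sqrt l)^-1) minr_pMl // invr_ge0 ltW.
rewrite expr_div_n (sqr_sqrtr (ltW l0)); field.
by rewrite gt_eqF.
Qed.
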